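(* For $N\ge 2$ let $\zeta_N(s)=\sum_{n\le N}n^{-s}$ and let $J_N$ denote its Jessen function. Then, as $N\to\infty$, $$\frac{J_N(\sigma)}{\log N}\longrightarrow\left(\frac12-\sigma\right)_+$$ locally uniformly for $\sigma\in\mathbb R$, and $$\frac1{\log N}J_N''\longrightarrow\delta_{1/2}$$ weakly as probability measures on $\mathbb R$.
   Context: $x_+=\max\{x,0\}$, and $\delta_{1/2}$ is the Dirac mass at $1/2$. The Jessen function of a finite Dirichlet sum $P(s)=\sum_{n\le N}a_nn^{-s}$ with $a_1\ne0$ is $$J_P(\sigma)=\lim_{T\to\infty}\frac1{2T}\int_{-T}^{T}\log|P(\sigma+it)|\,dt\qquad(\sigma\in\mathbb R);$$ the limit exists and $J_P$ is finite and convex on $\mathbb R$. $J_P''$ denotes its distributional second derivative, a positive Radon measure on $\mathbb R$ (the Lebesgue--Stieltjes measure of the increasing right derivative of $J_P$). Weak convergence means convergence of integrals of all bounded continuous functions. *)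

(* Defs.v *)
From HB Require Import structures.
From mathcomp Require Import all_boot all_order all_algebra.
From mathcomp Require Export complex.
From mathcomp Require Import all_classical all_reals all_analysis.

Set Implicit Arguments.
Unset Strict Implicit.
Unset Printing Implicit Defensive.
Import Order.TTheory GRing.Theory Num.Theory.
Import numFieldNormedType.Exports.
Local Open Scope classical_set_scope.
Local Open Scope ring_scope.

Section dirichlet.
Context {R : realType}.

(* n^{-s} = n^{-Re s} (cos (Im s log n) - i sin (Im s log n)), for n >= 1. *)
Definition natpowN (n : nat) (s : R[i]) : R[i] :=
  (n%:R `^ (- complex.Re s))%:C%C *
  (cos (complex.Im s * ln n%:R) -i* sin (complex.Im s * ln n%:R))%C.

Definition dirichlet_sum (a : nat -> R[i]) (N : nat) (s : R[i]) : R[i] :=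
  \sum_(1 <= n < N.+1) a n * natpowN n s.

Definition zetaN (N : nat) : R[i] -> R[i] := dirichlet_sum (fun=> 1) N.

(* The library's convention ln 0 = 0 is harmless here: a Dirichlet sum with
   a_1 <> 0 has only isolated zeros. *)
Definition log_mean (P : R[i] -> R[i]) (sigma T : R) : R :=
  (2 * T)^-1 *
  \int[lebesgue_measure]_(t in `[- T, T]) ln (Normc.normc (P (sigma +i* t)%C)).

Definition jessen (P : R[i] -> R[i]) (sigma : R) : R :=
  lim (log_mean P sigma T @[T --> +oo]).

End dirichlet.

Section second_derivative.
Context {R : realType}.

Definition right_derivative (f : R -> R) (x : R) : R :=
  lim (h^-1 * (f (x + h) - f x) @[h --> 0^'+]).

Definition as_cumulative (g : R -> R)
  of nondecreasing g /\ right_continuous g : R -> R := g.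

HB.instance Definition _ (g : R -> R)
    (hg : nondecreasing g /\ right_continuous g) :=
  isCumulative.Build R _ R (as_cumulative hg) (proj1 hg) (proj2 hg).

(* The right derivative of a finite convex function is nondecreasing and
   right-continuous, so the zero measure is never selected for such an [f]. *)
Definition second_derivative (f : R -> R) :
    {measure set (measurableTypeR R) -> \bar R} :=
  match pselect (nondecreasing (right_derivative f) /\
                 right_continuous (right_derivative f)) with
  | left h => lebesgue_stieltjes_measure (as_cumulative h)
  | right _ => mzero
  end.

Definition weakly_converges
    (mu : nat -> {measure set (measurableTypeR R) -> \bar R})
    (nu : {measure set (measurableTypeR R) -> \bar R}) : Prop :=
  forall f : R -> R, continuous f -> bounded_fun f ->
    (\int[mu n]_x (f x)%:E)%E @[n --> \oo] --> (\int[nu]_x (f x)%:E)%E.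

End second_derivative.

Section zeta_sections.
Context {R : realType}.

Lemma inv_ln_nat_ge0 (N : nat) : 0 <= (ln (N%:R : R))^-1.
Proof.
rewrite invr_ge0; case: N => [|N]; first by rewrite ln0.
by apply: ln_ge0; rewrite ler1n.
Qed.

Definition jessen_zeta (N : nat) : R -> R := jessen (zetaN N).

Definition normalized_jessen_measure (N : nat) :
    {measure set (measurableTypeR R) -> \bar R} :=
  mscale (NngNum (inv_ln_nat_ge0 N)) (second_derivative (jessen_zeta N)).

End zeta_sections.

(* Main.v *)
Require Import Defs.
From mathcomp Require Import all_boot all_order all_algebra.
From mathcomp Require Import ring lra zify.
From mathcomp Require Import all_classical all_reals all_analysis measurable_realfun.

(**
  Put [J_s] for half the mean of [ln (|zeta_N (sigma + i t)|^2 + s)], [s > 0].  The mean exists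
  because [ln] is a uniform limit of polynomials and because means of trigonometric polynomials
  exist; it does not change when [n^(it)] is multiplied by [e^(i phi(n))] with [phi] completely
  additive.  Van der Corput's estimate makes the mean of the logarithmic singularities uniformly
  small, so [J_s] tends to the Jessen function as [s] tends to [0].

  The shift [sigma + h] is compared with the twists [phi = +-h ln], which amounts to the
  subharmonicity of [ln (|zeta_N|^2 + s)]: this gives the convexity of [J_s], hence of the
  Jessen function [J_N].

  Jensen's inequality and the mean square of [zeta_N] give
  [J_N(sigma) <= (1/2) ln (sum n^(-2 sigma))].  Together with the two ends, where one term of the
  sum dominates, convexity forces the slopes of [J_N] into [[- ln N, 0]] and gives
  [J_N >= - ln 2].  The missing lower bound is [J_N(0) >= (1/2 - e) ln N].  Primes [p] in
  [(N/2, N]] divide no other integer up to [N], so they can be given arbitrary phases; grouping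
  them into [K] blocks and averaging over the phases of the blocks bounds [J_N(0)] below by the
  logarithm of the largest block sum, at least about [sqrt v] for blocks of [v] primes since the
  sum of the squared block moduli is usually close to [K v].  Chebyshev's bound makes [v] nearly
  [N / ln N].

  The measure [J_N''] has total mass [ln N] by the slopes at both ends, and the locally uniform
  limit makes its mass concentrate at [1/2] by comparing the right derivative with slopes.
*)

Set Implicit Arguments.
Unset Strict Implicit.
Unset Printing Implicit Defensive.

(** The means computed explicitly are those of cosine sums, and the constructions are shaped so that
    these suffice. The parameter [s] keeps the argument of [ln] away from [0], where polynomial
    approximation fails; the zeros of zeta_N matter only when [s] tends to [0]. Convexity needs no
    complex analysis: the twist by [h ln n] is the translation [t -> t + h], so the shifts of
    [sigma] and of [t] by [h] and [-h] form a discrete Laplacian, in which both twisted means equal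
    the untwisted one. Averages over phases are finite sums over [2 ^ m] angles, whose defect
    vanishes as [m] grows, so linearity of the mean replaces any exchange of integrals. A block of
    one prime would only give [ln 1 = 0], hence large blocks; their number [K] stays fixed while [N]
    grows, since dividing the primes by [K] costs only a constant in [ln v], and the exceptional [t]
    cost a factor [1 - 4/K]. A lower bound at [0] alone suffices: the slope bound [- ln N] carries
    it to [[0, 1/2]], and convexity through [0] and [1/2], where the upper bound is [o(ln N)],
    carries it to negative [sigma]. *)

(** * Chebyshev's lower bound for the primes in [(n, 2n]] *)

Lemma prod_prime_logn (M m : nat) : 0 < M -> (forall p, prime p -> p %| M -> p <= m) ->
  M = \prod_(0 <= p < m.+1 | prime p) p ^ logn p M.
Proof.
move=> M0 Hm; rewrite {1}(prod_prime_decomp M0) prime_decompE big_map /=.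
rewrite [RHS](bigID (fun p => p \in primes M)) /= [X in _ = _ * X]big1 ?muln1; last first.
  move=> p /andP[pp]; rewrite mem_primes pp M0 /= => npM.
  by rewrite logn_coprime ?expn0 // prime_coprime.
rewrite -[RHS]big_filter; apply: perm_big; apply: uniq_perm; rewrite ?primes_uniq ?filter_uniq ?iota_uniq //.
move=> p; rewrite mem_filter mem_index_iota /= mem_primes.
case pp: (prime p) => //=; rewrite M0 /=.
by case pM: (p %| M) => //=; rewrite ltnS Hm.
Qed.

Lemma prime_dvd_fact (p n : nat) : prime p -> p %| n`! -> p <= n.
Proof.
move=> pp; elim: n => [|n IH]; first by rewrite fact0 dvdn1 => /eqP E; rewrite E in pp.
by rewrite factS Euclid_dvdM // => /orP[/dvdn_leq -> //|/IH /leqW].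
Qed.

Lemma leq_prod_nat (a b : nat) (P : pred nat) (F G : nat -> nat) :
  (forall i, a <= i < b -> P i -> F i <= G i) ->
  \prod_(a <= i < b | P i) F i <= \prod_(a <= i < b | P i) G i.
Proof.
move=> H; rewrite big_seq_cond [X in _ <= X]big_seq_cond.
elim/big_ind2: _ => // [x1 x2 y1 y2 h1 h2|i /andP[]]; first exact: leq_mul.
by rewrite mem_index_iota => *; exact: H.
Qed.

(** The two middle coefficients of row [2k+1] are equal and together at most [2 ^ (2k+1)]. *)
Lemma central_bin_lt (k : nat) : 'C(k.*2.+1, k) <= 4 ^ k.
Proof.
have E : 'C(k.*2.+1, k.+1) = 'C(k.*2.+1, k).
  by rewrite -bin_sub; [congr 'C(_, _)|]; lia.
have : 'C(k.*2.+1, k) + 'C(k.*2.+1, k.+1) <= 2 ^ k.*2.+1.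
  have -> : 2 ^ k.*2.+1 = \sum_(i < k.*2.+2) 'C(k.*2.+1, i).
    rewrite -[2]/(1 + 1) expnDn; apply: eq_bigr => i _; by rewrite !exp1n !muln1.
  have k1 : k < k.*2.+2 by lia.
  have k2 : k.+1 < k.*2.+2 by lia.
  rewrite (bigD1 (Ordinal k1)) //= (bigD1 (Ordinal k2)) /=; last by rewrite -val_eqE /=; lia.
  by rewrite addnA leq_addr.
rewrite E addnn -mul2n expnS leq_pmul2l // -mul2n expnM; exact.
Qed.

(** Erdos' induction: for [m = 2k+1] the primes in [(k+1, 2k+1]] all divide ['C(m, k)], which is at
    most [4 ^ k], and the primes up to [k+1] are left to the induction hypothesis; an even [m > 2]
    adds no prime. *)
Lemma primorial_le (m : nat) : \prod_(0 <= p < m.+1 | prime p) p <= 4 ^ m.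
Proof.
elim/ltn_ind: m => m IH.
have [m2|m2] := leqP m 2.
  by move: m m2 {IH} => [|[|[|//]]] _; rewrite !big_mkcond /= !big_nat_recr //= big_nil.
have [om|em] := boolP (odd m); last first.
  rewrite big_mkcond big_nat_recr //= -big_mkcond /=.
  have -> : prime m = false.
    by apply/negP => /even_prime [E|]; [move: m2; rewrite E|rewrite (negbTE em)].
  rewrite muln1; case: m m2 em IH => // m _ _ /(_ m (ltnSn m)) H.
  by apply: (leq_trans H); rewrite leq_exp2l.
pose k := m./2; have mE : m = k.*2.+1 by rewrite /k; have := odd_double_half m; rewrite om; lia.
have k0 : 0 < k by lia.
have k1m : k.+2 <= m.+1 by lia.
rewrite (@big_cat_nat _ _ _ k.+2) //=.
have h1 : \prod_(0 <= p < k.+2 | prime p) p <= 4 ^ k.+1 by apply: IH; lia.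
have h2 : \prod_(k.+2 <= p < m.+1 | prime p) p <= 'C(m, k).
  have C0 : 0 < 'C(m, k) by rewrite bin_gt0; lia.
  have fE : 'C(m, k) * (k`! * (m - k)`!) = m`! by apply: bin_fact; lia.
  have Cm p : prime p -> p %| 'C(m, k) -> p <= m.
    by move=> pp pC; apply: prime_dvd_fact => //; rewrite -fE dvdn_mulr.
  rewrite [X in _ <= X](prod_prime_logn C0 Cm) [X in _ <= X](@big_cat_nat _ _ _ k.+2) //=.
  rewrite -[X in X <= _]mul1n; apply: leq_mul.
    rewrite big_seq_cond; apply: prodn_cond_gt0 => p /andP[_ pp].
    by rewrite expn_gt0 prime_gt0.
  apply: leq_prod_nat => p /andP[kp pm] pp.
  rewrite -{1}[p]expn1 leq_exp2l ?prime_gt1 // logn_gt0 mem_primes pp C0 /=.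
  have : p %| m`! by apply: dvdn_fact; rewrite prime_gt0.
  rewrite -fE !Euclid_dvdM // => /orP[//|/orP[|]] /(prime_dvd_fact pp); lia.
apply: (leq_trans (leq_mul h1 (leq_trans h2 _))); first by rewrite mE; exact: central_bin_lt.
by rewrite -expnD leq_exp2l //; lia.
Qed.

(** From [n] to [n+1] the right side is multiplied by [4 (2n+1) / (2n)], which exceeds [4]. *)
Lemma central_bin_ge (n : nat) : 0 < n -> 4 ^ n <= n.*2 * 'C(n.*2, n).
Proof.
case: n => // n _; elim: n => [|n IH]; first by [].
have E1 : n.+2 * 'C(n.+2.*2, n.+2) = n.+2.*2 * 'C(n.+1.*2.+1, n.+1).
  by rewrite doubleS -mul_bin_diag.
have E2 : 'C(n.+1.*2.+1, n.+1) = 'C(n.+1.*2.+1, n.+2).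
  by rewrite -bin_sub; [congr 'C(_, _)|]; lia.
have E3 : n.+2 * 'C(n.+1.*2.+1, n.+2) = n.+1.*2.+1 * 'C(n.+1.*2, n.+1).
  by rewrite -mul_bin_diag.
rewrite expnS; apply: (leq_trans (leq_mul (leqnn 4) IH)).
rewrite E2 in E1; move: E1 E3; move: 'C(n.+2.*2, n.+2) 'C(n.+1.*2.+1, n.+2) 'C(n.+1.*2, n.+1) => a b c E1 E3.
have -> : n.+2.*2 * a = 4 * (n.+2 * b) by move: E1; lia.
by rewrite E3 leq_mul2l /= leq_mul2r leqnSn orbT.
Qed.

(** Legendre's formula for [(2n)!] and [n!]. The summands are the carries of [n + n] in base [p],
    hence [0] or [1]. *)
Lemma logn_central_bin (p n : nat) : prime p ->
  logn p 'C(n.*2, n) = \sum_(1 <= k < n.*2.+1) (n.*2 %/ p ^ k - (n %/ p ^ k).*2).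
Proof.
move=> pp.
have C0 : 0 < 'C(n.*2, n) by rewrite bin_gt0; lia.
have fE : 'C(n.*2, n) * (n`! * (n.*2 - n)`!) = (n.*2)`! by apply: bin_fact; lia.
have := congr1 (logn p) fE; rewrite !lognM ?muln_gt0 ?fact_gt0 //.
have -> : n.*2 - n = n by lia.
rewrite !logn_fact // => E.
have ext : \sum_(1 <= k < n.+1) n %/ p ^ k = \sum_(1 <= k < n.*2.+1) n %/ p ^ k.
  rewrite [RHS](@big_cat_nat _ _ _ n.+1) //=; [|lia].
  rewrite [X in _ = _ + X]big_nat_cond [X in _ = _ + X]big1 ?addn0 //.
  move=> k /andP[/andP[nk _] _]; apply: divn_small; apply: leq_trans nk _.
  by apply: ltnW; apply: ltn_expl; exact: prime_gt1.
rewrite ext in E.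
have le k : (n %/ p ^ k).*2 <= n.*2 %/ p ^ k.
  by rewrite leq_divRL ?expn_gt0 ?prime_gt0 // -doubleMl leq_double leq_trunc_div.
have -> : \sum_(1 <= k < n.*2.+1) (n.*2 %/ p ^ k - (n %/ p ^ k).*2) =
    \sum_(1 <= k < n.*2.+1) n.*2 %/ p ^ k - \sum_(1 <= k < n.*2.+1) (n %/ p ^ k).*2.
  by rewrite sumnB.
rewrite -E; under [X in _ = _ - X]eq_bigr do rewrite -addnn.
by rewrite big_split /= addnK.
Qed.

Lemma digit_le (p n k : nat) : 0 < p -> n.*2 %/ p ^ k - (n %/ p ^ k).*2 <= (p ^ k <= n.*2).
Proof.
move=> p0; have pk : 0 < p ^ k by rewrite expn_gt0 p0.
case: (leqP (p ^ k) n.*2) => h; last by rewrite divn_small.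
have := ltn_ceil n pk; have : (n.*2 %/ p ^ k) * p ^ k <= n.*2 := leq_trunc_div _ _.
move: (n.*2 %/ p ^ k) (n %/ p ^ k) (p ^ k) pk => a b c; nia.
Qed.

(** Carries occur only at those [k] with [p ^ k <= 2n], and there are [trunc_log p n.*2] of them at
    most. *)
Lemma pfactor_central_bin_le (p n : nat) : 0 < n -> prime p -> p ^ logn p 'C(n.*2, n) <= n.*2.
Proof.
move=> n0 pp; have p1 := prime_gt1 pp.
have n20 : 0 < n.*2 by lia.
apply: leq_trans (trunc_logP p1 n20); rewrite leq_exp2l // logn_central_bin //.
apply: (@leq_trans (\sum_(1 <= k < n.*2.+1) (p ^ k <= n.*2))).
  by apply: leq_sum => k _; apply: digit_le; exact: prime_gt0.
apply: (@leq_trans (\sum_(1 <= k < n.*2.+1) (k <= trunc_log p n.*2))).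
  by apply: leq_sum => k _; case: (leqP (p ^ k)) => // h; rewrite trunc_log_max.
set t := trunc_log _ _.
have tn : t <= n.*2.
  by apply: leq_trans (trunc_logP p1 n20); apply: ltnW; exact: ltn_expl.
rewrite (@big_cat_nat _ _ _ t.+1) //= [X in _ + X]big_nat_cond [X in _ + X]big1 ?addn0.
  rewrite big_nat (eq_bigr (fun=> 1)); last by move=> k /andP[_]; rewrite ltnS => ->.
  by rewrite -big_nat sum_nat_const_nat subn1 muln1.
by move=> k /andP[/andP[tk _] _]; rewrite leqNgt tk.
Qed.

Lemma pfactor_central_bin_small (p n : nat) : prime p -> n.*2 < p ^ 2 -> p ^ logn p 'C(n.*2, n) <= p.
Proof.
move=> pp h; have p1 := prime_gt1 pp.
rewrite -{3}[p]expn1 leq_exp2l // logn_central_bin //.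
case: n h => [|n] h; first by rewrite big_geq.
rewrite big_ltn; last by rewrite doubleS.
rewrite big_nat_cond big1 ?addn0.
  apply: (leq_trans (digit_le n.+1 1 (prime_gt0 pp))); exact: leq_b1.
move=> k /andP[/andP[k2 _] _]; rewrite divn_small //.
by apply: (leq_trans h); rewrite leq_exp2l.
Qed.

(** For [2n/3 < p <= n] the quotients of [2n] and [n] by [p] are [2] and [1], so [k = 1] gives no
    carry, and [p ^ 2 >= 3 p > 2n] excludes the others. Erdos' argument lives on this gap. *)
Lemma pfactor_central_bin_one (p n : nat) : 2 < n -> prime p -> p <= n -> n.*2 < 3 * p ->
  p ^ logn p 'C(n.*2, n) = 1.
Proof.
move=> n2 pp pn np; have p2 : 2 < p by lia.
rewrite logn_central_bin //.
rewrite big_ltn; last by lia.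
have -> : n.*2 %/ p ^ 1 = 2.
  rewrite expn1; apply/eqP; rewrite eqn_leq -ltnS ltn_divLR ?(ltnW (ltnW p2)) // leq_divRL ?(ltnW (ltnW p2)) //; lia.
have -> : n %/ p ^ 1 = 1.
  rewrite expn1; apply/eqP; rewrite eqn_leq -ltnS ltn_divLR ?(ltnW (ltnW p2)) // leq_divRL ?(ltnW (ltnW p2)) //; lia.
rewrite subnn add0n big_nat_cond big1 ?expn0 //.
move=> k /andP[/andP[k2 _] _]; rewrite divn_small //.
apply: (@leq_trans (p ^ 2)); last by rewrite leq_exp2l //; lia.
by rewrite expnS expn1; nia.
Qed.

Definition upper_primes (n : nat) : seq nat := [seq p <- index_iota n.+1 n.*2.+1 | prime p].

(* Chebyshev's estimate, localised to [(n, 2n]] as in Erdos' proof of Bertrand's postulate. *)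
Lemma upper_primes_bound (n r : nat) : 2 < n -> n.*2 < r.+1 ^ 2 ->
  4 ^ n <= n.*2 ^ (r + size (upper_primes n)).+1 * 4 ^ (n.*2 %/ 3).
Proof.
move=> n2 nr; have n0 : 0 < n by lia.
apply: (leq_trans (central_bin_ge n0)); rewrite expnS -mulnA leq_pmul2l; last by lia.
have C0 : 0 < 'C(n.*2, n) by rewrite bin_gt0; lia.
have fE : 'C(n.*2, n) * (n`! * (n.*2 - n)`!) = (n.*2)`! by apply: bin_fact; lia.
have Cm p : prime p -> p %| 'C(n.*2, n) -> p <= n.*2.
  by move=> pp pC; apply: prime_dvd_fact => //; rewrite -fE dvdn_mulr.
rewrite [X in X <= _](prod_prime_logn C0 Cm).
(* Four ranges of [p]: up to [r] the prime power is at most [2n]; for [r < p <= 2n/3] it is at most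
   [p], since [p ^ 2 > 2n]; for [2n/3 < p <= n] it is [1]; above [n] it is again at most [2n]. The
   second range is then bounded by a primorial. *)
apply: (@leq_trans (\prod_(0 <= p < n.*2.+1 | prime p)
  ((n.*2 ^ (0 < p <= r)) * (n.*2 ^ (n < p)) * (p ^ (p <= n.*2 %/ 3))))).
  apply: leq_prod_nat => p _ pp; have p0 := prime_gt0 pp; rewrite p0 /=.
  have n20 b : 0 < n.*2 ^ b by rewrite expn_gt0; apply/orP; left; lia.
  have [pr|rp] := leqP p r.
    rewrite expn1 -mulnA -[X in X <= _]muln1; apply: leq_mul; first exact: pfactor_central_bin_le.
    by rewrite muln_gt0 n20 expn_gt0 p0.
  rewrite expn0 mul1n.
  have [np|pn] := ltnP n p.
    rewrite expn1 -[X in X <= _]muln1; apply: leq_mul; first exact: pfactor_central_bin_le.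
    by rewrite expn_gt0 p0.
  rewrite expn0 mul1n.
  have [p3|p3] := leqP p (n.*2 %/ 3).
    rewrite expn1; apply: pfactor_central_bin_small => //.
    by apply: (leq_trans nr); rewrite leq_exp2r.
  rewrite expn0 pfactor_central_bin_one //.
  by move: p3; rewrite ltn_divLR // mulnC.
rewrite !big_split /= -!expn_sum expnD; apply: leq_mul; last first.
  apply: leq_trans (primorial_le _).
  have h3 : (n.*2 %/ 3).+1 <= n.*2.+1 by rewrite ltnS leq_div.
  rewrite (@big_cat_nat _ _ _ (n.*2 %/ 3).+1) //= -[X in _ <= X]muln1; apply: leq_mul.
    by apply: leq_prod_nat => p /andP[_]; rewrite ltnS => h _; rewrite h expn1.
  rewrite big_nat_cond big1 // => p /andP[/andP[h _] _].
  by rewrite leqNgt h expn0.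
have n21 : 0 < n.*2 by lia.
apply: leq_mul; rewrite leq_pexp2l //.
  apply: (@leq_trans (\sum_(0 <= p < n.*2.+1) (0 < p <= r))).
    by rewrite big_mkcond; apply: leq_sum => p _; case: (prime p).
  rewrite big_ltn //= add0n.
  have [h|h] := leqP r n.*2.
    rewrite (@big_cat_nat _ _ _ r.+1) //= [X in _ + X]big_nat_cond [X in _ + X]big1 ?addn0.
      rewrite big_nat (eq_bigr (fun=> 1)); last by move=> k /andP[-> /=]; rewrite ltnS => ->.
      by rewrite -big_nat sum_nat_const_nat subn1 muln1.
    by move=> k /andP[/andP[tk _] _]; rewrite [k <= r]leqNgt tk andbF.
  apply: (@leq_trans (\sum_(1 <= p < n.*2.+1) 1)); first by apply: leq_sum => p _; case: (_ && _).
  by rewrite sum_nat_const_nat subn1 muln1 ltnW.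
rewrite size_filter -sum1_count [X in _ <= X]big_mkcond /=.
rewrite big_mkcond (@big_cat_nat _ _ _ n.+1) //=; last by lia.
rewrite big_nat_cond big1 ?add0n.
  by apply: leq_sum => p _; case: (prime p) => //; case: (_ < _).
by move=> p /andP[/andP[_ h] _]; rewrite [n < p]ltnNge -ltnS h; case: ifP.
Qed.

Import Order.TTheory GRing.Theory Num.Theory.
Import numFieldNormedType.Exports.
Local Open Scope classical_set_scope.
Local Open Scope ring_scope.

(** * Means over [[-T, T]] and their limits *)

Section mean.
Context {R : realType}.
Implicit Types (f g : R -> R) (T : R).
Notation mu := (@lebesgue_measure R).

Definition time_mean f T : R := (2 * T)^-1 * \int[mu]_(t in `[- T, T]) f t.

Lemma continuous_integrable f a b : continuous f ->
  mu.-integrable `[a, b] (EFin \o f).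
Proof.
move=> cf; apply: continuous_compact_integrable; first exact: segment_compact.
exact: continuous_subspaceT.
Qed.

Lemma time_meanD f g T : continuous f -> continuous g ->
  time_mean (fun t => f t + g t) T = time_mean f T + time_mean g T.
Proof.
move=> cf cg; rewrite /time_mean RintegralD ?mulrDr//; exact: continuous_integrable.
Qed.

Lemma time_meanZ k f T : continuous f ->
  time_mean (fun t => k * f t) T = k * time_mean f T.
Proof.
move=> cf; rewrite /time_mean RintegralZl 1?mulrCA//; exact: continuous_integrable.
Qed.

Lemma measure_segment (T : R) : 0 < T -> fine (mu `[- T, T]%classic) = 2 * T.
Proof.
move=> T0; rewrite lebesgue_measure_itv/= lte_fin ifT /=; first by ring.
lra.
Qed.

Lemma time_mean_cst (k T : R) : 0 < T -> time_mean (fun=> k) T = k.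
Proof.
move=> T0; rewrite /time_mean Rintegral_cst//= measure_segment//.
by field; rewrite gt_eqF.
Qed.

Lemma le_time_mean_int f g T : 0 < T ->
  mu.-integrable `[- T, T] (EFin \o f) -> mu.-integrable `[- T, T] (EFin \o g) ->
  (forall t, f t <= g t) -> time_mean f T <= time_mean g T.
Proof.
move=> T0 cf cg fg; rewrite /time_mean ler_pM2l ?invr_gt0 ?mulr_gt0//.
by apply: le_Rintegral.
Qed.

Lemma le_time_mean f g T : 0 < T -> continuous f -> continuous g ->
  (forall t, f t <= g t) -> time_mean f T <= time_mean g T.
Proof. by move=> T0 cf cg; apply: le_time_mean_int => //; exact: continuous_integrable. Qed.

Lemma continuous_sum_fun (I : Type) (s : seq I) (P : pred I) (F : I -> R -> R) :
  (forall i, continuous (F i)) -> continuous (fun t => \sum_(i <- s | P i) F i t).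
Proof.
move=> cF; elim: s => [|i s IH].
  by under eq_fun do rewrite big_nil; move=> t; exact: cvg_cst.
under eq_fun do rewrite big_cons; case: (P i) => // t.
by apply: cvgD; [exact: cF|exact: IH].
Qed.

Definition has_mean f (l : R) := time_mean f T @[T --> +oo] --> l.

Lemma near_pinfty_gt0 (P : R -> Prop) : (forall T, 0 < T -> P T) -> \forall T \near +oo, P T.
Proof. by move=> H; near=> T; apply: H; near: T; exact: nbhs_pinfty_gt. Unshelve. all: by end_near. Qed.

Lemma has_meanD f g l m : continuous f -> continuous g ->
  has_mean f l -> has_mean g m -> has_mean (fun t => f t + g t) (l + m).
Proof.
move=> cf cg fl gm; rewrite /has_mean.
under eq_fun do rewrite time_meanD//.
exact: cvgD.
Qed.

Lemma has_meanZ k f l : continuous f ->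
  has_mean f l -> has_mean (fun t => k * f t) (k * l).
Proof.
move=> cf fl; rewrite /has_mean; under eq_fun do rewrite time_meanZ//.
exact: cvgMr.
Qed.

Lemma has_mean_cst k : has_mean (fun=> k) k.
Proof.
apply: cvg_near_cst; apply: near_pinfty_gt0 => T T0.
by rewrite time_mean_cst.
Qed.

Lemma has_mean_sum (I : Type) (s : seq I) (P : pred I) (F : I -> R -> R) (l : I -> R) :
  (forall i, continuous (F i)) -> (forall i, P i -> has_mean (F i) (l i)) ->
  has_mean (fun t => \sum_(i <- s | P i) F i t) (\sum_(i <- s | P i) l i).
Proof.
move=> cF Fl; elim: s => [|i s IH].
  by under eq_fun do rewrite big_nil; rewrite big_nil; exact: has_mean_cst.
under eq_fun do rewrite big_cons; rewrite big_cons; case: ifPn => // Pi.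
by apply: has_meanD => //; [exact: continuous_sum_fun|exact: Fl].
Qed.

Lemma le_has_mean f g l m : continuous f -> continuous g ->
  has_mean f l -> has_mean g m -> (forall t, f t <= g t) -> l <= m.
Proof.
move=> cf cg fl gm fg; apply: (ler_cvg_to fl gm).
by apply: near_pinfty_gt0 => T T0; exact: le_time_mean.
Qed.

Lemma continuous_cos_affine (a b : R) : continuous (fun t : R => cos (t * a + b)).
Proof.
move=> t; have : {for t, continuous (cos \o (fun t : R => t * a + b))}.
  apply: continuous_comp; last exact: continuous_cos.
  by apply: cvgD; [apply: cvgMl|exact: cvg_cst].
by [].
Qed.

Lemma is_derive_affine (a b x : R) : is_derive x (1 : R) (fun t : R => t * a + b) a.
Proof.
have H : is_derive x (1 : R) (fun t : R => a * t) (a *: 1) by apply: is_deriveZ.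
have H2 : is_derive x (1 : R) (fun t : R => a * t + b) (a *: 1 + 0) by apply: is_deriveD.
rewrite /GRing.scale/= mulr1 addr0 in H2.
by under eq_fun do rewrite mulrC.
Qed.

Lemma is_derive_sin_affine (a b x : R) :
  is_derive x (1 : R) (fun t : R => sin (t * a + b)) (a * cos (x * a + b)).
Proof.
have := is_derive1_comp (f := @sin R) (is_derive_sin _) (is_derive_affine a b x).
by rewrite /GRing.scale/= mulrC.
Qed.

Lemma is_derive_cos_affine (a b x : R) :
  is_derive x (1 : R) (fun t : R => cos (t * a + b)) (- a * sin (x * a + b)).
Proof.
have := is_derive1_comp (f := @cos R) (is_derive_cos _) (is_derive_affine a b x).
by rewrite /GRing.scale/= mulrC mulrN mulNr.
Qed.

Lemma is_derive_continuous (f df : R -> R) :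
  (forall x, is_derive x (1 : R) f (df x)) -> continuous f.
Proof.
move=> D x; apply/differentiable_continuous; apply/derivable1_diffP.
by have := D x => -[].
Qed.

Lemma integral_derive (f df : R -> R) (a b : R) : a < b ->
  (forall x, is_derive x (1 : R) f (df x)) -> continuous df ->
  \int[mu]_(t in `[a, b]) df t = f b - f a.
Proof.
move=> ab D cdf; have cf := is_derive_continuous D.
rewrite /Rintegral (@continuous_FTC2 _ _ f)//.
- exact: continuous_subspaceT.
- split.
  + by move=> x _; have := D x => -[].
  + by apply: cvg_at_right_filter; exact: cf.
  + by apply: cvg_at_left_filter; exact: cf.
- by move=> x _; rewrite derive1E; have := D x => -[].
Qed.

(** A nonzero frequency has the bounded primitive [sin (t * a + b) / a], which the factor
    [1 / (2 T)] sends to [0]. *)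
Lemma has_mean_cos (a b : R) :
  has_mean (fun t => cos (t * a + b)) (if a == 0 then cos b else 0).
Proof.
case: eqVneq => [->|a0].
  by under eq_fun do rewrite mulr0 add0r; exact: has_mean_cst.
have D (x : R) : is_derive x (1 : R) (fun t : R => a^-1 * sin (t * a + b)) (cos (x * a + b)).
  have : is_derive x (1 : R) (fun t : R => a^-1 * sin (t * a + b)) (a^-1 *: (a * cos (x * a + b))).
    exact: is_deriveZ (is_derive_sin_affine a b x).
  by rewrite /GRing.scale/= mulKf.
have E T : 0 < T -> time_mean (fun t => cos (t * a + b)) T =
    T^-1 * ((2 * a)^-1 * (sin (T * a + b) - sin (- T * a + b))).
  move=> T0; rewrite /time_mean (integral_derive _ D); [by field; rewrite a0 gt_eqF|lra|].
  exact: continuous_cos_affine.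
apply/cvgrPdist_le => e e0; near=> T.
have T0 : 0 < T by near: T; exact: nbhs_pinfty_gt.
rewrite E// sub0r normrN normrM (ger0_norm (ltW _)) ?invr_gt0//.
rewrite ler_pdivrMl// normrM.
have : `|(2 * a)^-1| * 2 / e <= T by near: T; apply: nbhs_pinfty_ge; rewrite num_real.
rewrite ler_pdivrMr// => h; apply: le_trans h.
apply: ler_wpM2l => //.
apply: (le_trans (ler_normB _ _)).
have := sin_max (T * a + b); have := sin_max (- T * a + b); lra.
Unshelve. all: by end_near. Qed.

End mean.

(** * Trigonometric polynomials with frequencies [ln (a / b)], and their twists *)

Section twisted_trigonometric_polynomials.
Context {R : realType}.
Implicit Types (phi : nat -> R) (F G : (nat -> R) -> R -> R).

Definition completely_additive phi :=
  forall a b : nat, (0 < a)%N -> (0 < b)%N -> phi (a * b)%N = phi a + phi b.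

(* The twist [phi] replaces [n ^ it] by [n ^ it * exp (i phi n)]. *)
Definition twisted_phase phi (ab : nat * nat) (t : R) :=
  t * (ln ab.1%:R - ln ab.2%:R) + (phi ab.1 - phi ab.2).

Definition pos_pair (ab : nat * nat) := ((0 < ab.1) && (0 < ab.2))%N.

(** An entry [((r, p), (a, b))] stands for [r cos (t ln (a / b) + phi a - phi b + p)]. One list
    serves all twists, so the coefficients cannot depend on [phi], and keeping integer pairs instead
    of real frequencies makes resonance the equality [a = b]. *)
Definition trig_poly F := exists2 s : seq ((R * R) * (nat * nat)),
  all (fun x => pos_pair x.2) s &
  forall phi, completely_additive phi -> forall t,
    F phi t = \sum_(x <- s) x.1.1 * cos (twisted_phase phi x.2 t + x.1.2).

Lemma trig_poly_cos ab : pos_pair ab -> trig_poly (fun phi t => cos (twisted_phase phi ab t)).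
Proof.
move=> ab0; exists [:: ((1, 0), ab)] => [|phi _ t]; first by rewrite /= ab0.
by rewrite big_seq1 mul1r addr0.
Qed.

Lemma trig_poly_cst k : trig_poly (fun _ _ => k).
Proof.
exists [:: ((k, 0), (1, 1)%N)] => // phi _ t.
by rewrite big_seq1 /twisted_phase/= !subrr mulr0 !addr0 cos0 mulr1.
Qed.

Lemma trig_polyD F G : trig_poly F -> trig_poly G -> trig_poly (fun phi t => F phi t + G phi t).
Proof.
move=> [s s0 Fs] [u u0 Gu]; exists (s ++ u) => [|phi h t]; first by rewrite all_cat s0.
by rewrite big_cat/= Fs// Gu.
Qed.

Lemma trig_polyZ k F : trig_poly F -> trig_poly (fun phi t => k * F phi t).
Proof.
move=> [s s0 Fs]; exists [seq ((k * x.1.1, x.1.2), x.2) | x <- s] => [|phi h t].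
  by rewrite all_map.
by rewrite big_map Fs// mulr_sumr; apply: eq_bigr => x _; rewrite mulrA.
Qed.

Lemma trig_poly_sum (I : eqType) (s : seq I) (P : pred I) (F : I -> (nat -> R) -> R -> R) :
  (forall i, i \in s -> P i -> trig_poly (F i)) ->
  trig_poly (fun phi t => \sum_(i <- s | P i) F i phi t).
Proof.
elim: s => [|i s IH] h.
  have [u u0 H] := trig_poly_cst 0.
  by exists u => // phi a t; rewrite big_nil -H.
have [|u u0 H] := IH; first by move=> j js; apply: h; rewrite inE js orbT.
have [Pi|Pi] := boolP (P i); last by exists u => // phi a t; rewrite big_cons (negbTE Pi) -H.
have Fi : trig_poly (F i) by apply: h => //; rewrite inE eqxx.
have [|v v0 H2] := @trig_polyD (F i) (fun phi t => \sum_(i <- s | P i) F i phi t) Fi.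
  by exists u.
by exists v => // phi a t; rewrite big_cons Pi -H2.
Qed.

Lemma cosMcos (x y : R) : cos x * cos y = 2^-1 * cos (x + y) + 2^-1 * cos (x - y).
Proof. rewrite cosD cosB; lra. Qed.

Lemma ln_natM (a b : nat) : (0 < a)%N -> (0 < b)%N ->
  ln ((a * b)%:R : R) = ln a%:R + ln b%:R.
Proof. by move=> a0 b0; rewrite natrM lnM ?posrE ?ltr0n. Qed.

Lemma twisted_phaseD phi a b c d t : completely_additive phi ->
  pos_pair (a, b) -> pos_pair (c, d) ->
  twisted_phase phi (a, b) t + twisted_phase phi (c, d) t =
  twisted_phase phi (a * c, b * d)%N t.
Proof.
move=> h /andP[/= a0 b0] /andP[/= c0 d0]; rewrite /twisted_phase/= !ln_natM// !h//; ring.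
Qed.

Lemma twisted_phaseB phi a b c d t : completely_additive phi ->
  pos_pair (a, b) -> pos_pair (c, d) ->
  twisted_phase phi (a, b) t - twisted_phase phi (c, d) t =
  twisted_phase phi (a * d, b * c)%N t.
Proof.
move=> h /andP[/= a0 b0] /andP[/= c0 d0]; rewrite /twisted_phase/= !ln_natM// !h//; ring.
Qed.

(** Product to sum: the pairs [(a, b)] and [(c, d)] combine into [(a c, b d)] and [(a d, b c)].
    Complete additivity of [phi] is what makes its phases follow the same rule as [ln]. *)
Lemma trig_polyM F G : trig_poly F -> trig_poly G -> trig_poly (fun phi t => F phi t * G phi t).
Proof.
move=> [s s0 Fs] [u u0 Gu].
exists ([seq ((2^-1 * x.1.1 * y.1.1, x.1.2 + y.1.2),
              (x.2.1 * y.2.1, x.2.2 * y.2.2)%N) | x <- s, y <- u] ++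
        [seq ((2^-1 * x.1.1 * y.1.1, x.1.2 - y.1.2),
              (x.2.1 * y.2.2, x.2.2 * y.2.1)%N) | x <- s, y <- u]).
  rewrite all_cat; apply/andP; split; apply/allP => _ /allpairsP[[x y] /= [xs yu ->]] /=;
  by move/allP: s0 => /(_ _ xs) /andP[? ?]; move/allP: u0 => /(_ _ yu) /andP[? ?];
    rewrite /pos_pair/= !muln_gt0; apply/andP; split; apply/andP.
move=> phi h t; rewrite Fs// Gu// big_cat/= !big_allpairs_dep/=.
rewrite mulr_suml -big_split/= big_seq [RHS]big_seq; apply: eq_bigr => x xs.
rewrite mulr_sumr -big_split/= big_seq [RHS]big_seq; apply: eq_bigr => y yu.
move: x y xs yu => [[r p] [a b]] [[r' p'] [c d]] xs yu/=.
have xx := allP s0 _ xs; have yy := allP u0 _ yu.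
rewrite -(twisted_phaseD _ h xx yy) -(twisted_phaseB _ h xx yy) mulrACA cosMcos.
set u1 := twisted_phase _ _ _; set u2 := twisted_phase _ _ _.
rewrite (_ : u1 + p + (u2 + p') = u1 + u2 + (p + p')); last by ring.
rewrite (_ : u1 + p - (u2 + p') = u1 - u2 + (p - p')); last by ring.
ring.
Qed.

Lemma trig_polyX F n : trig_poly F -> trig_poly (fun phi t => F phi t ^+ n).
Proof.
move=> hF; elim: n => [|n IH].
  have [u u0 H] := trig_poly_cst 1.
  by exists u => // phi a t; rewrite expr0 -H.
have [u u0 H] := trig_polyM hF IH.
by exists u => // phi a t; rewrite exprS -H.
Qed.

Lemma trig_poly_horner F (p : {poly R}) : trig_poly F -> trig_poly (fun phi t => p.[F phi t]).
Proof.
move=> hF.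
have [|u u0 H] := @trig_poly_sum _ (enum 'I_(size p)) xpredT (fun i phi t => p`_i * F phi t ^+ i).
  by move=> i _ _; apply: trig_polyZ; exact: trig_polyX.
by exists u => // phi a t; rewrite -H// horner_coef big_enum.
Qed.

Lemma continuous_twisted_phase phi ab (p : R) :
  continuous (fun t => cos (twisted_phase phi ab t + p)).
Proof.
under eq_fun do rewrite /twisted_phase -addrA.
exact: continuous_cos_affine.
Qed.

Lemma trig_poly_continuous F phi : trig_poly F -> completely_additive phi -> continuous (F phi).
Proof.
move=> [s s0 Fs] h; rewrite (_ : F phi = fun t => F phi t)//.
under eq_fun do rewrite Fs//.
apply: continuous_sum_fun => x t.
by apply: cvgMr; exact: continuous_twisted_phase.
Qed.

Lemma ln_nat_inj (a b : nat) : (0 < a)%N -> (0 < b)%N -> (ln a%:R == ln b%:R :> R) = (a == b).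
Proof.
move=> a0 b0; apply/eqP/eqP => [|->//] /ln_inj; rewrite !posrE !ltr0n => /(_ a0 b0).
by move/eqP; rewrite eqr_nat => /eqP.
Qed.

Lemma has_mean_twisted_phase phi ab p : pos_pair ab ->
  has_mean (fun t => cos (twisted_phase phi ab t + p)) (if ab.1 == ab.2 then cos p else 0).
Proof.
move=> /andP[a0 b0].
under eq_fun do rewrite /twisted_phase -addrA.
have := @has_mean_cos R (ln ab.1%:R - ln ab.2%:R) (phi ab.1 - phi ab.2 + p).
rewrite subr_eq0 ln_nat_inj//; case: eqVneq => // ->.
by rewrite !subrr add0r.
Qed.

(* Terms with [a <> b] have mean zero, and the resonant ones, [a = b], do not see the twist. *)
Lemma trig_poly_mean F : trig_poly F -> exists l : R,
  forall phi, completely_additive phi -> has_mean (F phi) l.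
Proof.
move=> [s s0 Fs]; exists (\sum_(x <- s) x.1.1 * (if x.2.1 == x.2.2 then cos x.1.2 else 0)).
move=> phi h.
have -> : F phi = fun t => \sum_(x <- s | pos_pair x.2) x.1.1 * cos (twisted_phase phi x.2 t + x.1.2).
  apply/funext => t; rewrite Fs// [RHS]big_mkcond/= big_seq [RHS]big_seq.
  by apply: eq_bigr => x xs; rewrite (allP s0 _ xs).
have -> : \sum_(x <- s) x.1.1 * (if x.2.1 == x.2.2 then cos x.1.2 else 0) =
    \sum_(x <- s | pos_pair x.2) x.1.1 * (if x.2.1 == x.2.2 then cos x.1.2 else 0).
  rewrite [RHS]big_mkcond/= big_seq [RHS]big_seq.
  by apply: eq_bigr => x xs; rewrite (allP s0 _ xs).
apply: has_mean_sum => x.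
  by move=> t; apply: cvgMr; exact: continuous_twisted_phase.
move=> x0; apply: has_meanZ; first exact: continuous_twisted_phase.
exact: has_mean_twisted_phase.
Qed.

End twisted_trigonometric_polynomials.

(** * Polynomial approximation of [ln], and the common mean of [ln (F + s)] *)

Section log_approx.
Context {R : realType}.

(** The polynomial is the Taylor polynomial of [ln] at [B]. The derivative of the difference is then
    exactly [(1 - x / B) ^+ n / x], and the mean value theorem is applied between [x] and [B], where
    the difference vanishes. *)
Lemma ln_sub_poly_bound (B : R) (n : nat) : 0 < B -> exists p : {poly R},
  forall x : R, 0 < x -> x <= B -> `|ln x - p.[x]| <= (1 - x / B) ^+ n / x * B.
Proof.
move=> B0; pose Y : {poly R} := 1 - B^-1 *: 'X.
pose p := - \sum_(k < n) (k.+1%:R^-1)%:P * Y ^+ k.+1.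
have dY : Y^`() = (- B^-1)%:P by rewrite derivB derivC derivZ derivX sub0r alg_polyC polyCN.
have Yx x : Y.[x] = 1 - x / B by rewrite !hornerE mulrC.
have dp x : 0 < x -> p^`().[x] = (1 - (1 - x / B) ^+ n) / x.
  move=> x0; rewrite derivN raddf_sum/= hornerN horner_sum.
  transitivity (B^-1 * \sum_(k < n) (1 - x / B) ^+ k).
    rewrite mulr_sumr -sumrN; apply: eq_bigr => k _.
    rewrite derivM derivC mul0r add0r deriv_exp dY/= hornerM hornerC hornerMn hornerM hornerC horner_exp Yx.
    rewrite -mulr_natr; field; rewrite (gt_eqF B0) -[1]/(1%:R) -natrD pnatr_eq0; lia.
  have := subrX1 (1 - x / B) n; rewrite [1 - x / B - 1](_ : _ = - (x / B)); last by ring.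
  move=> h; apply: (mulfI (lt0r_neq0 x0)); rewrite mulrC mulrA mulrAC; apply: (canRL (mulfK _)).
    by rewrite gt_eqF.
  set S := \sum_(k < n) _ in h *.
  rewrite (_ : 1 - _ ^+ n = - ((1 - x / B) ^+ n - 1)); last by ring.
  rewrite h; field; exact: lt0r_neq0.
exists (p + (ln B - p.[B])%:P) => x x0 xB.
have D (t : R) : 0 < t -> is_derive t (1 : R) (fun t : R => ln t - p.[t]) (t^-1 - p^`().[t]).
  by move=> t0; apply: is_deriveB; exact: is_derive1_ln.
have [||c cx E] := @MVT_segment R (fun t => ln t - p.[t]) (fun t => t^-1 - p^`().[t]) x B xB.
- by move=> t; rewrite in_itv/= => /andP[xt _]; apply: D; exact: lt_trans xt.
- apply: derivable_within_continuous => t; rewrite in_itv/= => /andP[xt _].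
  by have := D t (lt_le_trans x0 xt) => -[].
rewrite hornerD hornerC.
rewrite (_ : ln x - _ = - ((ln B - p.[B]) - (ln x - p.[x]))); last by ring.
move: cx; rewrite in_itv/= => /andP[xc cB]; have c0 := lt_le_trans x0 xc.
rewrite normrN E dp// normrM (ger0_norm (_ : 0 <= B - x)) ?subr_ge0//.
rewrite (_ : c^-1 - _ = (1 - c / B) ^+ n / c); last by field; exact: lt0r_neq0.
have c1 : 0 <= 1 - c / B by rewrite subr_ge0 ler_pdivrMr ?mul1r.
rewrite ger0_norm ?divr_ge0 ?exprn_ge0 ?(ltW c0)//.
apply: ler_pM; rewrite ?divr_ge0 ?exprn_ge0 ?(ltW c0)//; [lra| |lra].
apply: ler_pM; rewrite ?exprn_ge0 ?invr_ge0 ?(ltW c0)//; last by rewrite lef_pV2.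
apply: lerXn2r; rewrite ?nnegrE// ?subr_ge0 ?ler_pdivrMr ?mul1r//.
by rewrite lerB// ler_pM2r ?invr_gt0.
Qed.

Lemma ln_poly_approx (s B e : R) : 0 < s -> s <= B -> 0 < e ->
  exists p : {poly R}, forall x, s <= x <= B -> `|ln x - p.[x]| <= e.
Proof.
move=> s0 sB e0; have B0 := lt_le_trans s0 sB.
have r0 : 0 <= 1 - s / B by rewrite subr_ge0 ler_pdivrMr ?mul1r.
have r1 : `|1 - s / B| < 1.
  by rewrite ger0_norm// ltrBlDr ltrDl divr_gt0.
have e1 : 0 < e * s / B by rewrite divr_gt0 ?mulr_gt0.
have /cvgrPdist_lt/(_ _ e1)[n _ /(_ n (leqnn n))] := cvg_expr r1.
rewrite sub0r normrN ger0_norm ?exprn_ge0// => hn.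
have [p hp] := ln_sub_poly_bound n B0; exists p => x /andP[sx xB].
have x0 := lt_le_trans s0 sx.
apply: (le_trans (hp x x0 xB)).
apply: (@le_trans _ _ ((1 - s / B) ^+ n / s * B)); last first.
  by move: hn; rewrite ltr_pdivlMr// mulrAC ler_pdivrMr// => /ltW.
rewrite ler_pM2r//; apply: ler_pM; rewrite ?exprn_ge0 ?invr_ge0 ?(ltW x0)//.
- by rewrite subr_ge0 ler_pdivrMr ?mul1r.
- apply: lerXn2r; rewrite ?nnegrE// ?subr_ge0 ?ler_pdivrMr ?mul1r//.
  by rewrite lerB// ler_pM2r ?invr_gt0.
- by rewrite lef_pV2.
Qed.

Lemma time_mean_dist (f g : R -> R) (e T : R) : 0 < T -> continuous f -> continuous g ->
  (forall t, `|f t - g t| <= e) -> `|time_mean f T - time_mean g T| <= e.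
Proof.
move=> T0 cf cg h; rewrite ler_norml; apply/andP; split.
  rewrite lerBrDl -[- e](time_mean_cst _ T0) -time_meanD//; last by move=> ?; exact: cvg_cst.
  apply: le_time_mean => //; first by move=> t; apply: cvgD; [exact: cg|exact: cvg_cst].
  by move=> t; have := h t; rewrite ler_norml; lra.
rewrite lerBlDl -[e](time_mean_cst _ T0) -time_meanD//; last by move=> ?; exact: cvg_cst.
apply: le_time_mean => //; first by move=> t; apply: cvgD; [exact: cg|exact: cvg_cst].
by move=> t; have := h t; rewrite ler_norml; lra.
Qed.

(** Approximants with a common mean make the time means of [f i0] Cauchy. Another index [i] is
    reached through the approximants of [i] and [i0] and their common mean [m]: five error terms,
    each at most [e / 5]. *)
Lemma has_mean_approx (I : Type) (P : I -> Prop) (i0 : I) (f : I -> R -> R) :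
  P i0 -> (forall i, P i -> continuous (f i)) ->
  (forall e, 0 < e -> exists2 g : I -> R -> R,
     (forall i, P i -> continuous (g i) /\ (forall t, `|f i t - g i t| <= e)) &
     exists l, forall i, P i -> has_mean (g i) l) ->
  exists l, forall i, P i -> has_mean (f i) l.
Proof.
move=> Pi0 cf H.
have [l hl] : exists l, has_mean (f i0) l.
  suff : cvg (time_mean (f i0) T @[T --> +oo]) by move=> h; exists (lim (time_mean (f i0) T @[T --> +oo])).
  apply/cauchy_cvgP/cauchy_exP => e e0.
  have e2 : 0 < e / 2 by rewrite divr_gt0.
  have [g gf [l gl]] := H _ e2; have [cg fg] := gf _ Pi0.
  have /cvgrPdist_lt/(_ _ e2) gl0 := gl _ Pi0.
  exists l; suff : \forall T \near +oo, `|l - time_mean (f i0) T| < e by [].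
  near=> T; have T0 : 0 < T by near: T; exact: nbhs_pinfty_gt.
  rewrite (_ : l - _ = (l - time_mean (g i0) T) - (time_mean (f i0) T - time_mean (g i0) T)); last by ring.
  apply: (le_lt_trans (ler_normB _ _)); rewrite [ltRHS]splitr.
  apply: ltr_leD; last exact: time_mean_dist (cf _ Pi0) cg fg.
  by near: T.
exists l => i Pi; apply/cvgrPdist_lt => e e0.
have e5 : 0 < e / 5 by rewrite divr_gt0.
have [g gf [m gm]] := H _ e5.
have [cg fg] := gf _ Pi; have [cg0 fg0] := gf _ Pi0.
have /cvgrPdist_lt/(_ _ e5) h1 := gm _ Pi.
have /cvgrPdist_lt/(_ _ e5) h2 := gm _ Pi0.
have /cvgrPdist_lt/(_ _ e5) h3 := hl.
near=> T; have T0 : 0 < T by near: T; exact: nbhs_pinfty_gt.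
have k1 := time_mean_dist T0 (cf _ Pi) cg fg.
have k2 := time_mean_dist T0 (cf _ Pi0) cg0 fg0.
have q1 : `|m - time_mean (g i) T| < e / 5 by near: T.
have q2 : `|m - time_mean (g i0) T| < e / 5 by near: T.
have q3 : `|l - time_mean (f i0) T| < e / 5 by near: T.
move: k1 k2 q1 q2 q3; rewrite !ler_norml !ltr_norml => /andP[? ?] /andP[? ?] /andP[? ?] /andP[? ?] /andP[? ?].
apply/andP; split; lra.
Unshelve. all: by end_near. Qed.

Lemma completely_additive0 : completely_additive (fun _ : nat => 0 : R).
Proof. by move=> a b _ _; rewrite addr0. Qed.

Lemma trig_poly_ln_mean (F : (nat -> R) -> R -> R) (s B : R) : trig_poly F -> 0 < s ->
  (forall phi, completely_additive phi -> forall t, 0 <= F phi t <= B) ->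
  exists l, forall phi, completely_additive phi -> has_mean (fun t => ln (F phi t + s)) l.
Proof.
move=> hF s0 hB.
apply: (@has_mean_approx _ completely_additive (fun=> 0) (fun phi t => ln (F phi t + s))).
- exact: completely_additive0.
- move=> phi h t; have /andP[F0 _] := hB phi h t.
  have : {for t, continuous (@ln R \o (fun t => F phi t + s))}.
    apply: continuous_comp; last by apply: continuous_ln; rewrite ltr_wpDl.
    by apply: cvgD; [exact: trig_poly_continuous|exact: cvg_cst].
  by [].
move=> e e0.
have sB : s <= B + s.
  have /andP[] := hB _ completely_additive0 0; lra.
have [p hp] := ln_poly_approx s0 sB e0.
have hG : trig_poly (fun phi t => p.[F phi t + s]).
  apply: (@trig_poly_horner _ (fun phi t => F phi t + s)).
  by apply: trig_polyD => //; exact: trig_poly_cst.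
exists (fun phi t => p.[F phi t + s]); last exact: trig_poly_mean.
move=> phi h; split; first exact: trig_poly_continuous hG h.
by move=> t; apply: hp; have := hB phi h t; lra.
Qed.

End log_approx.

(** * Measure of sublevel sets under a lower bound for a derivative *)

Section sublevel.
Context {R : realType}.
Notation mu := (@lebesgue_measure R).

Lemma measurable_sublevel (f : R -> R) (d : R) : continuous f ->
  measurable [set t : R | `|f t| < d].
Proof.
move=> cf; apply: open_measurable.
have -> : [set t : R | `|f t| < d] = (fun t => `|f t|) @^-1` [set x | x < d] by [].
apply: open_comp; last exact: open_lt.
by move=> t _; apply: (@continuous_comp _ _ _ f Num.norm); [exact: cf|exact: norm_continuous].
Qed.

Lemma derive_ge_slope (f df : R -> R) (a b lam x y : R) :
  (forall x, is_derive x (1 : R) f (df x)) -> (forall t, a <= t <= b -> lam <= df t) ->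
  a <= x -> x <= y -> y <= b -> f x + lam * (y - x) <= f y.
Proof.
move=> D h ax xy yb.
have [|c] := @MVT_segment R f df x y xy.
  by apply: continuous_subspaceT; exact: is_derive_continuous D.
rewrite in_itv/= => /andP[xc cy] E.
have : lam * (y - x) <= df c * (y - x).
  by apply: ler_wpM2r; rewrite ?subr_ge0// h// (le_trans ax xc) (le_trans cy yb).
by rewrite -E; lra.
Qed.

(* Van der Corput's sublevel estimate. *)
Lemma sublevel_measure (k : nat) (g : nat -> R -> R) (a b lam r : R) :
  (forall i x, is_derive x (1 : R) (g i) (g i.+1 x)) -> 0 < lam -> 0 < r ->
  (forall t, a <= t <= b -> lam <= g k t) ->
  (mu (`[a, b] `&` [set t | `|g 0%N t| < lam * r ^+ k]%R) <= ((4 * 2 ^+ k - 4) * r)%:E)%E.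
Proof.
elim: k g a b lam => [|k IH] g a b lam D lam0 r0 gk.
  rewrite (_ : _ `&` _ = set0) ?measure0 ?expr0 ?mulr1 ?subrr ?mul0r//.
  apply/seteqP; split => // t [/=]; rewrite in_itv/= => tab.
  by rewrite ltNge (le_trans (gk _ tab) (ler_norm _)).
have mE (h : nat -> R -> R) x y d : (forall i x, is_derive x (1 : R) (h i) (h i.+1 x)) ->
    measurable (`[x, y] `&` [set t | `|h 0%N t| < d]%R).
  move=> Dh; apply: measurableI => //; apply: measurable_sublevel.
  exact: is_derive_continuous (Dh 0%N).
pose A := [set t | a <= t <= b /\ g k t < 0].
have slope := derive_ge_slope (D k) gk.
(* [g k] increases at rate at least [lam], so its modulus is at least [lam * r] away from its sign
   change [c], the supremum of [A], or [a] if [A] is empty. A point of [A] is only known to exist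
   within [r] of the supremum, whence the distance [2 * r]. *)
have [c [ac cR cL]] : exists c, [/\ a <= c,
    forall t, c < t -> t <= b -> 0 <= g k t &
    forall t, a <= t -> t <= c - 2 * r -> t <= b /\ g k t <= - (lam * r)].
  have [/set0P A0|/negP] := boolP (A != set0); last first.
    move/negP/negPn/eqP => A0; exists a; split => // [t at_ tb|t at_ ta].
      rewrite leNgt; apply/negP => gt; suff : A t by rewrite A0.
      by split => //; rewrite (ltW at_).
    by move: r0 at_ ta; lra.
  have hA : has_sup A by split => //; exists b => t [/andP[]].
  have ub := sup_upper_bound hA.
  have cb : sup A <= b by apply: sup_le_ub => //; move=> t [/andP[]].
  have [t0 At0] := A0; have ac : a <= sup A by apply: (le_trans _ (ub _ At0)); case: At0 => /andP[].
  exists (sup A); split => // [t ct tb|t at_ tc].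
    rewrite leNgt; apply/negP => gt; have : t <= sup A by apply: ub; split => //; rewrite tb (le_trans ac (ltW ct)).
    by rewrite leNgt ct.
  have [t1 [/andP[at1 t1b] gt1] ct1] := sup_adherent r0 hA.
  split; first lra.
  have tt1 : t <= t1 by lra.
  have := slope t t1 at_ tt1 t1b.
  have : lam * r <= lam * (t1 - t) by rewrite ler_pM2l//; lra.
  lra.
set E := `[a, b] `&` _.
pose E1 := `[a, c - 2 * r] `&` [set t | `|g 0%N t| < lam * r * r ^+ k].
pose E2 := `[c + 2 * r, b] `&` [set t | `|g 0%N t| < lam * r * r ^+ k].
pose W := `[c - 2 * r, c + 2 * r]%classic : set R.
have sub : E `<=` E1 `|` (W `|` E2).
  move=> t [/=]; rewrite in_itv/= => /andP[at_ tb]; rewrite exprS mulrA => ht.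
  have [t1|t1] := leP t (c - 2 * r); first by left; split => //=; rewrite in_itv/= at_.
  right; have [t2|t2] := leP t (c + 2 * r); first by left; rewrite /W/= in_itv/= (ltW t1).
  by right; split => //=; rewrite in_itv/= tb (ltW t2).
have lr0 : 0 < lam * r by rewrite mulr_gt0.
have m1 : (mu E1 <= ((4 * 2 ^+ k - 4) * r)%:E)%E.
  have -> : E1 = `[a, c - 2 * r] `&` [set t | `|- g 0%N t| < lam * r * r ^+ k].
    by rewrite /E1; congr (_ `&` _); apply/funext => t /=; rewrite normrN.
  apply: (IH (fun i t => - g i t)) => // t /andP[at_ tc].
  by have [_] := cL t at_ tc; rewrite lerNr.
have m2 : (mu E2 <= ((4 * 2 ^+ k - 4) * r)%:E)%E.
  apply: IH => // t /andP[ct tb].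
  have h1 : a <= t - r by lra.
  have h2 : t - r <= t by lra.
  have := slope _ _ h1 h2 tb.
  have : 0 <= g k (t - r) by apply: cR; lra.
  rewrite (_ : t - (t - r) = r); lra.
have m3 : (mu W <= (4 * r)%:E)%E.
  rewrite /W lebesgue_measure_itv/= lte_fin; case: ifPn => // _.
    by rewrite -EFinB lee_fin; lra.
  by rewrite lee_fin mulr_ge0// ltW.
have mE1 : measurable E1 by exact: mE.
have mE2 : measurable E2 by exact: mE.
have mW : measurable W by exact: measurable_itv.
apply: (@le_trans _ _ (mu (E1 `|` (W `|` E2)))).
  apply: le_measure => //; rewrite inE; first exact: mE.
  by apply: measurableU => //; exact: measurableU.
apply: (le_trans (measureU2 _ _ _)) => //; first exact: measurableU.
(* Two uses of the induction hypothesis and a window of length [4 * r]: the constant solves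
   [m (k+1) = 2 m k + 4] with [m 0 = 0]. *)
apply: (le_trans (leeD m1 (le_trans (measureU2 _ _ _) (leeD m3 m2)))) => //.
rewrite -!EFinD lee_fin exprS; lra.
Qed.

End sublevel.

(** * Logarithmic singularities, uniformly in the window *)

Section log_singularity.
Context {R : realType}.
Notation mu := (@lebesgue_measure R).

Lemma ln_add_sub (F s : R) : 0 < F -> 0 <= s -> 0 <= ln (F + s) - ln F <= s / F.
Proof.
move=> F0 s0; apply/andP; split.
  by rewrite subr_ge0 ler_ln ?posrE ?ltr_wpDr ?lerDl.
rewrite -ln_div ?posrE ?ltr_wpDr//.
rewrite (_ : (F + s) / F = 1 + s / F); last by field; exact: lt0r_neq0.
by apply: le_ln1Dx; rewrite (lt_le_trans _ (divr_ge0 s0 (ltW F0)))// ltrN10.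
Qed.

(** Layer-cake bound: every level [L * q ^+ (i0 + i)] lying above [F] pays [ln 2 - ln q], while
    above the first level the difference is at most [s / F]. The latter cost is spread over a
    geometric series so that, after integration, all terms share one geometric majorant. *)
Lemma log_dyadic_bound (L q F s : R) (i0 : nat) : 0 < L -> 0 < q -> q < 1 -> 0 <= F ->
  0 < s -> s <= L * q ^+ i0 -> exists n : nat,
  `|ln (F + s) - ln F| <= \sum_(0 <= i < n.+1)
    (2 * (s / (L * q ^+ i0)) / (2 ^ i.+1)%:R + (ln 2 - ln q) * \1_[set x | x < L * q ^+ (i0 + i)] F).
Proof.
move=> L0 q0 q1 F0 s0 sx; set c := ln 2 - ln q; set x := fun i => L * q ^+ (i0 + i).
have x0 i : 0 < x i by rewrite mulr_gt0 ?exprn_gt0.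
have Lq0 : 0 < L * q ^+ i0 by rewrite mulr_gt0 ?exprn_gt0.
have c0 : 0 < c.
  have : ln q < 0 by apply: ln_lt0; rewrite q0.
  have : 0 < ln (2 : R) by apply: ln_gt0; lra.
  rewrite /c; lra.
have T0 i : 0 <= 2 * (s / (L * q ^+ i0)) / (2 ^ i.+1)%:R.
  by rewrite !mulr_ge0 ?invr_ge0 ?mulr_ge0 ?exprn_ge0 ?(ltW L0) ?(ltW s0) ?(ltW q0).
have key n : (forall i, (i < n)%N -> F < x i) -> c * n%:R <= \sum_(0 <= i < n)
    (2 * (s / (L * q ^+ i0)) / (2 ^ i.+1)%:R + c * \1_[set y | y < L * q ^+ (i0 + i)] F).
  move=> h; rewrite -[n in n%:R]subn0 -sumr_const_nat mulr_sumr.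
  rewrite big_nat [leRHS]big_nat; apply: ler_sum => i /andP[_ ni].
  by rewrite indicE mem_set ?lerDr//=; exact: h.
have [xF|Fx] := leP (L * q ^+ i0) F.
  exists 0%N; rewrite big_nat1; have F1 := lt_le_trans Lq0 xF.
  have /andP[h1 h2] := ln_add_sub F1 (ltW s0).
  rewrite ger0_norm//; apply: (le_trans h2).
  rewrite expn1 [2 * _]mulrC mulfK// (@le_trans _ _ (s / (L * q ^+ i0)))//.
    by rewrite ler_pM2l// lef_pV2.
  by rewrite lerDl mulr_ge0// ?(ltW c0)// indicE.
(* As [ln 0 = 0], the left side is the finite number [|ln s|]; [0] lies below every level, so enough
   levels pay for it. *)
have [F1|F1] := eqVneq F 0.
  exists (Num.truncn (`|ln (F + s) - ln F| / c)).
  apply: le_trans (key _ _); last by move=> i _; rewrite F1.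
  by rewrite mulrC -ler_pdivrMr// ltW// truncnS_gt.
have F2 : 0 < F by rewrite lt_neqAle eq_sym F1.
have ex : exists j, x j <= F.
  have := @cvg_expr R q; rewrite ger0_norm ?(ltW q0)// => /(_ q1) /cvgrPdist_lt/(_ (F / L)).
  move=> /(_ (divr_gt0 F2 L0)) [j _ /(_ (i0 + j)%N (leq_addl _ _))].
  rewrite sub0r normrN ger0_norm ?exprn_ge0 ?(ltW q0)// ltr_pdivlMr// => h.
  by exists j; rewrite /x mulrC ltW.
pose j := ex_minn ex; have jF : x j <= F by rewrite /j; case: ex_minnP.
have jm i : (i < j)%N -> F < x i.
  move=> ij; rewrite ltNge; apply/negP => h; move: ij; rewrite /j; case: ex_minnP => m _ /(_ _ h).
  by move=> a b; have := leq_trans b a; rewrite ltnn.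
have j0 : (0 < j)%N.
  rewrite lt0n; apply/eqP => E; move: jF; rewrite E /x addn0 leNgt.
  by rewrite Fx.
exists j.-1; rewrite prednK//; apply: le_trans (key _ jm).
have /andP[h1 _] := ln_add_sub F2 (ltW s0); rewrite ger0_norm//.
have h2 : ln (F + s) <= ln 2 + ln (L * q ^+ i0).
  rewrite -lnM ?posrE// ler_ln ?posrE ?addr_gt0 ?mulr_gt0 ?exprn_gt0//.
  by rewrite mulr_natl mulr2n lerD// ltW.
have h3 : ln (L * q ^+ i0) + ln q * j%:R <= ln F.
  by rewrite mulr_natr -lnXn// -lnM ?posrE ?exprn_gt0// -mulrA -exprD;
    rewrite ler_ln ?posrE//; exact: (x0 j).
have h4 : ln 2 * 1 <= ln 2 * j%:R :> R.
  by rewrite ler_wpM2l ?ler1n// ln_ge0//; lra.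
rewrite (_ : c * j%:R = ln 2 * j%:R - ln q * j%:R); [lra|by rewrite /c; ring].
Qed.

(** Sublevel sets shrink geometrically while each further level costs a constant, so the layer-cake
    series converges to a bound proportional to [T]. This gives both integrability and an error
    uniform in [T >= 1]. *)
Lemma log_singularity_mean (F : R -> R) (L q C : R) : continuous F -> (forall t, 0 <= F t) ->
  0 < L -> 0 < q -> q < 1 -> 0 < C ->
  (forall (T : R) (i : nat), 1 <= T ->
    (mu (`[(- T)%R, T] `&` [set t | (F t < L * q ^+ i)%R]) <= (C * T / (2 ^ i)%:R)%:E)%E) ->
  (forall T, mu.-integrable `[- T, T] (EFin \o (@ln R \o F))) /\
  forall d, 0 < d -> exists2 s0, 0 < s0 & forall s T, 0 < s -> s < s0 -> 1 <= T ->
    `|time_mean (fun t => ln (F t + s)) T - time_mean (@ln R \o F) T| <= d.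
Proof.
move=> cF F0 L0 q0 q1 C0 muE.
have mF (D : set R) : measurable_fun D (@ln R \o F).
  apply: measurable_funTS; apply: measurableT_comp; first exact: measurable_ln.
  exact: continuous_measurable_fun.
have cFs s : 0 < s -> continuous (fun t => ln (F t + s)).
  move=> s0 t; have : {for t, continuous (@ln R \o (fun t => F t + s))}.
    apply: continuous_comp; last by apply: continuous_ln; rewrite ltr_wpDl.
    by apply: cvgD; [exact: cF|exact: cvg_cst].
  by [].
have [c cE] : exists c, c = ln 2 - ln q by exists (ln 2 - ln q).
have c0 : 0 < c.
  have : ln q < 0 by apply: ln_lt0; rewrite q0.
  have : 0 < ln (2 : R) by apply: ln_gt0; lra.
  rewrite cE; lra.
pose E i := [set t | F t < L * q ^+ i].
have mE i : measurable (E i).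
  apply: open_measurable.
  have -> : E i = F @^-1` [set x | x < L * q ^+ i] by [].
  by apply: open_comp => //; exact: open_lt.
have main s T i0 : 1 <= T -> 0 < s -> s <= L * q ^+ i0 ->
    (\int[mu]_(t in `[(- T)%R, T]) `|(ln (F t + s) - ln (F t))%R%:E| <=
     (4 * T * (s / (L * q ^+ i0)) + 2 * c * C * T / (2 ^ i0)%:R)%:E)%E.
  move=> T1 s0 sx; have T0 : 0 < T by lra.
  pose f i t : \bar R := (2 * (s / (L * q ^+ i0)) / (2 ^ i.+1)%:R + c * \1_(E (i0 + i)%N) t)%:E.
  have a0 i : 0 <= 2 * (s / (L * q ^+ i0)) / (2 ^ i.+1)%:R.
    by rewrite !mulr_ge0 ?invr_ge0 ?mulr_ge0 ?exprn_ge0 ?(ltW L0) ?(ltW s0) ?(ltW q0).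
  have b0 i t : 0 <= c * \1_(E i) t by rewrite mulr_ge0 ?(ltW c0)// indicE.
  have f0 i t : (0 <= f i t)%E by rewrite lee_fin addr_ge0.
  have mf i : measurable_fun `[- T, T] (f i).
    apply/measurable_EFinP; apply: measurable_funTS; apply: measurable_funD => //.
    apply: measurable_funM => //; exact: measurable_indic.
  apply: (@le_trans _ _ (\int[mu]_(t in `[(- T)%R, T]) \sum_(0 <= i <oo) f i t)%E).
    apply: ge0_le_integral => //.
    - apply/measurable_EFinP/measurableT_comp => //; apply: measurable_funB; last exact: mF.
      by apply: measurable_funTS; apply: continuous_measurable_fun; exact: cFs.
    - by apply: (ge0_emeasurable_sum (h := f) (P := xpredT)) => i; [move=> t _ _; exact: f0|move=> _; exact: mf].
    - move=> t _; have [n] := log_dyadic_bound L0 q0 q1 (F0 t) s0 sx; rewrite -cE => hn.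
      apply: le_trans (nneseries_lim_ge n.+1 _) => //.
      rewrite /f sumEFin lee_fin; apply: (le_trans hn); apply: ler_sum => i _.
      by rewrite lerD2l.
  rewrite integral_nneseries//.
  set r := (X in (_ <= X%:E)%E).
  apply: (@le_trans _ _ (\sum_(0 <= i <oo) (r / (2 ^ (i + 1))%:R)%:E)%E).
    apply: lee_nneseries => [i _ _|i _]; first by apply: integral_ge0 => t _; exact: f0.
    under eq_integral do rewrite /f EFinD.
    rewrite ge0_integralD//=.
    - rewrite integral_cst//= lebesgue_measure_itv/= lte_fin ifT; last by lra.
      under eq_integral do rewrite EFinM.
      rewrite ge0_integralZl//.
      + rewrite integral_indic//.
        have h : (c%:E * mu (E (i0 + i)%N `&` `[(- T)%R, T]) <= c%:E * (C * T / (2 ^ (i0 + i))%:R)%:E)%E.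
          by apply: lee_wpmul2l; [rewrite lee_fin ltW|rewrite setIC; exact: muE].
        apply: (@le_trans _ _ ((2 * (s / (L * q ^+ i0)) / (2 ^ i.+1)%:R * (T - - T)) + c * (C * T / (2 ^ (i0 + i))%:R))%:E).
          by rewrite [leRHS]EFinD [in leRHS]EFinM; apply: leeD; rewrite -?EFinD -?EFinM.
        rewrite lee_fin /r expnD addn1 expnS !natrM le_eqVlt; apply/orP; left; apply/eqP.
        field; rewrite !pnatr_eq0 -!lt0n !expn_gt0/= (gt_eqF L0).
        by rewrite andbT expf_neq0// gt_eqF.
      + exact: mE.
      + by apply/measurable_EFinP; apply: measurable_funTS; apply: measurable_indic; exact: mE.
      + by rewrite lee_fin ltW.
    - by move=> t _; rewrite lee_fin.
    - by move=> t _; rewrite lee_fin.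
    - apply/measurable_EFinP; apply: measurable_funTS; apply: measurable_funM => //.
      apply: measurable_indic; exact: mE.
  have /cvg_lim := @cvg_geometric_eseries_half R r 0; rewrite expr0 divr1 => -> //.
have int T : mu.-integrable `[- T, T] (EFin \o (@ln R \o F)).
  wlog T1 : T / 1 <= T => [H|].
    have [/H//|T1] := leP 1 T.
    apply: integrableS (H 1 (lexx _)) => //.
    by move=> t/=; rewrite !in_itv/=; lra.
  have Lq0 : 0 < L * q ^+ 0 by rewrite mulr_gt0 ?exprn_gt0.
  have i1 : mu.-integrable `[- T, T] (EFin \o (fun t => ln (F t + L * q ^+ 0))).
    by apply: continuous_integrable; exact: cFs.
  have i2 : mu.-integrable `[- T, T] (fun t => (ln (F t + L * q ^+ 0) - ln (F t))%:E).
    apply/integrableP; split.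
      apply/measurable_EFinP; apply: measurable_funB; last exact: mF.
      by apply: measurable_funTS; apply: continuous_measurable_fun; exact: cFs.
    by apply: (le_lt_trans (main _ _ _ T1 Lq0 (lexx _))); rewrite ltry.
  apply: eq_integrable (integrableB _ i1 i2) => // t _ /=.
  by rewrite -EFinB; congr (_%:E); ring.
split => // d d0.
(* First [i0] reduces the cost of the levels to [d / 2]; then [s] is taken small against
   [L * q ^+ i0], so that the other term, divided by [2 * T], is at most [2 * (d / 4)]. *)
have [i0 hi0] : exists i0 : nat, c * C / (2 ^ i0)%:R <= d / 2.
  have h12 : `|2^-1 : R| < 1 by rewrite ger0_norm; lra.
  have e0 : 0 < d / 2 / (c * C) by rewrite !divr_gt0 ?mulr_gt0.
  have /cvgrPdist_lt/(_ _ e0)[n _ /(_ n (leqnn n))] := cvg_expr h12.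
  rewrite sub0r normrN ger0_norm ?exprn_ge0 ?invr_ge0// ltr_pdivlMr ?mulr_gt0// => h.
  by exists n; rewrite natrX -exprVn mulrC ltW.
have Lq0 : 0 < L * q ^+ i0 by rewrite mulr_gt0 ?exprn_gt0.
exists (L * q ^+ i0 * Num.min 1 (d / 4)).
  by rewrite mulr_gt0// lt_min ltr01 divr_gt0.
move=> s T s0 ss T1; have T0 : 0 < T by lra.
have sL : s <= L * q ^+ i0.
  apply: (le_trans (ltW ss)); rewrite ger_pMr// ge_min lexx//.
have sd : s / (L * q ^+ i0) <= d / 4.
  rewrite ler_pdivrMr// mulrC; apply: (le_trans (ltW ss)).
  by rewrite ler_pM2l// ge_min lexx orbT.
have ci : mu.-integrable `[- T, T] (EFin \o (fun t => ln (F t + s))).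
  by apply: continuous_integrable; exact: cFs.
rewrite /time_mean -mulrBr -RintegralB// normrM ger0_norm; last by rewrite invr_ge0; lra.
rewrite ler_pdivrMl ?mulr_gt0//.
rewrite -lee_fin EFin_normr_Rintegral//; last first.
  by apply: eq_integrable (integrableB _ ci (int T)).
apply: (le_trans (le_abse_integral _ _ _)) => //.
  apply/measurable_EFinP; apply: measurable_funB; last exact: mF.
  by apply: measurable_funTS; apply: continuous_measurable_fun; exact: cFs.
apply: (le_trans (main _ _ _ T1 s0 sL)); rewrite lee_fin.
have := ler_wpM2l (ltW T0) sd; have := ler_wpM2l (ltW T0) hi0.
rewrite (_ : 2 * c * C * T / (2 ^ i0)%:R = 2 * (T * (c * C / (2 ^ i0)%:R))); last by ring.
lra.
Qed.

End log_singularity.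

(** * Sublevel estimate on long windows *)

Section uniform_sublevel.
Context {R : realType}.
Notation mu := (@lebesgue_measure R).

Lemma measure_cover_segments (E : set R) (h M a : R) (n : nat) : measurable E -> 0 <= h -> 0 <= M ->
  (forall a, mu (`[a, (a + h)%R] `&` E) <= M%:E)%E ->
  (mu (`[a, (a + h *+ n.+1)%R] `&` E) <= (M *+ n.+1)%R%:E)%E.
Proof.
move=> mE h0 M0 H; elim: n => [|n IH]; first by rewrite !mulr1n; exact: H.
have -> : `[a, a + h *+ n.+2] `&` E =
    (`[a, a + h *+ n.+1] `&` E) `|` (`[a + h *+ n.+1, a + h *+ n.+1 + h] `&` E).
  apply/seteqP; split => t /=.
    rewrite !in_itv/= => -[/andP[at_ tn] Et].
    have [tl|tl] := leP t (a + h *+ n.+1); [left|right]; split => //; rewrite ?at_//.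
    by rewrite (ltW tl)/= -addrA -mulrSr.
  rewrite !in_itv/= => -[[/andP[at_ tn] Et]|[/andP[at_ tn] Et]]; split => //.
    by rewrite at_/= (le_trans tn)// [h *+ n.+2]mulrSr addrA lerDl.
  rewrite mulrSr addrA tn andbT; apply: le_trans at_.
  by rewrite lerDl mulrn_wge0.
apply: (le_trans (measureU2 _ _ _)); rewrite ?[M *+ n.+2]mulrSr ?EFinD; last exact: (leeD IH (H _)).
- exact: measurableI.
- exact: measurableI.
Qed.

(** The bound [Bd] on the next derivative keeps a derivative that is at least [kappa] in modulus
    above [kappa / 2] on an interval of fixed length [h]. Van der Corput's estimate applies there,
    whatever the order [k <= K], and [[-T, T]] is covered by [O(T)] such intervals. *)
Lemma uniform_sublevel_measure (g : nat -> R -> R) (K : nat) (kappa Bd : R) :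
  (forall i x, is_derive x (1 : R) (g i) (g i.+1 x)) -> 0 < kappa -> 0 < Bd ->
  (forall k t, (k <= K.+1)%N -> `|g k t| <= Bd) ->
  (forall t, exists2 k, (k <= K)%N & kappa <= `|g k t|) ->
  exists2 C, 0 < C & forall T r, 1 <= T -> 0 < r -> r <= 1 ->
  (mu (`[(- T)%R, T] `&` [set t | `|g 0%N t| < kappa / 2 * r ^+ K]%R) <= (C * T * r)%:E)%E.
Proof.
move=> D k0 B0 gB gk; pose h := kappa / 2 / Bd.
have h0 : 0 < h by rewrite !divr_gt0.
pose M : R := 4 * 2 ^+ K.
have M0 : 0 < M by rewrite mulr_gt0// exprn_gt0.
have kap2 : 0 < kappa / 2 by rewrite divr_gt0.
have near_ge k t u : (k <= K)%N -> t <= u <= t + h -> `|g k u - g k t| <= kappa / 2.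
  move=> kK /andP[tu uth].
  have [|c _ ->] := @MVT_segment R (g k) (g k.+1) t u tu.
    by apply: continuous_subspaceT; exact: is_derive_continuous (D k).
  rewrite normrM (ger0_norm (_ : 0 <= u - t)) ?subr_ge0//.
  apply: (@le_trans _ _ (Bd * h)); last by rewrite /h mulrCA mulfV ?mulr1// gt_eqF.
  by apply: ler_pM => //; [rewrite subr_ge0|exact: gB|lra].
have loc r : 0 < r -> r <= 1 -> forall a,
    (mu (`[a, (a + h)%R] `&` [set t | `|g 0%N t| < kappa / 2 * r ^+ K]%R) <= (M * r)%:E)%E.
  move=> r0 r1 a; have [k kK ka] := gk a.
  have sub (G : nat -> R -> R) : (forall i x, is_derive x (1 : R) (G i) (G i.+1 x)) ->
      (forall t, `|G 0%N t| = `|g 0%N t|) -> (forall t, a <= t <= a + h -> kappa / 2 <= G k t) ->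
      (mu (`[a, (a + h)%R] `&` [set t | `|g 0%N t| < kappa / 2 * r ^+ K]%R) <= (M * r)%:E)%E.
    move=> DG G0 Gk.
    apply: (@le_trans _ _ (mu (`[a, (a + h)%R] `&` [set t | `|G 0%N t| < kappa / 2 * r ^+ k]%R))).
      apply: le_measure; rewrite ?inE.
      - apply: measurableI => //; apply: measurable_sublevel; exact: is_derive_continuous (D 0%N).
      - apply: measurableI => //; apply: measurable_sublevel; exact: is_derive_continuous (DG 0%N).
      - move=> t [/= ta gt]; split => //=; rewrite G0; apply: (lt_le_trans gt).
        by rewrite ler_pM2l//; apply: ler_wiXn2l => //; rewrite ltW.
    apply: (le_trans (sublevel_measure DG kap2 r0 Gk)).
    rewrite lee_fin ler_pM2r// /M; have : (2 : R) ^+ k <= 2 ^+ K by apply: ler_weXn2l => //; lra.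
    lra.
  have [ga|ga] := leP 0 (g k a).
    apply: (sub g) => // t ta; have := near_ge _ _ _ kK ta.
    by move: ka; rewrite ger0_norm// ler_norml => ? /andP[? _]; lra.
  apply: (sub (fun i t => - g i t)) => [t|t ta]; first by rewrite normrN.
  have := near_ge _ _ _ kK ta.
  by move: ka; rewrite ltr0_norm// ler_norml => ? /andP[_ ?]; lra.
pose C := M * (2 / h + 2).
have C0 : 0 < C by rewrite mulr_gt0// addr_gt0// divr_gt0.
exists C => // T r T1 r0 r1.
have T0 : 0 < T by lra.
have mE : measurable [set t | `|g 0%N t| < kappa / 2 * r ^+ K].
  by apply: measurable_sublevel; exact: is_derive_continuous (D 0%N).
pose n := Num.truncn (2 * T / h).
have nT : 2 * T / h < n.+1%:R by exact: truncnS_gt.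
have nT2 : n%:R <= 2 * T / h by rewrite truncn_le; apply: divr_ge0; [lra|exact: ltW].
apply: (@le_trans _ _ (mu (`[(- T)%R, (- T + h *+ n.+1)%R] `&` [set t | `|g 0%N t| < kappa / 2 * r ^+ K]%R))).
  apply: le_measure; rewrite ?inE; [exact: measurableI|exact: measurableI|].
  apply: setSI => t /=; rewrite !in_itv/= => /andP[-> tT] /=; apply: (le_trans tT).
  by move: nT; rewrite ltr_pdivrMr// mulr_natl; lra.
apply: (le_trans (measure_cover_segments _ _ mE (ltW h0) _ (loc r r0 r1))).
  by rewrite mulr_ge0// ltW.
rewrite lee_fin -mulr_natr (_ : C * T * r = M * r * ((2 / h + 2) * T)); last by rewrite /C; ring.
rewrite ler_pM2l ?mulr_gt0// -natr1 mulrDl (_ : 2 / h * T = 2 * T / h); last by ring.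
lra.
Qed.

End uniform_sublevel.

(** * Dirichlet sums with real coefficients and their regularised logarithmic means *)

Section dirichlet_mean.
Context {R : realType}.
Notation mu := (@lebesgue_measure R).
Implicit Types (c : nat -> R) (N : nat) (phi : nat -> R).

(** Real and imaginary parts of the sum of [c n * n ^ (i t) * exp (i phi n)]. This is the conjugate
    of the Dirichlet sum when [phi = 0], so the squared modulus [dsq] is the same. *)
Definition dcos c N phi t : R := \sum_(1 <= n < N.+1) c n * cos (t * ln n%:R + phi n).
Definition dsin c N phi t : R := \sum_(1 <= n < N.+1) c n * sin (t * ln n%:R + phi n).
Definition dsq c N phi t : R := dcos c N phi t ^+ 2 + dsin c N phi t ^+ 2.

Lemma dsqE c N phi t : dsq c N phi t =
  \sum_(1 <= n < N.+1) \sum_(1 <= m < N.+1) c n * c m * cos (twisted_phase phi (n, m) t).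
Proof.
rewrite /dsq /dcos /dsin !expr2 !mulr_suml -big_split/=; apply: eq_bigr => n _.
rewrite !mulr_sumr -big_split/=; apply: eq_bigr => m _.
have -> : twisted_phase phi (n, m) t = (t * ln n%:R + phi n) - (t * ln m%:R + phi m).
  by rewrite /twisted_phase/=; ring.
rewrite cosB; ring.
Qed.

Lemma dsq_ge0 c N phi t : 0 <= dsq c N phi t.
Proof. by rewrite addr_ge0// sqr_ge0. Qed.

Lemma dsq_le c N phi t : dsq c N phi t <= (\sum_(1 <= n < N.+1) `|c n|) ^+ 2.
Proof.
rewrite dsqE expr2 mulr_suml; apply: ler_sum => n _; rewrite mulr_sumr; apply: ler_sum => m _.
apply: (le_trans (ler_norm _)); rewrite !normrM -[leRHS]mulr1; apply: ler_wpM2l.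
  by rewrite mulr_ge0.
exact: cos_max.
Qed.

Lemma trig_poly_dsq c N : trig_poly (dsq c N).
Proof.
have [|u u0 H] := @trig_poly_sum R _ (index_iota 1 N.+1) xpredT (fun n phi t =>
  \sum_(1 <= m < N.+1) c n * c m * cos (twisted_phase phi (n, m) t)).
  move=> n; rewrite mem_index_iota => /andP[n0 _] _; apply: trig_poly_sum => m.
  rewrite mem_index_iota => /andP[m0 _] _; apply: trig_polyZ; apply: trig_poly_cos.
  by rewrite /pos_pair/= n0.
by exists u => // phi h t; rewrite dsqE H.
Qed.

Lemma continuous_dsq c N phi : completely_additive phi -> continuous (dsq c N phi).
Proof. exact: trig_poly_continuous (trig_poly_dsq c N). Qed.

Definition reg_jessen c N s : R :=
  2^-1 * lim (time_mean (fun t => ln (dsq c N (fun=> 0) t + s)) T @[T --> +oo]).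

Lemma has_mean_reg_jessen c N s phi : 0 < s -> completely_additive phi ->
  has_mean (fun t => ln (dsq c N phi t + s)) (2 * reg_jessen c N s).
Proof.
move=> s0 h.
have [|l hl] := @trig_poly_ln_mean R (dsq c N) s ((\sum_(1 <= n < N.+1) `|c n|) ^+ 2) (trig_poly_dsq c N) s0.
  by move=> psi _ t; rewrite dsq_ge0 dsq_le.
rewrite /reg_jessen mulrA divff ?mul1r ?pnatr_eq0//.
have -> := cvg_lim _ (hl _ completely_additive0); first exact: hl.
exact: Rhausdorff.
Qed.

Lemma continuous_ln_dsq c N phi s : 0 < s -> completely_additive phi ->
  continuous (fun t => ln (dsq c N phi t + s)).
Proof.
move=> s0 h t; have : {for t, continuous (@ln R \o (fun t => dsq c N phi t + s))}.
  apply: continuous_comp; last by apply: continuous_ln; rewrite ltr_wpDl ?dsq_ge0.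
  by apply: cvgD; [exact: continuous_dsq|exact: cvg_cst].
by [].
Qed.

Lemma cosD_natpi (x : R) (k : nat) : cos (x + k%:R * pi) = (-1) ^+ k * cos x.
Proof.
elim: k => [|k IH]; first by rewrite mul0r addr0 expr0 mul1r.
rewrite -natr1 mulrDl mul1r addrA cosDpi IH exprS; ring.
Qed.

(** The [k]-th derivative of [dcos c N (fun=> 0)]: each differentiation brings down [ln n] and
    shifts the phase by [pi / 2]. *)
Definition dcos_derive c N k t : R :=
  \sum_(1 <= n < N.+1) c n * ln n%:R ^+ k * cos (t * ln n%:R + k%:R * (pi / 2)).

Lemma is_derive_dcos_derive c N k (x : R) :
  is_derive x (1 : R) (dcos_derive c N k) (dcos_derive c N k.+1 x).
Proof.
have -> : dcos_derive c N k = \sum_(i < N) (fun t => c i.+1 * ln i.+1%:R ^+ k * cos (t * ln i.+1%:R + k%:R * (pi / 2))).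
  by apply/funext => t; rewrite fct_sumE /dcos_derive big_add1/= big_mkord.
rewrite /dcos_derive big_add1/= big_mkord; apply: is_derive_sum => i.
have := is_deriveZ (c i.+1 * ln i.+1%:R ^+ k) (is_derive_cos_affine (ln i.+1%:R) (k%:R * (pi / 2)) x).
rewrite /GRing.scale/= (_ : k.+1%:R * (pi / 2) = k%:R * (pi / 2) + pi / 2); last by rewrite -natr1; ring.
rewrite addrA cosDpihalf exprSr.
by congr is_derive; ring.
Qed.

Lemma dcos_derive_bound c N k t : `|dcos_derive c N k t| <= \sum_(1 <= n < N.+1) `|c n| * `|ln n%:R| ^+ k.
Proof.
apply: (le_trans (ler_norm_sum _ _ _)); apply: ler_sum => n _.
rewrite !normrM normrX -[leRHS]mulr1; apply: ler_wpM2l; first by rewrite mulr_ge0 ?exprn_ge0.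
exact: cos_max.
Qed.

(* The operator [prod_(2 <= n <= N) (1 + (ln n)^-2 D^2)] kills every term of the
   real part but the constant one, so the derivatives cannot all be small at once. *)
Lemma dcos_derive_nondegenerate c N : (0 < N)%N -> c 1%N = 1 -> exists K kappa,
  0 < kappa /\ forall t, exists2 k, (k <= K)%N & kappa <= `|dcos_derive c N k t|.
Proof.
move=> N0 c1.
pose p : {poly R} := \prod_(2 <= n < N.+1) (1 + (ln n%:R ^- 2) *: 'X).
have p1 : p.[0] = 1.
  rewrite horner_prod big1// => n _; rewrite !hornerE; ring.
have pn n : (2 <= n < N.+1)%N -> p.[- ln n%:R ^+ 2] = 0.
  move=> /andP[n2 nN]; rewrite horner_prod (bigD1_seq n) ?mem_index_iota ?n2 ?iota_uniq//=.
  rewrite !hornerE mulrN mulVf ?subrr ?mul0r// expf_neq0// gt_eqF// ln_gt0// ltr1n.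
  exact: n2.
have E t : \sum_(k < size p) p`_k * dcos_derive c N (2 * k) t = 1.
  transitivity (\sum_(1 <= n < N.+1) c n * cos (t * ln n%:R) * p.[- ln n%:R ^+ 2]).
    rewrite /dcos_derive; under eq_bigr do rewrite mulr_sumr.
    rewrite exchange_big/=; apply: eq_bigr => n _.
    rewrite horner_coef mulr_sumr; apply: eq_bigr => k _.
    rewrite natrM (_ : 2 * k%:R * (pi / 2) = k%:R * pi); last by field.
    rewrite cosD_natpi exprM [(- ln _ ^+ 2) ^+ k]exprNn; ring.
  rewrite big_ltn// ln1 expr0n/= oppr0 p1 mulr0 cos0 c1 big_nat big1 ?addr0 ?mulr1//.
  by move=> n hn; rewrite pn// mulr0.
pose S := \sum_(k < size p) `|p`_k|.
have S0 : 0 <= S by apply: sumr_ge0.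
(* Only the derivatives of even order [2 k], [k < size p], enter the identity; if all were below
   [(S + 1)^-1] it would give [1 <= S / (S + 1)]. *)
exists (2 * size p)%N, (S + 1)^-1; split; first by rewrite invr_gt0; lra.
move=> t; apply: contrapT => H.
have lt k : (k <= 2 * size p)%N -> `|dcos_derive c N k t| < (S + 1)^-1.
  by move=> kK; rewrite ltNge; apply/negP => h; apply: H; exists k.
have : `|\sum_(k < size p) p`_k * dcos_derive c N (2 * k) t| <= S * (S + 1)^-1.
  apply: (le_trans (ler_norm_sum _ _ _)); rewrite mulr_suml; apply: ler_sum => k _.
  rewrite normrM; apply: ler_wpM2l => //; apply: ltW; apply: lt.
  by rewrite leq_mul2l/= ltnW.
rewrite E normr1 ler_pdivlMr; lra.
Qed.

(** Since [dsq] is at least the square of [dcos], its sublevel sets lie in those of a function with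
    nondegenerate derivatives. The regularisation error is therefore small uniformly in [T], and the
    limits in [s] and [T] can be exchanged. *)
Lemma has_mean_ln_dsq c N : (0 < N)%N -> c 1%N = 1 -> exists l, [/\
  forall T, mu.-integrable `[- T, T] (EFin \o (fun t => ln (dsq c N (fun=> 0) t))),
  has_mean (fun t => ln (dsq c N (fun=> 0) t)) (2 * l) &
  forall d, 0 < d -> exists2 s0, 0 < s0 & forall s, 0 < s -> s < s0 ->
    `|reg_jessen c N s - l| <= d].
Proof.
move=> N0 c1; have [K [kappa [k0 nd]]] := dcos_derive_nondegenerate N0 c1.
pose Bd := 1 + \sum_(k < K.+2) \sum_(1 <= n < N.+1) `|c n| * `|ln n%:R| ^+ k.
have B0 : 0 < Bd.
  apply: ltr_wpDr => //; apply: sumr_ge0 => k _; apply: sumr_ge0 => n _.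
  by rewrite mulr_ge0 ?exprn_ge0.
have gB k t : (k <= K.+1)%N -> `|dcos_derive c N k t| <= Bd.
  move=> kK; apply: (le_trans (dcos_derive_bound _ _ _ _)).
  have kK2 : (k < K.+2)%N by [].
  rewrite /Bd (bigD1 (Ordinal kK2))//= addrCA lerDl; apply: addr_ge0 => //.
  by apply: sumr_ge0 => i _; apply: sumr_ge0 => n _; rewrite mulr_ge0 ?exprn_ge0.
have [C C0 HC] := uniform_sublevel_measure (is_derive_dcos_derive c N) k0 B0 gB nd.
pose F := dsq c N (fun=> 0).
have cF : continuous F by apply: continuous_dsq; exact: completely_additive0.
have k2 : 0 < kappa / 2 by rewrite divr_gt0.
(* With [r = 2 ^ (-i)] the square of [kappa / 2 * r ^+ K] is at least [(kappa / 2) ^+ 2 * q ^+ i];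
   the exponent [K.+1] rather than [K] keeps [q < 1] when [K = 0]. *)
pose q : R := (2^-1) ^+ (2 * K.+1).
have q0 : 0 < q by rewrite exprn_gt0// invr_gt0.
have q1 : q < 1 by rewrite exprn_ilt1// ?invr_ge0//; lra.
have L0 : 0 < (kappa / 2) ^+ 2 by rewrite exprn_gt0.
have [||intF HF] := @log_singularity_mean R F ((kappa / 2) ^+ 2) q C cF _ L0 q0 q1 C0.
- by move=> t; exact: dsq_ge0.
- move=> T i T1.
  have r0 : 0 < (2^-1 : R) ^+ i by rewrite exprn_gt0// invr_gt0.
  have r1 : (2^-1 : R) ^+ i <= 1 by rewrite exprn_ile1// ?invr_ge0//; lra.
  have := HC T _ T1 r0 r1; rewrite exprVn -natrX; apply: le_trans.
  apply: le_measure; rewrite ?inE.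
  + apply: measurableI => //; apply: open_measurable.
    have -> : [set t | F t < (kappa / 2) ^+ 2 * q ^+ i] = F @^-1` [set x | x < (kappa / 2) ^+ 2 * q ^+ i] by [].
    by apply: open_comp => //; exact: open_lt.
  + apply: measurableI => //; apply: measurable_sublevel.
    exact: is_derive_continuous (is_derive_dcos_derive c N 0).
  + move=> t [ht /= Ft]; split => //=.
    have -> : dcos_derive c N 0 t = dcos c N (fun=> 0) t.
      by apply: eq_bigr => n _; rewrite expr0 mul0r mulr1.
    rewrite -(@ltr_pXn2r _ 2)// ?nnegrE ?mulr_ge0 ?exprn_ge0 ?invr_ge0 ?(ltW k0)//.
    rewrite real_normK ?num_real//; apply: (@le_lt_trans _ _ (F t)).
      by rewrite lerDl sqr_ge0.
    apply: (lt_le_trans Ft); rewrite [leRHS]exprMn ler_pM2l// /q natrX -exprVn -!exprM.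
    apply: ler_wiXn2l; [by rewrite invr_ge0|lra|lia].
have M s : 0 < s -> has_mean (fun t => ln (F t + s)) (2 * reg_jessen c N s).
  by move=> s0; apply: has_mean_reg_jessen => //; exact: completely_additive0.
have near_reg d s0 s : 0 < d -> 0 < s -> s < s0 -> (forall s T, 0 < s -> s < s0 -> 1 <= T ->
    `|time_mean (fun t => ln (F t + s)) T - time_mean (@ln R \o F) T| <= d) ->
    \forall T \near +oo, `|2 * reg_jessen c N s - time_mean (@ln R \o F) T| < 2 * d.
  move=> d0 s1 s2 H; have /cvgrPdist_lt/(_ _ d0) h := M s s1.
  near=> T; have T1 : 1 <= T by near: T; exact: nbhs_pinfty_ge.
  have := H s T s1 s2 T1.
  have : `|2 * reg_jessen c N s - time_mean (fun t => ln (F t + s)) T| < d by near: T.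
  rewrite ltr_norml !ler_norml => /andP[? ?] /andP[? ?].
  rewrite ltr_norml; apply/andP; split; lra.
have [l hl] : exists l, has_mean (@ln R \o F) (2 * l).
  suff h : cvg (time_mean (@ln R \o F) T @[T --> +oo]).
    exists (2^-1 * lim (time_mean (@ln R \o F) T @[T --> +oo])).
    by rewrite mulrA divff ?mul1r ?pnatr_eq0.
  apply/cauchy_cvgP/cauchy_exP => e e0.
  have e2 : 0 < e / 2 by rewrite divr_gt0.
  have [s0 s00 H] := HF _ e2.
  exists (2 * reg_jessen c N (s0 / 2)).
  have s01 : 0 < s0 / 2 by rewrite divr_gt0.
  have s02 : s0 / 2 < s0 by lra.
  have := near_reg _ _ _ e2 s01 s02 H.
  by rewrite (_ : 2 * (e / 2) = e)//; field.
exists l; split => // d d0; have d2 : 0 < d / 2 by rewrite divr_gt0.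
have [s0 s00 H] := HF _ d2; exists s0 => // s s1 s2.
have h1 := near_reg _ _ _ d2 s1 s2 H.
have /cvgrPdist_lt/(_ _ d0) h2 := hl.
have [T [hT1 hT2]] : exists T, `|2 * reg_jessen c N s - time_mean (@ln R \o F) T| < 2 * (d / 2) /\
    `|2 * l - time_mean (@ln R \o F) T| < d.
  have [T []] := filter_ex (filterI h1 h2).
  by exists T.
move: hT1 hT2; rewrite !ltr_norml => /andP[? ?] /andP[? ?].
rewrite ler_norml; apply/andP; split; lra.
Unshelve. all: by end_near. Qed.

End dirichlet_mean.

(** * Taylor remainders of third order *)

Section elementary_taylor.
Context {R : realType}.

(** The mean value theorem raises the order of smallness by one. The constant stays [K] instead of
    [K / (n + 1)], since only the order is used later. *)
Lemma mvt_power_bound (f df : R -> R) (K x : R) (n : nat) :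
  (forall y, `|y| <= `|x| -> is_derive y (1 : R) f (df y)) ->
  (forall y, `|y| <= `|x| -> `|df y| <= K * `|y| ^+ n) -> 0 <= K ->
  `|f x - f 0| <= K * `|x| ^+ n.+1.
Proof.
move=> D dfK K0.
have key y : `|y| <= `|x| -> `|df y| * `|x| <= K * `|x| ^+ n.+1.
  move=> yx; rewrite exprSr mulrA ler_wpM2r//; apply: (le_trans (dfK _ yx)).
  by rewrite ler_wpM2l// lerXn2r ?nnegrE.
have [x0|x0] := leP 0 x.
  have [||c] := @MVT_segment R f df 0 x x0.
  - by move=> y; rewrite in_itv/= => /andP[y0 yx]; apply: D; rewrite !ger0_norm// ltW.
  - apply: derivable_within_continuous => y; rewrite in_itv/= => /andP[y0 yx].
    by have := D y; rewrite !ger0_norm// => /(_ yx) [].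
  rewrite in_itv/= => /andP[c0 cx] ->; rewrite subr0 normrM; apply: key.
  by rewrite !ger0_norm.
have [||c] := @MVT_segment R f df x 0 (ltW x0).
- by move=> y; rewrite in_itv/= => /andP[y0 yx]; apply: D; rewrite !ltr0_norm// lerN2 ltW.
- apply: derivable_within_continuous => y; rewrite in_itv/= => /andP[y0 yx].
  by have := D y; rewrite !ler0_norm ?(ltW x0)// lerN2 => /(_ y0) [].
rewrite in_itv/= => /andP[c0 cx] E; rewrite distrC E sub0r normrM normrN; apply: key.
by rewrite !ler0_norm ?(ltW x0)// lerN2.
Qed.

Lemma sin_bound (x : R) : `|sin x| <= `|x|.
Proof.
have := @mvt_power_bound sin cos 1 x 0 (fun y _ => is_derive_sin y) _ ler01.
rewrite sin0 subr0 !mul1r expr1; apply => y _; rewrite expr0 mulr1; exact: cos_max.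
Qed.

Lemma cos_bound2 (x : R) : `|cos x - 1| <= x ^+ 2.
Proof.
have := @mvt_power_bound cos (fun x => - sin x) 1 x 1 (fun y _ => is_derive_cos y) _ ler01.
rewrite cos0 !mul1r real_normK ?num_real//; apply => y _; rewrite mul1r expr1 normrN; exact: sin_bound.
Qed.

Lemma sin_bound3 (x : R) : `|sin x - x| <= `|x| ^+ 3.
Proof.
have := @mvt_power_bound (fun x => sin x - x) (fun x => cos x - 1) 1 x 2 _ _ ler01.
rewrite sin0 !subr0 mul1r; apply => y _.
by rewrite mul1r real_normK ?num_real//; exact: cos_bound2.
Qed.

Lemma cos_bound3 (x : R) : `|x| <= 1 -> `|cos x - 1 + x ^+ 2 / 2| <= `|x| ^+ 3.
Proof.
move=> x1; have := @mvt_power_bound (fun x => cos x - 1 + x ^+ 2 / 2) (fun x => x - sin x) 1 x 2 _ _ ler01.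
rewrite cos0 expr0n/= mul0r subrr addr0 subr0 mul1r; apply => [y _|y yx].
  have H : is_derive y (1 : R) (fun x : R => 2^-1 * x ^+ 2) (2^-1 *: (2%:R * y ^+ 1 *: 1)).
    by apply: is_deriveZ; apply: is_derive_eq; rewrite /GRing.scale/= !mulr1 mulr_natl.
  have := is_deriveD (is_deriveB (is_derive_cos y) (is_derive_cst (1 : R) y 1)) H.
  rewrite (_ : _ + _ = y - sin y); last by rewrite /GRing.scale/=; field.
  by congr is_derive; apply/funext => z; rewrite [in RHS]mulrC.
rewrite mul1r distrC (le_trans (sin_bound3 _))//; apply: ler_wiXn2l => //; exact: le_trans x1.
Qed.

Lemma expR_bound3 (x : R) : `|x| <= 1 -> `|expR x - 1 - x - x ^+ 2 / 2| <= expR 1 * `|x| ^+ 3.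
Proof.
move=> x1; have e0 : 0 <= expR (1 : R) by exact: expR_ge0.
have b0 y : `|y| <= `|x| -> `|expR y| <= expR 1.
  move=> yx; rewrite ger0_norm ?expR_ge0// ler_expR (le_trans (ler_norm _))// (le_trans yx)//.
have b1 y : `|y| <= `|x| -> `|expR y - 1| <= expR 1 * `|y|.
  move=> yx; have := @mvt_power_bound expR expR (expR 1) y 0 (fun y _ => is_derive_expR y) _ e0.
  rewrite expR0 expr1; apply => z zy; rewrite expr0 mulr1; apply: b0; exact: le_trans yx.
have b2 y : `|y| <= `|x| -> `|expR y - 1 - y| <= expR 1 * `|y| ^+ 2.
  move=> yx; have := @mvt_power_bound (fun y => expR y - 1 - y) (fun y => expR y - 1) (expR 1) y 1 _ _ e0.
  rewrite expR0 subrr !subr0; apply => [z _|z zy]; last by rewrite expr1; apply: b1; exact: le_trans yx.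
  have := is_deriveB (is_deriveB (is_derive_expR z) (is_derive_cst (1 : R) z 1)) (is_derive_id z 1).
  by rewrite subr0.
have := @mvt_power_bound (fun y => expR y - 1 - y - y ^+ 2 / 2) (fun y => expR y - 1 - y) (expR 1) x 2 _ b2 e0.
rewrite expR0 expr0n/= mul0r subrr !subr0; apply => y _.
have H : is_derive y (1 : R) (fun x : R => 2^-1 * x ^+ 2) (2^-1 *: (2%:R * y ^+ 1 *: 1)).
  by apply: is_deriveZ; apply: is_derive_eq; rewrite /GRing.scale/= !mulr1 mulr_natl.
have := is_deriveB (is_deriveB (is_deriveB (is_derive_expR y) (is_derive_cst (1 : R) y 1)) (is_derive_id y 1)) H.
rewrite (_ : _ - _ = expR y - 1 - y); last by rewrite /GRing.scale/=; field.
by congr is_derive; apply/funext => z; rewrite [in RHS]mulrC.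
Qed.

Lemma ln_bound3 (x : R) : `|x| <= 2^-1 -> `|ln (1 + x) - x + x ^+ 2 / 2| <= 2 * `|x| ^+ 3.
Proof.
move=> x1; have pos y : `|y| <= `|x| -> 0 < 1 + y /\ 2^-1 <= 1 + y.
  by move=> yx; have := le_trans yx x1; rewrite ler_norml => /andP[? ?]; split; lra.
have := @mvt_power_bound (fun y => ln (1 + y) - y + y ^+ 2 / 2) (fun y => y ^+ 2 / (1 + y)) 2 x 2.
rewrite addr0 ln1 expr0n/= mul0r !subr0 addr0 subr0 => H; apply: H => // [y yx|y yx].
  have [y0 _] := pos y yx.
  have H : is_derive y (1 : R) (fun x : R => 2^-1 * x ^+ 2) (2^-1 *: (2%:R * y ^+ 1 *: 1)).
    by apply: is_deriveZ; apply: is_derive_eq; rewrite /GRing.scale/= !mulr1 mulr_natl.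
  have H1 : is_derive y (1 : R) (fun x : R => 1 + x) (0 + 1).
    exact: is_deriveD (is_derive_cst (1 : R) y 1) (is_derive_id y 1).
  have H2 := is_derive1_comp (f := @ln R) (g := fun x : R => 1 + x) (is_derive1_ln y0) H1.
  have := is_deriveD (is_deriveB H2 (is_derive_id y 1)) H.
  rewrite [X in is_derive _ _ _ X](_ : _ = y ^+ 2 / (1 + y)); last first.
    by rewrite /GRing.scale/=; field; exact: lt0r_neq0.
  by congr is_derive; apply/funext => z; rewrite [in RHS]mulrC.
have [y0 y2] := pos y yx.
rewrite normrM normfV normrX (ger0_norm (ltW y0)) mulrC; apply: ler_wpM2r; first exact: exprn_ge0.
by rewrite -[leRHS]invrK lef_pV2 ?posrE// invr_gt0.
Qed.

End elementary_taylor.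

(** * A discrete Laplacian of [ln (x^2 + y^2 + s)] *)

Section four_point.
Context {R : realType}.

(** Second-order expansion of [ln] at [D]; the lower bound [s] on [D] makes the cubic error
    uniform. *)
Lemma ln_quadratic_lower (s M : R) : 0 < s -> 0 < M -> exists C h0, [/\ 0 <= C, 0 < h0, h0 <= 1 &
  forall D p q r h, s <= D -> `|p| <= M -> `|q| <= M -> 0 < h -> h <= h0 -> `|r| <= M * h ^+ 3 ->
  (h * p + h ^+ 2 * q) / D - h ^+ 2 * p ^+ 2 / (2 * D ^+ 2) - C * h ^+ 3 <=
  ln (D + (h * p + h ^+ 2 * q + r)) - ln D].
Proof.
move=> s0 M0.
(* The three terms pay for [r / D], for the cross terms in the square of the increment, and for the
   cubic remainder of [ln], the increment being at most [3 * M * h]. *)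
pose C := M / s + 4 * M ^+ 2 / s ^+ 2 + 2 * (3 * M / s) ^+ 3.
have C0 : 0 <= C.
  have a0 : 0 <= M / s by rewrite divr_ge0 ?ltW.
  rewrite /C -mulrA -exprVn -exprMn -mulrA.
  by apply: addr_ge0; [apply: addr_ge0|]; rewrite // mulr_ge0// exprn_ge0// mulr_ge0.
(* This keeps the relative increment, at most [3 * M * h / s], below [1/2], the range of
   [ln_bound3]. *)
exists C, (Num.min 1 (s / (6 * M))); split => //.
- by rewrite lt_min ltr01 divr_gt0// mulr_gt0.
- by rewrite ge_min lexx.
move=> D p q r h sD pM qM h0; rewrite le_min => /andP[h1 hs] rM.
have D0 := lt_le_trans s0 sD.
have h20 : 0 <= h ^+ 2 by rewrite exprn_ge0// ltW.
have h30 : 0 <= h ^+ 3 by rewrite exprn_ge0// ltW.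
have h21 : h ^+ 2 <= h by rewrite expr2 ger_pMr.
have h32 : h ^+ 3 <= h ^+ 2 by rewrite exprS ger_pMl// exprn_gt0.
have qh : `|h ^+ 2 * q| <= M * h ^+ 2 by rewrite normrM ger0_norm// mulrC ler_wpM2r.
have ph : `|h * p| <= M * h by rewrite normrM gtr0_norm// mulrC ler_wpM2r// ltW.
set v := h ^+ 2 * q + r.
have vh : `|v| <= 2 * M * h ^+ 2.
  have := ler_normD (h ^+ 2 * q) r; have := ler_wpM2l (ltW M0) h32; rewrite -/v; lra.
have uE : h * p + h ^+ 2 * q + r = h * p + v by rewrite /v; ring.
rewrite uE; set u := h * p + v.
have uh : `|u| <= 3 * M * h.
  have := ler_normD (h * p) v; have := ler_wpM2l (ltW M0) h21; rewrite -/u; lra.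
have xs : `|u / D| <= 3 * M * h / s.
  rewrite normrM normfV (gtr0_norm D0); apply: ler_pM => //; first by rewrite invr_ge0 ltW.
  by rewrite lef_pV2.
have x2 : `|u / D| <= 2^-1.
  apply: (le_trans xs); rewrite ler_pdivrMr//.
  move: hs; rewrite ler_pdivlMr ?mulr_gt0//; lra.
have L := ln_bound3 x2.
have Du : D + u = D * (1 + u / D) by field; exact: lt0r_neq0.
have pos : 0 < 1 + u / D by move: x2; rewrite ler_norml => /andP[? ?]; lra.
rewrite Du lnM ?posrE// [ln D + _]addrC addrK.
have c3 : 2 * `|u / D| ^+ 3 <= 2 * (3 * M / s) ^+ 3 * h ^+ 3.
  rewrite -mulrA ler_pM2l// -exprMn; apply: lerXn2r; rewrite ?nnegrE//.
    by rewrite !mulr_ge0 ?invr_ge0 ?(ltW s0) ?(ltW h0) ?(ltW M0).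
  by rewrite mulrAC.
have c1 : (h * p + h ^+ 2 * q) / D - M / s * h ^+ 3 <= u / D.
  rewrite (_ : u / D = (h * p + h ^+ 2 * q) / D + r / D); last by rewrite /u /v; field; exact: lt0r_neq0.
  rewrite lerD2l lerNl -mulNr; apply: (@le_trans _ _ (`|r| / D)).
    by rewrite ler_pM2r ?invr_gt0// -normrN ler_norm.
  rewrite mulrAC; apply: ler_pM => //; first by rewrite invr_ge0 ltW.
  by rewrite lef_pV2.
have u2 : u ^+ 2 <= h ^+ 2 * p ^+ 2 + 8 * M ^+ 2 * h ^+ 3.
  have a1 : h * p * v <= 2 * M ^+ 2 * h ^+ 3.
    apply: (le_trans (ler_norm _)); rewrite normrM.
    rewrite (_ : 2 * M ^+ 2 * h ^+ 3 = (M * h) * (2 * M * h ^+ 2)); last by ring.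
    exact: ler_pM.
  have a2 : v ^+ 2 <= 4 * M ^+ 2 * h ^+ 3.
    rewrite -[v ^+ 2]ger0_norm ?sqr_ge0// normrX.
    apply: (@le_trans _ _ ((2 * M * h ^+ 2) ^+ 2)); first by apply: lerXn2r; rewrite ?nnegrE//; exact: le_trans vh.
    rewrite (_ : (2 * M * h ^+ 2) ^+ 2 = 4 * M ^+ 2 * (h ^+ 3 * h)); last by ring.
    apply: ler_wpM2l; first by rewrite mulr_ge0// exprn_ge0// ltW.
    by rewrite ler_piMr.
  rewrite (_ : u ^+ 2 = h ^+ 2 * p ^+ 2 + 2 * (h * p * v) + v ^+ 2); last by rewrite /u; ring.
  lra.
have c2 : (u / D) ^+ 2 / 2 <= h ^+ 2 * p ^+ 2 / (2 * D ^+ 2) + 4 * M ^+ 2 / s ^+ 2 * h ^+ 3.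
  rewrite (_ : (u / D) ^+ 2 / 2 = u ^+ 2 / (2 * D ^+ 2)); last by field; exact: lt0r_neq0.
  have D20 : 0 < 2 * D ^+ 2 by rewrite mulr_gt0// exprn_gt0.
  apply: (@le_trans _ _ ((h ^+ 2 * p ^+ 2 + 8 * M ^+ 2 * h ^+ 3) / (2 * D ^+ 2))).
    by rewrite ler_pM2r// invr_gt0.
  rewrite mulrDl lerD2l.
  rewrite (_ : 8 * M ^+ 2 * h ^+ 3 / (2 * D ^+ 2) = 4 * M ^+ 2 * h ^+ 3 / D ^+ 2); last by field; exact: lt0r_neq0.
  rewrite [leRHS]mulrAC; apply: ler_wpM2l.
    by rewrite mulr_ge0// mulr_ge0// exprn_ge0// ltW.
  rewrite lef_pV2 ?posrE ?exprn_gt0//.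
  by apply: lerXn2r => //; rewrite nnegrE ltW.
move: L; rewrite ler_norml => /andP[L _].
rewrite /C; lra.
Qed.

(* The squared modulus along [A + h b + h^2 d + O(h^3)]. *)
Lemma sqr_taylor (B X a d x h : R) : `|X| <= B -> `|a| <= B -> `|d| <= B -> 0 < h -> h <= 1 ->
  `|x - (X + h * a + h ^+ 2 * d)| <= B * h ^+ 3 ->
  `|x ^+ 2 - (X ^+ 2 + h * (2 * X * a) + h ^+ 2 * (a ^+ 2 + 2 * X * d))| <= 10 * B ^+ 2 * h ^+ 3.
Proof.
move=> XB aB dB h0 h1; set r := x - _ => rB.
have B0 : 0 <= B by apply: le_trans XB.
have M (y z : R) : `|y| <= B -> `|z| <= B -> `|y * z| <= B ^+ 2.
  by move=> yB zB; rewrite normrM expr2 ler_pM.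
have h30 : 0 <= h ^+ 3 by rewrite exprn_ge0// ltW.
pose r' := r / h ^+ 3.
have rE : r = h ^+ 3 * r' by rewrite /r'; field; exact: lt0r_neq0.
have r'B : `|r'| <= B.
  rewrite /r' normrM normfV (ger0_norm h30) ler_pdivrMr ?exprn_gt0//.
have xE : x = X + h * a + h ^+ 2 * d + h ^+ 3 * r' by rewrite -rE /r; ring.
have -> : x ^+ 2 - (X ^+ 2 + h * (2 * X * a) + h ^+ 2 * (a ^+ 2 + 2 * X * d)) =
  (2 * (X * r') + 2 * (a * d) + h * (2 * (a * r') + d * d) + h ^+ 2 * (2 * (d * r')) + h ^+ 3 * (r' * r')) * h ^+ 3.
  by rewrite xE; ring.
rewrite normrM (ger0_norm h30); apply: ler_wpM2r => //.
have hh n : 0 <= h ^+ n <= 1 by apply/andP; split; [apply: exprn_ge0|apply: exprn_ile1]; rewrite // ltW.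
have W (y c n : R) : 0 <= n <= 1 -> `|y| <= c -> - c <= n * y <= c.
  move=> /andP[n0 n1] yc; rewrite -ler_norml normrM ger0_norm// (le_trans _ yc)//.
  by rewrite ler_piMl.
have := M _ _ XB r'B; have := M _ _ aB dB; have := M _ _ aB r'B; have := M _ _ dB dB.
have := M _ _ dB r'B; have := M _ _ r'B r'B.
move=> k1 k2 k3 k4 k5 k6.
have h11 : 0 <= h <= 1 by rewrite ltW.
have m1 := W _ _ _ h11 k4; have m2 := W _ _ _ h11 k3.
have m3 := W _ _ _ (hh 2) k2; have m4 := W _ _ _ (hh 3) k1.
move: k5 k6; rewrite !ler_norml => /andP[? ?] /andP[? ?].
rewrite !mulrDr [h * (2 * _)]mulrCA [h ^+ 2 * (2 * _)]mulrCA.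
move: m1 m2 m3 m4 => /andP[? ?] /andP[? ?] /andP[? ?] /andP[? ?].
by apply/andP; split; lra.
Qed.

(** Models a holomorphic [F = X + i Y] with first derivative [a + i b] and half second derivative
    [d + i e]. The first two points are its shifts by [h] and [-h], the last two those by [i h] and
    [-i h]: there the first-order term is multiplied by [i] and the second-order one by [-1].
    First-order terms and the contributions of [d], [e] cancel, leaving the nonnegative
    [4 h^2 (a^2 + b^2) s / D^2] with [D = X^2 + Y^2 + s]. *)
Lemma four_point_ln (s B : R) : 0 < s -> 0 < B -> exists C h0, [/\ 0 <= C, 0 < h0, h0 <= 1 &
  forall X Y a b d e x1 y1 x2 y2 x3 y3 x4 y4 h,
  `|X| <= B -> `|Y| <= B -> `|a| <= B -> `|b| <= B -> `|d| <= B -> `|e| <= B ->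
  0 < h -> h <= h0 ->
  `|x1 - (X + h * a + h ^+ 2 * d)| <= B * h ^+ 3 -> `|y1 - (Y + h * b + h ^+ 2 * e)| <= B * h ^+ 3 ->
  `|x2 - (X + h * (- a) + h ^+ 2 * d)| <= B * h ^+ 3 -> `|y2 - (Y + h * (- b) + h ^+ 2 * e)| <= B * h ^+ 3 ->
  `|x3 - (X + h * (- b) + h ^+ 2 * (- d))| <= B * h ^+ 3 -> `|y3 - (Y + h * a + h ^+ 2 * (- e))| <= B * h ^+ 3 ->
  `|x4 - (X + h * b + h ^+ 2 * (- d))| <= B * h ^+ 3 -> `|y4 - (Y + h * (- a) + h ^+ 2 * (- e))| <= B * h ^+ 3 ->
  - (C * h ^+ 3) <= ln (x1 ^+ 2 + y1 ^+ 2 + s) + ln (x2 ^+ 2 + y2 ^+ 2 + s) +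
    ln (x3 ^+ 2 + y3 ^+ 2 + s) + ln (x4 ^+ 2 + y4 ^+ 2 + s) - 4 * ln (X ^+ 2 + Y ^+ 2 + s)].
Proof.
move=> s0 B0.
have M0 : 0 < 20 * B ^+ 2 by rewrite mulr_gt0// exprn_gt0.
have [C [h0 [C0 h00 h01 H]]] := ln_quadratic_lower s0 M0.
exists (4 * C), h0; split; [by rewrite mulr_ge0|by []|by []|].
move=> X Y a b d e x1 y1 x2 y2 x3 y3 x4 y4 h XB YB aB bB dB eB hpos hh.
have h1 := le_trans hh h01.
set D := X ^+ 2 + Y ^+ 2 + s.
have sD : s <= D by rewrite lerDr addr_ge0// sqr_ge0.
have key a' b' d' e' x y : `|a'| <= B -> `|b'| <= B -> `|d'| <= B -> `|e'| <= B ->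
    `|x - (X + h * a' + h ^+ 2 * d')| <= B * h ^+ 3 -> `|y - (Y + h * b' + h ^+ 2 * e')| <= B * h ^+ 3 ->
    (h * (2 * (X * a' + Y * b')) + h ^+ 2 * (a' ^+ 2 + b' ^+ 2 + 2 * (X * d' + Y * e'))) / D -
      h ^+ 2 * (2 * (X * a' + Y * b')) ^+ 2 / (2 * D ^+ 2) - C * h ^+ 3 <= ln (x ^+ 2 + y ^+ 2 + s) - ln D.
  move=> a'B b'B d'B e'B hx hy.
  have kx := sqr_taylor XB a'B d'B hpos h1 hx; have ky := sqr_taylor YB b'B e'B hpos h1 hy.
  set p := 2 * _; set q := a' ^+ 2 + _ + _.
  have Q (u v : R) : `|u| <= B -> `|v| <= B -> - B ^+ 2 <= u * v <= B ^+ 2.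
    by move=> uB vB; rewrite -ler_norml normrM expr2 ler_pM.
  have := Q _ _ XB a'B; have := Q _ _ YB b'B; have := Q _ _ a'B a'B; have := Q _ _ b'B b'B.
  have := Q _ _ XB d'B; have := Q _ _ YB e'B.
  move=> /andP[? ?] /andP[? ?] /andP[? ?] /andP[? ?] /andP[? ?] /andP[? ?].
  have B20 : 0 <= B ^+ 2 by rewrite exprn_ge0// ltW.
  have pM : `|p| <= 20 * B ^+ 2 by rewrite /p ler_norml; apply/andP; split; lra.
  have qM : `|q| <= 20 * B ^+ 2 by rewrite /q !expr2 ler_norml; rewrite -expr2; apply/andP; split; lra.
  pose r := x ^+ 2 + y ^+ 2 - (X ^+ 2 + Y ^+ 2) - (h * p + h ^+ 2 * q).
  have rM : `|r| <= 20 * B ^+ 2 * h ^+ 3.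
    rewrite (_ : r = (x ^+ 2 - (X ^+ 2 + h * (2 * X * a') + h ^+ 2 * (a' ^+ 2 + 2 * X * d'))) +
      (y ^+ 2 - (Y ^+ 2 + h * (2 * Y * b') + h ^+ 2 * (b' ^+ 2 + 2 * Y * e')))); last by rewrite /r /p /q; ring.
    apply: (le_trans (ler_normD _ _)); lra.
  have := H D p q r h sD pM qM hpos hh rM.
  by rewrite (_ : D + (h * p + h ^+ 2 * q + r) = x ^+ 2 + y ^+ 2 + s)//; rewrite /r /D; ring.
move=> g1 g2 g3 g4 g5 g6 g7 g8.
have aB' : `|- a| <= B by rewrite normrN.
have bB' : `|- b| <= B by rewrite normrN.
have dB' : `|- d| <= B by rewrite normrN.
have eB' : `|- e| <= B by rewrite normrN.
have k1 := key _ _ _ _ _ _ aB bB dB eB g1 g2.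
have k2 := key _ _ _ _ _ _ aB' bB' dB eB g3 g4.
have k3 := key _ _ _ _ _ _ bB' aB dB' eB' g5 g6.
have k4 := key _ _ _ _ _ _ bB aB' dB' eB' g7 g8.
have D0 := lt_le_trans s0 sD.
have main : 0 <= 4 * h ^+ 2 * (a ^+ 2 + b ^+ 2) * s / D ^+ 2.
  apply: divr_ge0; last exact: sqr_ge0.
  apply: mulr_ge0; last exact: ltW.
  by apply: mulr_ge0; [rewrite mulr_ge0// sqr_ge0|rewrite addr_ge0// sqr_ge0].
suff E : forall t1 t2 t3 t4 : R, t1 = (h * (2 * (X * a + Y * b)) + h ^+ 2 * (a ^+ 2 + b ^+ 2 + 2 * (X * d + Y * e))) / D -
      h ^+ 2 * (2 * (X * a + Y * b)) ^+ 2 / (2 * D ^+ 2) ->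
    t2 = (h * (2 * (X * - a + Y * - b)) + h ^+ 2 * ((- a) ^+ 2 + (- b) ^+ 2 + 2 * (X * d + Y * e))) / D -
      h ^+ 2 * (2 * (X * - a + Y * - b)) ^+ 2 / (2 * D ^+ 2) ->
    t3 = (h * (2 * (X * - b + Y * a)) + h ^+ 2 * ((- b) ^+ 2 + a ^+ 2 + 2 * (X * - d + Y * - e))) / D -
      h ^+ 2 * (2 * (X * - b + Y * a)) ^+ 2 / (2 * D ^+ 2) ->
    t4 = (h * (2 * (X * b + Y * - a)) + h ^+ 2 * (b ^+ 2 + (- a) ^+ 2 + 2 * (X * - d + Y * - e))) / D -
      h ^+ 2 * (2 * (X * b + Y * - a)) ^+ 2 / (2 * D ^+ 2) ->
    t1 + t2 + t3 + t4 = 4 * h ^+ 2 * (a ^+ 2 + b ^+ 2) * s / D ^+ 2.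
  have := E _ _ _ _ erefl erefl erefl erefl.
  lra.
move=> t1 t2 t3 t4 -> -> -> ->.
have -> : s = D - (X ^+ 2 + Y ^+ 2) by rewrite /D; ring.
field; exact: lt0r_neq0.
Qed.

End four_point.

(** * Second differences of [reg_jessen] in [sigma] *)

Section convexity.
Context {R : realType}.

Definition zcoef (sigma : R) (n : nat) : R := n%:R `^ (- sigma).

Lemma zcoef_gt0 sigma n : (0 < n)%N -> 0 < zcoef sigma n.
Proof. by move=> n0; rewrite powR_gt0// ltr0n. Qed.

Lemma zcoefE sigma n : (0 < n)%N -> zcoef sigma n = expR (- sigma * ln n%:R).
Proof. by move=> n0; rewrite /zcoef /powR gt_eqF// ltr0n. Qed.

Lemma zcoefD sigma h n : (0 < n)%N -> zcoef (sigma + h) n = zcoef sigma n * expR (- h * ln n%:R).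
Proof. by move=> n0; rewrite !zcoefE// -expRD; congr expR; ring. Qed.

Lemma ln_nat_ge0 (n : nat) : 0 <= ln (n%:R : R).
Proof. by case: n => [|n]; [rewrite ln0|rewrite ln_ge0// ler1n]. Qed.

Lemma completely_additive_ln (h : R) : completely_additive (fun n => h * ln n%:R).
Proof. by move=> a b a0 b0; rewrite ln_natM// mulrDr. Qed.

Lemma norm_sum_nat_le (f g : nat -> R) N : (forall n, (0 < n <= N)%N -> `|f n| <= g n) ->
  `|\sum_(1 <= n < N.+1) f n| <= \sum_(1 <= n < N.+1) g n.
Proof.
move=> H; apply: (le_trans (ler_norm_sum _ _ _)); rewrite big_nat [leRHS]big_nat.
by apply: ler_sum => n; rewrite ltnS; exact: H.
Qed.

(** Puts the exponential remainder of a shift and the trigonometric remainders of a twist under one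
    majorant, so that a single constant serves all four points. *)
Lemma taylor_combination (c u m0 m1 : R) : `|m0| <= 1 -> `|m1| <= 1 -> 0 <= c ->
  forall v w : R, `|v| <= expR 1 * `|u| ^+ 3 -> `|w| <= `|u| ^+ 3 ->
  `|c * (m0 * v)| <= c * ((expR 1 + 2) * `|u| ^+ 3) /\
  (forall w', `|w'| <= `|u| ^+ 3 -> `|c * (m0 * w + m1 * w')| <= c * ((expR 1 + 2) * `|u| ^+ 3)).
Proof.
move=> m01 m11 c0 v w hv hw; have e0 : 0 <= expR (1 : R) := expR_ge0 _.
have u3 : 0 <= `|u| ^+ 3 by rewrite exprn_ge0.
have M (m z k : R) : `|m| <= 1 -> `|z| <= k -> `|m * z| <= k.
  by move=> h1 h2; rewrite normrM (le_trans _ h2)// ler_piMl.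
split; first by rewrite normrM ger0_norm// ler_wpM2l//; have := M _ _ _ m01 hv; lra.
move=> w' hw'; rewrite normrM ger0_norm// ler_wpM2l//.
have := ler_normD (m0 * w) (m1 * w'); have := M _ _ _ m01 hw; have := M _ _ _ m11 hw'.
have := mulr_ge0 e0 u3; lra.
Qed.

Let second_difference_aux (w x y z : R) : 0 <= w ->
  - w <= 2 * x + 2 * y + 2 * z + 2 * z + - 4 * (2 * z) -> - w <= y + x - 2 * z.
Proof. lra. Qed.

(** Mean over [t] of the four-point inequality. The means at the two twisted points are those at
    [sigma] itself, so they cancel two of the four copies subtracted, and a one-dimensional second
    difference remains. *)
Lemma reg_jessen_second_difference N s sigma : 0 < s -> exists C h0, [/\ 0 <= C, 0 < h0 &
  forall h, 0 < h -> h <= h0 -> - (C * h ^+ 3) <=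
    reg_jessen (zcoef (sigma + h)) N s + reg_jessen (zcoef (sigma - h)) N s -
    2 * reg_jessen (zcoef sigma) N s].
Proof.
move=> s0; pose c := zcoef sigma; pose l n : R := ln n%:R.
pose S j := \sum_(1 <= n < N.+1) c n * l n ^+ j.
have l0 n : 0 <= l n := ln_nat_ge0 n.
have c0 n : 0 <= c n by exact: powR_ge0.
have S0 j : 0 <= S j by apply: sumr_ge0 => n _; rewrite mulr_ge0 ?exprn_ge0.
have e0 : 0 <= expR (1 : R) := expR_ge0 _.
(* One bound for the function, its first two derivatives and, through [S 3], all Taylor remainders;
   [1] makes it positive. *)
pose B := 1 + S 0%N + S 1%N + S 2%N + (expR 1 + 2) * S 3%N.
have E3 : 0 <= (expR 1 + 2) * S 3%N by rewrite mulr_ge0// addr_ge0.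
have B0 : 0 < B by have := S0 0%N; have := S0 1%N; have := S0 2%N; rewrite /B; lra.
have SB k : (k < 3)%N -> S k <= B.
  have := S0 0%N; have := S0 1%N; have := S0 2%N; rewrite /B; move: k => [|[|[|//]]] *; lra.
have S3B : (expR 1 + 2) * S 3%N <= B.
  have := S0 0%N; have := S0 1%N; have := S0 2%N; rewrite /B; lra.
have half (z : R) : `|z| <= 1 -> `|2^-1 * z| <= 1.
  by move=> z1; rewrite normrM ger0_norm//; have := normr_ge0 z; lra.
have [C [h0 [C0 h00 h01 H]]] := four_point_ln s0 B0.
have lN0 : 0 <= l N := l0 N.
(* Ensures [h * ln n <= 1] for all [n <= N], as the Taylor bounds require. *)
pose h0' := Num.min h0 (1 + l N)^-1.
exists C, h0'; split; [by []|by rewrite lt_min h00 invr_gt0; lra|].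
move=> h hpos; rewrite le_min => /andP[hh hlN].
have hl n : (0 < n <= N)%N -> `|h * l n| <= 1.
  move=> /andP[n0 nN]; rewrite ger0_norm ?mulr_ge0 ?(ltW hpos)//.
  have : l n <= l N by rewrite /l ler_ln ?posrE ?ltr0n ?ler_nat//; exact: leq_trans nN.
  move: hlN; rewrite -[_^-1]mul1r ler_pdivlMr; last by lra.
  by move=> h1 h2; have := ler_wpM2l (ltW hpos) h2; lra.
pose j s := 2 * reg_jessen (zcoef s) N s.
have J sg phi : completely_additive phi ->
    has_mean (fun t => ln (dsq (zcoef sg) N phi t + s)) (2 * reg_jessen (zcoef sg) N s).
  by move=> hphi; exact: has_mean_reg_jessen.
have J1 := J (sigma - h) _ (@completely_additive0 R).
have J2 := J (sigma + h) _ (@completely_additive0 R).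
have J3 := J sigma _ (completely_additive_ln h).
have J4 := J sigma _ (completely_additive_ln (- h)).
have J5 := J sigma _ (@completely_additive0 R).
have cont sg phi : completely_additive phi -> continuous (fun t => ln (dsq (zcoef sg) N phi t + s)).
  by move=> hphi; exact: continuous_ln_dsq.
have c1 := cont (sigma - h) _ (@completely_additive0 R).
have c2 := cont (sigma + h) _ (@completely_additive0 R).
have c3 := cont sigma _ (completely_additive_ln h).
have c4 := cont sigma _ (completely_additive_ln (- h)).
have c5 := cont sigma _ (@completely_additive0 R).
have c12 : continuous (fun t => ln (dsq (zcoef (sigma - h)) N (fun=> 0) t + s) + ln (dsq (zcoef (sigma + h)) N (fun=> 0) t + s)).
  by move=> t; apply: cvgD; [exact: c1|exact: c2].
have c123 : continuous (fun t => ln (dsq (zcoef (sigma - h)) N (fun=> 0) t + s) + ln (dsq (zcoef (sigma + h)) N (fun=> 0) t + s)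
   + ln (dsq (zcoef sigma) N (fun n => h * ln n%:R) t + s)).
  by move=> t; apply: cvgD; [exact: c12|exact: c3].
have c1234 : continuous (fun t => ln (dsq (zcoef (sigma - h)) N (fun=> 0) t + s) + ln (dsq (zcoef (sigma + h)) N (fun=> 0) t + s)
   + ln (dsq (zcoef sigma) N (fun n => h * ln n%:R) t + s) + ln (dsq (zcoef sigma) N (fun n => - h * ln n%:R) t + s)).
  by move=> t; apply: cvgD; [exact: c123|exact: c4].
have c5' : continuous (fun t => (- 4) * ln (dsq (zcoef sigma) N (fun=> 0) t + s)).
  by move=> t; apply: cvgMr; exact: c5.
have J12 := has_meanD c1 c2 J1 J2.
have J123 := has_meanD c12 c3 J12 J3.
have J1234 := has_meanD c123 c4 J123 J4.
have Jall := has_meanD c1234 c5' J1234 (has_meanZ (k := - 4) c5 J5).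
apply: second_difference_aux; first by rewrite mulr_ge0// exprn_ge0// ltW.
apply: (@le_has_mean R (fun=> - (C * h ^+ 3)) _ _ _ _ _ (@has_mean_cst R _) Jall).
- by move=> t; exact: cvg_cst.
- by move=> t; apply: cvgD; [exact: c1234|exact: c5'].
move=> t.
pose cs n := cos (t * l n); pose sn n := sin (t * l n).
have cs1 n : `|cs n| <= 1 := cos_max _; have sn1 n : `|sn n| <= 1 := sin_max _.
have h3 : 0 <= h ^+ 3 by rewrite exprn_ge0// ltW.
have bnd (m : nat -> R) k : (k < 3)%N -> (forall n, `|m n| <= 1) ->
    `|\sum_(1 <= n < N.+1) c n * l n ^+ k * m n| <= B.
  move=> k3 hm; apply: (@le_trans _ _ (S k)).
    apply: norm_sum_nat_le => n _; rewrite normrM ger0_norm ?mulr_ge0 ?exprn_ge0//.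
    by rewrite ler_piMr// mulr_ge0 ?exprn_ge0.
  exact: SB.
have rem (f : nat -> R) : (forall n, (0 < n <= N)%N -> `|f n| <= c n * ((expR 1 + 2) * `|h * l n| ^+ 3)) ->
    `|\sum_(1 <= n < N.+1) f n| <= B * h ^+ 3.
  move=> hf; apply: (le_trans (norm_sum_nat_le hf)).
  apply: (@le_trans _ _ ((expR 1 + 2) * S 3%N * h ^+ 3)); last first.
    exact: ler_wpM2r.
  rewrite mulr_sumr mulr_suml; apply: ler_sum => n _.
  rewrite ger0_norm ?mulr_ge0 ?(ltW hpos)// exprMn le_eqVlt; apply/orP; left; apply/eqP; ring.
(* [a + i b] and [d + i e] are the first derivative and half the second derivative of [X + i Y] in
   the direction of decreasing [sigma], so the first of the four points is [sigma - h]. *)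
pose a := \sum_(1 <= n < N.+1) c n * l n ^+ 1 * cs n.
pose b := \sum_(1 <= n < N.+1) c n * l n ^+ 1 * sn n.
pose d := \sum_(1 <= n < N.+1) c n * l n ^+ 2 * (2^-1 * cs n).
pose e := \sum_(1 <= n < N.+1) c n * l n ^+ 2 * (2^-1 * sn n).
pose X := \sum_(1 <= n < N.+1) c n * l n ^+ 0 * cs n.
pose Y := \sum_(1 <= n < N.+1) c n * l n ^+ 0 * sn n.
have XB : `|X| <= B by apply: bnd.
have YB : `|Y| <= B by apply: bnd.
have aB : `|a| <= B by apply: bnd.
have bB : `|b| <= B by apply: bnd.
have dB : `|d| <= B by apply: bnd => // n; apply: half.
have eB : `|e| <= B by apply: bnd => // n; apply: half.
have zE g n : (0 < n <= N)%N -> zcoef (sigma + g) n = c n * expR (- g * l n).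
  by move=> /andP[n0 _]; rewrite zcoefD.
have exp_rem g n (m : R) : `|g| = h -> (0 < n <= N)%N -> `|m| <= 1 ->
    `|c n * expR (g * l n) * m - (c n * m + g * (c n * l n ^+ 1 * m) + h ^+ 2 * (c n * l n ^+ 2 * (2^-1 * m)))|
     <= c n * ((expR 1 + 2) * `|h * l n| ^+ 3).
  move=> gh nN m1; have gl : `|g * l n| = `|h * l n| by rewrite !normrM gh (gtr0_norm hpos).
  have := @expR_bound3 R (g * l n); rewrite gl => /(_ (hl n nN)) hv.
  have z0 : `|0 : R| <= `|h * l n| ^+ 3 by rewrite normr0; apply: exprn_ge0; exact: normr_ge0.
  have [k _] := taylor_combination m1 m1 (c0 n) hv z0.
  apply: le_trans k; rewrite le_eqVlt; apply/orP; left; apply/eqP; congr `|_|.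
  have -> : h ^+ 2 = g ^+ 2 by rewrite -gh real_normK ?num_real.
  by field.
have rot_rem g n (m m' : R) : `|g| = h -> (0 < n <= N)%N -> `|m| <= 1 -> `|m'| <= 1 ->
    `|c n * (m * cos (g * l n) + m' * sin (g * l n)) -
      (c n * m + g * (c n * l n ^+ 1 * m') - h ^+ 2 * (c n * l n ^+ 2 * (2^-1 * m)))|
     <= c n * ((expR 1 + 2) * `|h * l n| ^+ 3).
  move=> gh nN m1 m1'; have gl : `|g * l n| = `|h * l n| by rewrite !normrM gh (gtr0_norm hpos).
  have := @cos_bound3 R (g * l n); rewrite gl => /(_ (hl n nN)) hv.
  have := @sin_bound3 R (g * l n); rewrite gl => hw.
  have z0 : `|0 : R| <= expR 1 * `|h * l n| ^+ 3 by rewrite normr0 mulr_ge0// exprn_ge0.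
  have [_ k] := taylor_combination m1 m1' (c0 n) z0 hv.
  apply: le_trans (k _ hw); rewrite le_eqVlt; apply/orP; left; apply/eqP; congr `|_|.
  have -> : h ^+ 2 = g ^+ 2 by rewrite -gh real_normK ?num_real.
  by field.
have hN : `|h| = h by rewrite gtr0_norm.
have hN' : `|- h| = h by rewrite normrN.
have pha phi n : t * ln n%:R + phi n = t * l n + phi n by [].
have sumE (f f1 f2 f3 : nat -> R) (k : R) : forall g : R,
    (\sum_(1 <= n < N.+1) f n) - ((\sum_(1 <= n < N.+1) f1 n) + g * (\sum_(1 <= n < N.+1) f2 n) + k * (\sum_(1 <= n < N.+1) f3 n)) =
    \sum_(1 <= n < N.+1) (f n - (f1 n + g * f2 n + k * f3 n)).
  by move=> g; rewrite !mulr_sumr -!big_split/= -sumrN -big_split/=.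
have X0 n : c n * cs n = c n * l n ^+ 0 * cs n by rewrite expr0 mulr1.
have Y0 n : c n * sn n = c n * l n ^+ 0 * sn n by rewrite expr0 mulr1.
have := H X Y a b d e
  (dcos (zcoef (sigma - h)) N (fun=> 0) t) (dsin (zcoef (sigma - h)) N (fun=> 0) t)
  (dcos (zcoef (sigma + h)) N (fun=> 0) t) (dsin (zcoef (sigma + h)) N (fun=> 0) t)
  (dcos c N (fun n => h * l n) t) (dsin c N (fun n => h * l n) t)
  (dcos c N (fun n => - h * l n) t) (dsin c N (fun n => - h * l n) t) h
  XB YB aB bB dB eB hpos hh.
have -> : X ^+ 2 + Y ^+ 2 = dsq c N (fun=> 0) t.
  rewrite /dsq /dcos /dsin; congr (_ ^+ 2 + _ ^+ 2); apply: eq_bigr => n _.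
    by rewrite -X0 addr0.
  by rewrite -Y0 addr0.
rewrite -!/(dsq _ _ _ _) => HH.
apply: le_trans (HH _ _ _ _ _ _ _ _) _; rewrite ?mulNr //.
- rewrite sumE; apply: rem => n nN; rewrite addr0 -X0 zE// opprK; exact: (exp_rem h n (cs n)).
- rewrite sumE; apply: rem => n nN; rewrite addr0 -Y0 zE// opprK; exact: (exp_rem h n (sn n)).
- rewrite mulrN -mulNr sumE; apply: rem => n nN; rewrite addr0 -X0 zE//; exact: (exp_rem (- h) n (cs n)).
- rewrite mulrN -mulNr sumE; apply: rem => n nN; rewrite addr0 -Y0 zE//; exact: (exp_rem (- h) n (sn n)).
- rewrite !mulrN -!mulNr sumE; apply: rem => n nN; rewrite cosD -X0.
  have := rot_rem h n (cs n) (- sn n) hN nN (cs1 n); rewrite normrN => /(_ (sn1 n)).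
  by congr (`|_| <= _); rewrite /cs /sn; ring.
- rewrite !mulrN -!mulNr sumE; apply: rem => n nN; rewrite sinD -Y0.
  have := rot_rem h n (sn n) (cs n) hN nN (sn1 n) (cs1 n).
  by congr (`|_| <= _); rewrite /cs /sn; ring.
- rewrite !mulrN -!mulNr sumE; apply: rem => n nN; rewrite cosD -X0.
  have := rot_rem (- h) n (cs n) (- sn n) hN' nN (cs1 n); rewrite normrN => /(_ (sn1 n)).
  by congr (`|_| <= _); rewrite /cs /sn; ring.
- rewrite !mulrN -!mulNr sumE; apply: rem => n nN; rewrite sinD -Y0.
  have := rot_rem (- h) n (sn n) (cs n) hN' nN (sn1 n) (cs1 n).
  by congr (`|_| <= _); rewrite /cs /sn; ring.
Qed.

End convexity.

(** * Convexity from second differences, and the passage to [jessen_zeta] *)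

Section convex_real.
Context {R : realType}.

Definition convex_real (f : R -> R) := forall x y z, x < y -> y < z ->
  f y * (z - x) <= f x * (z - y) + f z * (y - x).

(** If [f] exceeded its chord, subtracting the chord and adding a small upward parabola would leave
    an interior maximum; there the second difference is at most [0], yet the parabola makes it at
    least [2 e h^2 - C h^3]. Only the point of maximum is tested, so [C] and [h0] may depend on the
    point. *)
Lemma convex_of_second_difference (f : R -> R) : continuous f ->
  (forall x, exists C h0, [/\ 0 <= C, 0 < h0 &
    forall h, 0 < h -> h <= h0 -> - (C * h ^+ 3) <= f (x + h) + f (x - h) - 2 * f x]) ->
  convex_real f.
Proof.
move=> cf H x y z xy yz; rewrite leNgt; apply/negP => lt.
have xz : x < z := lt_trans xy yz.
have zx0 : 0 < z - x by rewrite subr_gt0.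
have yx0 : 0 < y - x by rewrite subr_gt0.
have zy0 : 0 < z - y by rewrite subr_gt0.
pose k := (f z - f x) / (z - x).
pose g u := f u - (f x + k * (u - x)).
have gx : g x = 0 by rewrite /g; ring.
have gz : g z = 0 by rewrite /g /k; field; exact: lt0r_neq0.
have gy : 0 < g y.
  rewrite (_ : g y = (f y * (z - x) - (f x * (z - y) + f z * (y - x))) / (z - x)); last first.
    by rewrite /g /k; field; exact: lt0r_neq0.
  by rewrite divr_gt0// subr_gt0.
(* Chosen so that the parabola takes away exactly half of [g y]. *)
pose e := g y / (2 * ((y - x) * (z - y))).
have e0 : 0 < e by rewrite divr_gt0// mulr_gt0// mulr_gt0.
pose G u := g u + e * ((u - x) * (u - z)).
have Gx : G x = 0 by rewrite /G gx; ring.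
have Gz : G z = 0 by rewrite /G gz; ring.
have Gy : 0 < G y.
  rewrite (_ : G y = g y / 2); first by rewrite divr_gt0.
  by rewrite /G /e; field; rewrite !lt0r_neq0.
have cG : continuous G.
  move=> u; apply: cvgD; [apply: cvgB|].
  - exact: cf.
  - by apply: cvgD; [exact: cvg_cst|apply: cvgMr; apply: cvgB; [exact: cvg_id|exact: cvg_cst]].
  - by apply: cvgMr; apply: cvgM; apply: cvgB; [exact: cvg_id|exact: cvg_cst|exact: cvg_id|exact: cvg_cst].
have [c cxz cmax] := @EVT_max R G x z (ltW xz) (continuous_subspaceT cG).
have yxz : y \in `[x, z] by rewrite in_itv/= !ltW.
have Gc := lt_le_trans Gy (cmax y yxz).
move: cxz; rewrite in_itv/= => /andP[xc cz].
have {}xc : x < c by rewrite lt_neqAle xc andbT; apply/eqP => E; move: Gc; rewrite -E Gx ltxx.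
have {}cz : c < z by rewrite lt_neqAle cz andbT; apply/eqP => E; move: Gc; rewrite E Gz ltxx.
have [C [h0 [C0 h00 Hh]]] := H c.
pose h := Num.min (Num.min h0 (e / (C + 1))) (Num.min (c - x) (z - c)).
have h_gt0 : 0 < h.
  rewrite !lt_min h00 divr_gt0 ?subr_gt0 ?xc ?cz//; lra.
have [hh0 he hcx hzc] : [/\ h <= h0, h <= e / (C + 1), h <= c - x & h <= z - c].
  by rewrite /h !ge_min !lexx !orbT.
have d1 := Hh h h_gt0 hh0.
have m1 : G (c + h) <= G c by apply: cmax; rewrite in_itv/=; apply/andP; split; lra.
have m2 : G (c - h) <= G c by apply: cmax; rewrite in_itv/=; apply/andP; split; lra.
have E : G (c + h) + G (c - h) - 2 * G c = f (c + h) + f (c - h) - 2 * f c + 2 * e * h ^+ 2.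
  by rewrite /G /g; ring.
have Ch : C * h ^+ 3 < 2 * e * h ^+ 2.
  rewrite exprSr mulrA mulrAC ltr_pM2r ?exprn_gt0//.
  move: he; rewrite ler_pdivlMr; [|lra]; rewrite mulrDr mulr1 mulrC; lra.
move: E d1 Ch m1 m2; clear; lra.
Qed.

Lemma has_mean_dist (f g : R -> R) (l m e : R) : continuous f -> continuous g ->
  has_mean f l -> has_mean g m -> (forall t, `|f t - g t| <= e) -> `|l - m| <= e.
Proof.
move=> cf cg fl gm h.
have P (f' g' : R -> R) l' m' : continuous f' -> continuous g' -> has_mean f' l' -> has_mean g' m' ->
    (forall t, f' t - g' t <= e) -> l' - m' <= e.
  move=> cf' cg' fl' gm' h'.
  have ce : continuous (fun _ : R => e) by move=> t; exact: cvg_cst.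
  rewrite lerBlDr; apply: (le_has_mean cf' _ fl' (has_meanD ce cg' (@has_mean_cst R e) gm')).
    by move=> t; apply: cvgD; [exact: ce|exact: cg'].
  by move=> t; have := h' t; rewrite lerBlDr.
rewrite ler_norml; apply/andP; split.
  rewrite lerNl opprB; apply: (P g f) => // t; have := h t; rewrite distrC => k.
  exact: le_trans (ler_norm _) k.
by apply: (P f g) => // t; exact: le_trans (ler_norm _) (h t).
Qed.

Lemma ln_lipschitz (s a b : R) : 0 < s -> 0 <= a -> 0 <= b -> `|ln (a + s) - ln (b + s)| <= `|a - b| / s.
Proof.
move=> s0; wlog ab : a b / b <= a.
  move=> H a0 b0; have [ba|ab] := leP b a; first exact: H.
  by rewrite distrC [`|a - b|]distrC; apply: H => //; exact: ltW.
move=> a0 b0; have bs : 0 < b + s by lra.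
have ab0 : 0 <= a - b by lra.
have /andP[h1 h2] := ln_add_sub bs ab0.
rewrite (_ : a + s = b + s + (a - b)); last by ring.
rewrite !ger0_norm//; apply: (le_trans h2); apply: ler_wpM2l => //.
by rewrite lef_pV2 ?posrE//; lra.
Qed.

Lemma zcoef_continuous (n : nat) : (0 < n)%N -> continuous (fun sigma : R => zcoef sigma n).
Proof.
move=> n0; under eq_fun do rewrite zcoefE//.
move=> x; have : {for x, continuous (@expR R \o (fun sigma : R => - sigma * ln n%:R))}.
  apply: continuous_comp; last exact: continuous_expR.
  by apply: cvgMl; apply: cvgN; exact: cvg_id.
by [].
Qed.

(** [V] bounds the change of [dsq] uniformly in [t], and [u -> ln (u + s)] is Lipschitz with
    constant [1 / s]. *)
Lemma reg_jessen_continuous N (s : R) : 0 < s -> continuous (fun sigma => reg_jessen (zcoef sigma) N s).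
Proof.
move=> s0 x.
pose V y := \sum_(i < N) \sum_(j < N)
  `|zcoef x i.+1 * zcoef x j.+1 - zcoef y i.+1 * zcoef y j.+1|.
have cV : continuous V.
  move=> y; apply: continuous_sum_fun => i; apply: continuous_sum_fun => j u.
  have : {for u, continuous (Num.norm \o (fun y => zcoef x i.+1 * zcoef x j.+1 - zcoef y i.+1 * zcoef y j.+1))}.
    apply: continuous_comp; last exact: norm_continuous.
    apply: cvgB; first exact: cvg_cst.
    by apply: cvgM; exact: zcoef_continuous.
  by [].
have V0 : V x = 0 by rewrite /V big1// => i _; rewrite big1// => j _; rewrite subrr normr0.
have key y : `|reg_jessen (zcoef x) N s - reg_jessen (zcoef y) N s| <= V y / s.
  have h0 := @completely_additive0 R.
  have := has_mean_dist (@continuous_ln_dsq R (zcoef x) N _ s s0 h0) (@continuous_ln_dsq R (zcoef y) N _ s s0 h0)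
    (@has_mean_reg_jessen R (zcoef x) N s _ s0 h0) (@has_mean_reg_jessen R (zcoef y) N s _ s0 h0).
  move=> /(_ (V y / s)) H.
  have {H} : `|2 * reg_jessen (zcoef x) N s - 2 * reg_jessen (zcoef y) N s| <= V y / s.
    apply: H => t; apply: (le_trans (ln_lipschitz s0 (dsq_ge0 _ _ _ _) (dsq_ge0 _ _ _ _))).
    rewrite ler_pM2r ?invr_gt0// !dsqE -sumrB /V big_add1 big_mkord.
    apply: (le_trans (ler_norm_sum _ _ _)); apply: ler_sum => i _.
    rewrite -sumrB big_add1 big_mkord; apply: (le_trans (ler_norm_sum _ _ _)); apply: ler_sum => j _.
    rewrite -mulrBl normrM ler_piMr//; exact: cos_max.
  rewrite -mulrBr normrM ger0_norm//; have := normr_ge0 (reg_jessen (zcoef x) N s - reg_jessen (zcoef y) N s).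
  lra.
apply/cvgrPdist_le => e e0; have es : 0 < e * s by rewrite mulr_gt0.
have /cvgrPdist_le/(_ _ es) := cV x; rewrite V0 => H.
near=> y; apply: (le_trans (key y)); rewrite ler_pdivrMr//.
have : `|0 - V y| <= e * s by near: y.
by rewrite sub0r normrN; exact: le_trans (ler_norm _).
Unshelve. all: by end_near. Qed.

Lemma reg_jessen_convex N (s : R) : 0 < s -> convex_real (fun sigma => reg_jessen (zcoef sigma) N s).
Proof.
move=> s0; apply: convex_of_second_difference; first exact: reg_jessen_continuous.
by move=> x; exact: reg_jessen_second_difference.
Qed.

Lemma zetaN_dsum N (sigma t : R) : zetaN N (sigma +i* t)%C =
  (dcos (zcoef sigma) N (fun=> 0) t +i* - dsin (zcoef sigma) N (fun=> 0) t)%C.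
Proof.
rewrite /zetaN /dirichlet_sum /dcos /dsin.
elim: N => [|N IH]; first by rewrite !big_geq// oppr0.
rewrite big_nat_recr//= IH mul1r /natpowN/=; apply/eqP; rewrite eq_complex/= /zcoef.
by apply/andP; split; apply/eqP; rewrite [in RHS]big_nat_recr//= addr0; ring.
Qed.

Lemma ln_normc_zetaN N (sigma t : R) :
  ln (Normc.normc (zetaN N (sigma +i* t)%C)) = 2^-1 * ln (dsq (zcoef sigma) N (fun=> 0) t).
Proof.
rewrite zetaN_dsum /= sqrrN -/(dsq _ _ _ _).
(* At a zero of the sum both sides are [0], by the convention [ln 0 = 0]. *)
have := dsq_ge0 (zcoef sigma) N (fun=> 0) t; rewrite le_eqVlt => /orP[/eqP <-|d0].
  by rewrite sqrtr0 ln0// mulr0.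
by rewrite -powR12_sqrt ?ln_powR// ltW.
Qed.

Lemma zcoef1 (sigma : R) : zcoef sigma 1 = 1.
Proof. by rewrite zcoefE// ln1 mulr0 expR0. Qed.

(** The limit in [jessen] is shown to be the value supplied by [has_mean_ln_dsq], so no default
    value of [lim] enters. *)
Lemma jessen_zeta_reg N (sigma : R) : (0 < N)%N -> forall d, 0 < d -> exists2 s0, 0 < s0 &
  forall s, 0 < s -> s < s0 -> `|reg_jessen (zcoef sigma) N s - jessen_zeta N sigma| <= d.
Proof.
move=> N0; have [l [int hl H]] := has_mean_ln_dsq N0 (zcoef1 sigma).
suff -> : jessen_zeta N sigma = l by [].
rewrite /jessen_zeta /jessen; apply: cvg_lim => //.
have E T : 2^-1 * time_mean (fun t => ln (dsq (zcoef sigma) N (fun=> 0) t)) T = log_mean (zetaN N) sigma T.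
  rewrite /log_mean mulrCA -RintegralZl//; congr (_ * _).
  by apply: eq_Rintegral => t _; rewrite ln_normc_zetaN.
have h2 : 2^-1 * time_mean (fun t => ln (dsq (zcoef sigma) N (fun=> 0) t)) T @[T --> +oo] --> l.
  by rewrite -[l](@mulKf _ 2) ?pnatr_eq0//; apply: cvgMr; exact: hl.
by under eq_fun do rewrite -E.
Qed.

End convex_real.

(** * Convexity of [jessen_zeta], its upper bound, and sums with a dominant term *)

Section jessen_bounds.
Context {R : realType}.

Lemma jessen_zeta_le N (sigma B s1 : R) : (0 < N)%N -> 0 < s1 ->
  (forall s, 0 < s -> s < s1 -> reg_jessen (zcoef sigma) N s <= B) -> jessen_zeta N sigma <= B.
Proof.
move=> N0 s10 H; apply/ler_addgt0Pl => d d0.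
have [s0 s00 K] := jessen_zeta_reg sigma N0 d0.
pose s := Num.min s0 s1 / 2.
have m0 : 0 < Num.min s0 s1 by rewrite lt_min s00.
have s_gt0 : 0 < s by rewrite divr_gt0.
have : s < Num.min s0 s1 by rewrite /s; lra.
rewrite lt_min => /andP[ss0 ss1].
by have := K s s_gt0 ss0; have := H s s_gt0 ss1; rewrite ler_norml => ? /andP[? _]; lra.
Qed.

Lemma jessen_zeta_ge N (sigma B s1 : R) : (0 < N)%N -> 0 < s1 ->
  (forall s, 0 < s -> s < s1 -> B <= reg_jessen (zcoef sigma) N s) -> B <= jessen_zeta N sigma.
Proof.
move=> N0 s10 H; apply/ler_addgt0Pl => d d0.
have [s0 s00 K] := jessen_zeta_reg sigma N0 d0.
pose s := Num.min s0 s1 / 2.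
have m0 : 0 < Num.min s0 s1 by rewrite lt_min s00.
have s_gt0 : 0 < s by rewrite divr_gt0.
have : s < Num.min s0 s1 by rewrite /s; lra.
rewrite lt_min => /andP[ss0 ss1].
by have := K s s_gt0 ss0; have := H s s_gt0 ss1; rewrite ler_norml => ? /andP[_ ?]; lra.
Qed.

Lemma jessen_zeta_convex N : (0 < N)%N -> convex_real (@jessen_zeta R N).
Proof.
move=> N0 x y z xy yz; have xz := lt_trans xy yz.
apply/ler_addgt0Pl => d d0.
(* The weights on each side add up to [z - x], so an error [e] in every value costs
   [2 * e * (z - x) = d]. *)
pose e := d / (2 * (z - x)).
have e0 : 0 < e by rewrite divr_gt0// mulr_gt0// subr_gt0.
have [sx sx0 Kx] := jessen_zeta_reg x N0 e0.
have [sy sy0 Ky] := jessen_zeta_reg y N0 e0.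
have [sz sz0 Kz] := jessen_zeta_reg z N0 e0.
pose m := Num.min (Num.min sx sy) sz.
have m0 : 0 < m by rewrite !lt_min sx0 sy0.
pose s := m / 2.
have s0 : 0 < s by rewrite divr_gt0.
have : s < m by rewrite /s; lra.
rewrite /m !lt_min => /andP[/andP[ssx ssy] ssz].
have c := reg_jessen_convex N s0 xy yz.
have /ler_normlP[_ kx] := Kx s s0 ssx.
have /ler_normlP[ky _] := Ky s s0 ssy.
have /ler_normlP[_ kz] := Kz s s0 ssz.
move: c kx ky kz => /=.
move: (jessen_zeta N x) (jessen_zeta N y) (jessen_zeta N z) => jx jy jz.
move: (reg_jessen (zcoef x) N s) (reg_jessen (zcoef y) N s) (reg_jessen (zcoef z) N s) => rx ry rz c kx ky kz.
have zy0 : 0 <= z - y by rewrite subr_ge0 ltW.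
have yx0 : 0 <= y - x by rewrite subr_ge0 ltW.
have zx0 : 0 < z - x by rewrite subr_gt0.
have E : 2 * (e * (z - x)) = d by rewrite /e; field; rewrite gt_eqF.
have q1 : jy * (z - x) <= (ry + e) * (z - x).
  by apply: ler_wpM2r; [exact: ltW|move: ky; clear; lra].
have q2 : rx * (z - y) <= (jx + e) * (z - y).
  by apply: ler_wpM2r; [|move: kx; clear; lra].
have q3 : rz * (y - x) <= (jz + e) * (y - x).
  by apply: ler_wpM2r; [|move: kz; clear; lra].
move: E q1 q2 q3 c; clear; lra.
Qed.

Lemma has_mean_sum_seq (I : eqType) (s : seq I) (F : I -> R -> R) (l : I -> R) :
  (forall i, continuous (F i)) -> (forall i, i \in s -> has_mean (F i) (l i)) ->
  has_mean (fun t => \sum_(i <- s) F i t) (\sum_(i <- s) l i).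
Proof.
move=> cF Fl; have -> : (fun t => \sum_(i <- s) F i t) = fun t => \sum_(i <- s | i \in s) F i t.
  by apply/funext => t; rewrite big_seq.
by rewrite big_seq; apply: has_mean_sum.
Qed.

(** Parseval's identity: the functions [n ^ (i t)] are orthogonal for the mean. *)
Lemma has_mean_dsq (c : nat -> R) N : has_mean (dsq c N (fun=> 0)) (\sum_(1 <= n < N.+1) c n ^+ 2).
Proof.
have -> : dsq c N (fun=> 0) = fun t => \sum_(n <- index_iota 1 N.+1) \sum_(m <- index_iota 1 N.+1)
    c n * c m * cos (twisted_phase (fun=> 0) (n, m) t + 0).
  apply/funext => t; rewrite dsqE; apply: eq_bigr => n _; apply: eq_bigr => m _.
  by rewrite addr0.
have -> : \sum_(1 <= n < N.+1) c n ^+ 2 = \sum_(n <- index_iota 1 N.+1) \sum_(m <- index_iota 1 N.+1)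
    c n * c m * (if n == m then 1 else 0).
  rewrite big_seq [RHS]big_seq; apply: eq_bigr => n nN.
  rewrite (bigD1_seq n) ?iota_uniq//= eqxx mulr1 big1 ?addr0 ?expr2//.
  by move=> m mn; rewrite eq_sym (negbTE mn) mulr0.
have cc n m : continuous (fun t => c n * c m * cos (twisted_phase (fun=> 0) (n, m) t + 0)).
  by move=> t; apply: cvgMr; exact: continuous_twisted_phase.
apply: has_mean_sum_seq => n; first by apply: continuous_sum_fun => m; exact: cc.
rewrite mem_index_iota => /andP[n0 _]; apply: has_mean_sum_seq => m; first exact: cc.
rewrite mem_index_iota => /andP[m0 _]; apply: has_meanZ; first exact: continuous_twisted_phase.
have := @has_mean_twisted_phase R (fun=> 0) (n, m) 0; rewrite cos0; apply.
by rewrite /pos_pair/= n0.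
Qed.

(** Jensen's inequality in the form of the tangent line of [ln] at [K], which needs nothing but the
    mean of [dsq]. *)
Lemma reg_jessen_le_ln N (c : nat -> R) (s K : R) : 0 < s -> 0 < K ->
  \sum_(1 <= n < N.+1) c n ^+ 2 <= K -> reg_jessen c N s <= 2^-1 * (ln K + s / K).
Proof.
move=> s0 K0 cK.
have h0 := @completely_additive0 R.
have c1 := @continuous_ln_dsq R c N _ s s0 h0.
have m1 := @has_mean_reg_jessen R c N s _ s0 h0.
have cd : continuous (dsq c N (fun=> 0)) by apply: continuous_dsq.
have ck : continuous (fun _ : R => ln K + (s - K) / K) by move=> t; exact: cvg_cst.
have cKd : continuous (fun t => K^-1 * dsq c N (fun=> 0) t) by move=> t; apply: cvgMr; exact: cd.
have m2 := has_meanD ck cKd (@has_mean_cst R (ln K + (s - K) / K)) (has_meanZ (k := K^-1) cd (@has_mean_dsq c N)).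
have : 2 * reg_jessen c N s <= ln K + (s - K) / K + K^-1 * \sum_(1 <= n < N.+1) c n ^+ 2.
  apply: (le_has_mean c1 _ m1 m2) => [t|t]; first by apply: cvgD; [exact: ck|exact: cKd].
  have d0 := dsq_ge0 c N (fun=> 0) t; set d := dsq _ _ _ _ in d0 *.
  have p : 0 < (d + s) / K by rewrite divr_gt0// ltr_wpDl.
  have E : d + s = K * ((d + s) / K) by field; rewrite gt_eqF.
  have E2 : ln K + (s - K) / K + K^-1 * d = ln K + ((d + s) / K - 1) by field; rewrite gt_eqF.
  rewrite E2 [in leLHS]E lnM ?posrE// lerD2l.
  move: ((d + s) / K) p => q q0.
  have q1 : -1 < q - 1 by rewrite ltrBrDl subrr.
  by have := le_ln1Dx q1; rewrite addrC subrK.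
have : K^-1 * \sum_(1 <= n < N.+1) c n ^+ 2 <= 1 by rewrite ler_pdivrMl// mulr1.
rewrite mulrBl mulfV ?gt_eqF//; lra.
Qed.

Lemma harmonic_le (N : nat) : \sum_(1 <= n < N.+2) (n%:R : R)^-1 <= 1 + ln N.+1%:R.
Proof.
elim: N => [|N IH]; first by rewrite big_nat1 ln1 invr1 addr0.
rewrite big_nat_recr//=.
have : (N.+2%:R : R)^-1 <= ln N.+2%:R - ln N.+1%:R.
  have h : -1 < - (N.+2%:R : R)^-1 by rewrite ltrN2 invf_lt1 ?ltr0n// ltr1n.
  have := le_ln1Dx h.
  rewrite (_ : 1 - (N.+2%:R : R)^-1 = N.+1%:R / N.+2%:R); last first.
    rewrite -[N.+2%:R]natr1; have : 0 < N.+1%:R :> R by rewrite ltr0n.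
    by move: (N.+1%:R : R) => x x0; field; rewrite gt_eqF//; lra.
  rewrite ln_div ?posrE ?ltr0n//.
  by rewrite lerNr opprB.
move: IH; set a := \sum_(1 <= n < N.+2) _; move: a (N.+2%:R^-1 : R) (ln _) (ln _) => a b u v; lra.
Qed.

Lemma jessen_zeta_upper N (sigma : R) : (0 < N)%N ->
  jessen_zeta N sigma <= Num.max (2^-1 - sigma) 0 * ln N%:R + 2^-1 * ln (1 + ln N%:R).
Proof.
move=> N0; set m := Num.max _ _.
have m0 : 0 <= m by rewrite le_max lexx orbT.
have ms : 2^-1 - sigma <= m by rewrite le_max lexx.
have lN := @ln_nat_ge0 R N.
(* As [1 - 2 sigma <= 2 m], each [n ^ (- 2 sigma)] is at most [N ^ (2 m) / n]; the harmonic sum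
   gives the factor [1 + ln N]. *)
pose K : R := expR (2 * m * ln N%:R) * (1 + ln N%:R).
have K0 : 0 < K by rewrite mulr_gt0 ?expR_gt0//; lra.
have KE : ln K = 2 * m * ln N%:R + ln (1 + ln N%:R) by rewrite lnM ?posrE ?expR_gt0 ?expRK//; lra.
have cK : \sum_(1 <= n < N.+1) zcoef sigma n ^+ 2 <= K.
  apply: (@le_trans _ _ (expR (2 * m * ln N%:R) * \sum_(1 <= n < N.+1) (n%:R)^-1)); last first.
    by rewrite ler_wpM2l ?expR_ge0//; case: N N0 {m0 K K0 KE lN} => // N _; exact: harmonic_le.
  rewrite mulr_sumr big_nat [leRHS]big_nat; apply: ler_sum => n /andP[n0 nN].
  rewrite zcoefE// -expRM_natl -[n%:R in leRHS]lnK ?posrE ?ltr0n// -expRN -expRD ler_expR.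
  have ln0 := @ln_nat_ge0 R n.
  have lnN : ln (n%:R : R) <= ln N%:R by rewrite ler_ln ?posrE ?ltr0n// ler_nat.
  have a1 := ler_wpM2l m0 lnN; have a2 := ler_wpM2r ln0 ms.
  lra.
apply/ler_addgt0Pl => d d0.
have Kd : 0 < K * d by rewrite mulr_gt0.
apply: (jessen_zeta_le N0 Kd) => s s0 sd.
apply: (le_trans (reg_jessen_le_ln s0 K0 cK)); rewrite KE.
have : s / K <= d by rewrite ler_pdivrMr// mulrC ltW.
lra.
Qed.

Lemma dsq_dominant (c : nat -> R) N n0 t : (0 < n0 <= N)%N -> (forall n, 0 <= c n) ->
  8 * \sum_(1 <= n < N.+1 | n != n0) c n <= c n0 -> c n0 ^+ 2 / 4 <= dsq c N (fun=> 0) t <= 2 * c n0 ^+ 2.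
Proof.
move=> /andP[n00 n0N] c0 h; set r := \sum_(1 <= n < N.+1 | n != n0) c n in h.
have r0 : 0 <= r by apply: sumr_ge0.
have in0 : n0 \in index_iota 1 N.+1 by rewrite mem_index_iota n00.
have cn0 := c0 n0.
apply/andP; split; last first.
  apply: (le_trans (dsq_le _ _ _ _)); rewrite (bigD1_seq n0) ?iota_uniq//=.
  have -> : \sum_(1 <= n < N.+1 | n != n0) `|c n| = r.
    by apply: eq_bigr => n _; rewrite ger0_norm.
  rewrite ger0_norm//; apply: (@le_trans _ _ ((c n0 + c n0 / 8) ^+ 2)).
    by apply: lerXn2r; rewrite ?nnegrE; lra.
  rewrite (_ : (c n0 + c n0 / 8) ^+ 2 = 81 / 64 * c n0 ^+ 2); last by field.
  by rewrite ler_wpM2r ?sqr_ge0//; lra.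
rewrite /dsq /dcos /dsin !(bigD1_seq n0)/= ?iota_uniq//.
set u := \sum_(1 <= n < N.+1 | n != n0) _; set v := \sum_(1 <= n < N.+1 | n != n0) _.
set th := t * _ + _.
have ur : `|u| <= r.
  apply: (le_trans (ler_norm_sum _ _ _)); apply: ler_sum => n _.
  by rewrite normrM ger0_norm// ler_piMr// cos_max.
have vr : `|v| <= r.
  apply: (le_trans (ler_norm_sum _ _ _)); apply: ler_sum => n _.
  by rewrite normrM ger0_norm// ler_piMr// sin_max.
have a1 : - r <= cos th * u by have := @ler_pM R _ _ _ _ (normr_ge0 (cos th)) (normr_ge0 u) (cos_max th) ur; rewrite -normrM mul1r ler_norml => /andP[].
have a2 : - r <= sin th * v by have := @ler_pM R _ _ _ _ (normr_ge0 (sin th)) (normr_ge0 v) (sin_max th) vr; rewrite -normrM mul1r ler_norml => /andP[].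
rewrite (_ : _ + _ = c n0 ^+ 2 * (cos th ^+ 2 + sin th ^+ 2) + 2 * (c n0 * (cos th * u + sin th * v)) + (u ^+ 2 + v ^+ 2)); last by ring.
rewrite cos2Dsin2 mulr1.
have uv : 0 <= u ^+ 2 + v ^+ 2 by rewrite addr_ge0// sqr_ge0.
have : c n0 * (- c n0 / 4) <= c n0 * (cos th * u + sin th * v).
  by apply: ler_wpM2l => //; lra.
rewrite (_ : c n0 * (- c n0 / 4) = - (c n0 ^+ 2 / 4)); last by field.
have := sqr_ge0 (c n0); lra.
Qed.

Lemma jessen_zeta_dominant N n0 (sigma : R) : (0 < n0 <= N)%N ->
  8 * \sum_(1 <= n < N.+1 | n != n0) zcoef sigma n <= zcoef sigma n0 ->
  `|jessen_zeta N sigma + sigma * ln n0%:R| <= ln 2.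
Proof.
move=> n0N h; have /andP[n00 nN] := n0N.
have N0 : (0 < N)%N := leq_trans n00 nN.
have c0 : 0 < zcoef sigma n0 by exact: zcoef_gt0.
have lc : ln (zcoef sigma n0) = - sigma * ln n0%:R by rewrite zcoefE// expRK.
set c := zcoef sigma n0 in c0 lc *.
have c20 : 0 < c ^+ 2 by rewrite exprn_gt0.
have dom t := @dsq_dominant (zcoef sigma) N n0 t n0N (fun n => powR_ge0 _ _) h.
have l4 : ln (4 : R) = 2 * ln 2.
  by rewrite (_ : 4 = 2 ^+ 2 :> R) ?lnXn// ?mulr_natl//; ring.
have lc2 : ln (c ^+ 2) = 2 * ln c by rewrite lnXn// mulr_natl.
have l1 : ln (c ^+ 2 / 4) = 2 * (ln c - ln 2) by rewrite ln_div ?posrE// lc2 l4; ring.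
have l2 : ln (4 * c ^+ 2) = 2 * (ln c + ln 2) by rewrite lnM ?posrE// lc2 l4; ring.
have J s : 0 < s -> has_mean (fun t => ln (dsq (zcoef sigma) N (fun=> 0) t + s)) (2 * reg_jessen (zcoef sigma) N s).
  by move=> s0; apply: has_mean_reg_jessen => //; exact: completely_additive0.
have C s : 0 < s -> continuous (fun t => ln (dsq (zcoef sigma) N (fun=> 0) t + s)).
  by move=> s0; apply: continuous_ln_dsq => //; exact: completely_additive0.
have cc k : continuous (fun _ : R => k : R) by move=> t; exact: cvg_cst.
(* For [s] in this range [dsq + s] stays below [4 * c ^+ 2], an excess of [ln 2] after halving. *)
have s10 : 0 < 2 * c ^+ 2 by rewrite mulr_gt0.
rewrite ler_norml; apply/andP; split.
  suff : ln c - ln 2 <= jessen_zeta N sigma by rewrite lc; lra.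
  apply: (jessen_zeta_ge N0 s10) => s s0 _.
  have := le_has_mean (cc (2 * (ln c - ln 2))) (C s s0) (@has_mean_cst R _) (J s s0).
  suff H : forall t, 2 * (ln c - ln 2) <= ln (dsq (zcoef sigma) N (fun=> 0) t + s) by move=> /(_ H); lra.
  move=> t; have /andP[d1 _] := dom t.
  by rewrite -l1 ler_ln ?posrE ?divr_gt0// ?ltr_wpDl ?dsq_ge0// (le_trans d1)// lerDl ltW.
suff : jessen_zeta N sigma <= ln c + ln 2 by rewrite lc; lra.
apply: (jessen_zeta_le N0 s10) => s s0 s1.
have := le_has_mean (C s s0) (cc (2 * (ln c + ln 2))) (J s s0) (@has_mean_cst R _).
suff H : forall t, ln (dsq (zcoef sigma) N (fun=> 0) t + s) <= 2 * (ln c + ln 2) by move=> /(_ H); lra.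
move=> t; have /andP[_ d1] := dom t.
rewrite -l2 ler_ln ?posrE ?ltr_wpDl ?dsq_ge0 ?mulr_gt0//.
by move: d1 s1; rewrite -/c; lra.
Qed.

End jessen_bounds.

(** * Behaviour at both ends and bounds for the slopes *)

Section slopes.
Context {R : realType}.

(** A positive slope between [x] and [y] would persist to the right by convexity and outgrow [B]. *)
Lemma convex_bounded_nonincreasing (f : R -> R) (a B : R) : convex_real f ->
  (forall x, a <= x -> f x <= B) -> forall x y, x <= y -> f y <= f x.
Proof.
move=> cf fB x y; rewrite le_eqVlt => /orP[/eqP->//|xy]; rewrite leNgt; apply/negP => fxy.
pose k := (f y - f x) / (y - x).
have k0 : 0 < k by rewrite divr_gt0 ?subr_gt0.
pose z := Num.max a (y + (`|B - f y| + 1) / k).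
have az : a <= z by rewrite le_max lexx.
have yk : y + (`|B - f y| + 1) / k <= z by rewrite le_max lexx orbT.
have B1 : 0 < `|B - f y| + 1 by have := normr_ge0 (B - f y); lra.
have yz : y < z by apply: lt_le_trans yk; rewrite ltrDl divr_gt0.
have H := cf x y z xy yz.
have zy : `|B - f y| + 1 <= k * (z - y) by rewrite mulrC -ler_pdivrMr//; lra.
have kE : k * (y - x) = f y - f x by rewrite /k; field; rewrite subr_eq0 gt_eqF.
have yx0 : 0 < y - x by rewrite subr_gt0.
have E : (f y + k * (z - y)) * (y - x) = f y * (y - x) + (f y - f x) * (z - y) by rewrite -kE; ring.
have le : (f y + k * (z - y)) * (y - x) <= f z * (y - x) by rewrite E; move: H; clear; lra.
have le2 : f y + k * (z - y) <= f z by move: le; rewrite ler_pM2r.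
have := ler_norm (B - f y); have := fB z az; lra.
Qed.

(** Telescoping majorant that keeps eight times the tail below the first term [1]. The exponent [5]
    leaves three factors [x + 1 >= 2] to absorb the [8]. *)
Lemma zcoef_le_telescope (sigma : R) (n : nat) : 5 <= sigma -> (2 <= n)%N ->
  8 * zcoef sigma n <= (n.-1%:R)^-1 - (n%:R)^-1.
Proof.
move=> s5; case: n => [//|[//|n]] _ /=.
rewrite zcoefE//; set x : R := n.+1%:R.
have x1 : 1 <= x by rewrite /x ler1n.
have -> : n.+2%:R = x + 1 :> R by rewrite -[n.+2%:R]natr1.
apply: (@le_trans _ _ (8 * ((x + 1) ^+ 5)^-1)).
  rewrite ler_pM2l// -[x + 1 in leRHS]lnK ?posrE; last by lra.
  rewrite -expRM_natl -expRN ler_expR mulNr lerN2.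
  by rewrite ler_wpM2r// ln_ge0//; lra.
have x0 : 0 < x by lra.
have x10 : 0 < x + 1 by lra.
rewrite (_ : x^-1 - (x + 1)^-1 = (x * (x + 1))^-1); last by field; rewrite !gt_eqF.
rewrite ler_pdivrMr ?exprn_gt0// mulrC ler_pdivlMr ?mulr_gt0//.
rewrite (_ : (x + 1) ^+ 5 = (x + 1) * ((x + 1) ^+ 3 * (x + 1))); last by ring.
rewrite (_ : 8 * (x * (x + 1)) = (x + 1) * (8 * x)); last by ring.
rewrite ler_pM2l//; apply: ler_pM; rewrite ?(ltW x0)//; last by lra.
rewrite (_ : 8 = 2 ^+ 3 :> R); last by ring.
by apply: lerXn2r; rewrite ?nnegrE; lra.
Qed.

Lemma jessen_zeta_right N (sigma : R) : (0 < N)%N -> 5 <= sigma -> `|jessen_zeta N sigma| <= ln 2.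
Proof.
move=> N0 s5; have := @jessen_zeta_dominant R N 1 sigma; rewrite ln1 mulr0 addr0; apply; first by [].
rewrite zcoef1.
suff H : 8 * \sum_(1 <= n < N.+1 | n != 1%N) zcoef sigma n <= 1 - (N%:R)^-1.
  by apply: (le_trans H); rewrite gerBl invr_ge0.
case: N N0 => // N _; elim: N => [|N IH].
  by rewrite big_mkcond big_nat1/= mulr0 invr1 subrr.
rewrite big_mkcond big_nat_recr//= -big_mkcond/= mulrDr.
by apply: (le_trans (lerD IH (@zcoef_le_telescope sigma N.+2 s5 isT))); rewrite /= addrA subrK.
Qed.

Lemma jessen_zeta_left N : (2 <= N)%N -> exists a : R, forall sigma, sigma <= a ->
  `|jessen_zeta N sigma + sigma * ln N%:R| <= ln 2.
Proof.
move=> N2; have N0 : (0 < N)%N by exact: leq_trans N2.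
have N1 : (0 < N.-1)%N by case: N N2 {N0} => [|[]].
pose d : R := ln N%:R - ln N.-1%:R.
have d0 : 0 < d by rewrite subr_gt0 ltr_ln ?posrE ?ltr0n// ltr_nat; case: N N0 {N2 N1 d}.
have NR : 0 < N%:R :> R by rewrite ltr0n.
(* Here [(N / (N-1)) ^ (- sigma)] has reached [8 N], so the other [N - 1] terms add up to at most an
   eighth of the last one. *)
exists (- (ln (8 * N%:R) / d)) => sigma hs; apply: jessen_zeta_dominant; first by rewrite N0 leqnn.
have s0 : ln (8 * N%:R) <= - sigma * d by rewrite -ler_pdivrMr// -lerNr.
have l8 : 0 <= ln (8 * N%:R : R).
  by apply: ln_ge0; have : 1 <= N%:R :> R by [rewrite ler1n]; lra.
have s00 : 0 <= - sigma.
  by move: hs; have := divr_ge0 l8 (ltW d0); lra.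
have key n : (0 < n < N)%N -> zcoef sigma n <= zcoef sigma N / (8 * N%:R).
  move=> /andP[n0 nN]; rewrite !zcoefE// -[8 * N%:R]lnK ?posrE ?mulr_gt0// -expRN -expRD ler_expR.
  have : ln (n%:R : R) <= ln N.-1%:R.
    by rewrite ler_ln ?posrE ?ltr0n// ler_nat -ltnS prednK.
  move=> h; have := ler_wpM2l s00 h; move: s0; rewrite /d; lra.
rewrite big_mkcond big_nat_recr//= eqxx/= addr0.
apply: (@le_trans _ _ (8 * \sum_(1 <= n < N) zcoef sigma N / (8 * N%:R))).
  rewrite ler_pM2l// big_nat [leRHS]big_nat; apply: ler_sum => n /andP[n0 nN].
  by rewrite (ltn_eqF nN)/=; apply: key; rewrite n0.
rewrite sumr_const_nat -[(_ / _) *+ _]mulr_natr.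
have c0 : 0 < zcoef sigma N by exact: zcoef_gt0.
rewrite (_ : 8 * _ = zcoef sigma N * ((N - 1)%:R / N%:R)); last by field; rewrite gt_eqF.
by rewrite ler_piMr ?(ltW c0)// ler_pdivrMr// mul1r ler_nat leq_subr.
Qed.

Lemma jessen_zeta_nonincreasing N (x y : R) : (0 < N)%N -> x <= y -> jessen_zeta N y <= jessen_zeta N x.
Proof.
move=> N0; apply: (convex_bounded_nonincreasing (a := 5) (B := ln 2)); first exact: jessen_zeta_convex.
by move=> z z5; apply: le_trans (ler_norm _) (jessen_zeta_right N0 z5).
Qed.

(** The reflection [u -> - u] turns [J_N(sigma) + sigma ln N], bounded near [-oo], into a convex
    function bounded to the right, hence nonincreasing. *)
Lemma jessen_zeta_slope_ge N (x y : R) : (2 <= N)%N -> x <= y ->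
  jessen_zeta N x + x * ln N%:R <= jessen_zeta N y + y * ln N%:R.
Proof.
move=> N2 xy; have N0 : (0 < N)%N by exact: leq_trans N2.
have [a Ha] := jessen_zeta_left N2.
pose g (u : R) := jessen_zeta N (- u) + (- u) * ln N%:R.
have cg : convex_real g.
  move=> u v w uv vw; rewrite /g.
  have wv' : - w < - v by rewrite ltrN2.
  have vu' : - v < - u by rewrite ltrN2.
  have := jessen_zeta_convex N0 wv' vu'.
  move: (jessen_zeta N (- u)) (jessen_zeta N (- v)) (jessen_zeta N (- w)) (ln (N%:R : R)) => a1 a2 a3 L.
  rewrite (_ : - u - - w = w - u); last by ring.
  rewrite (_ : - u - - v = v - u); last by ring.
  rewrite (_ : - v - - w = w - v); last by ring.
  move=> h; rewrite -subr_ge0 (_ : _ - _ = a3 * (v - u) + a1 * (w - v) - a2 * (w - u)) ?subr_ge0//.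
  by ring.
have gB u : - a <= u -> g u <= ln 2.
  by move=> au; apply: le_trans (ler_norm _) (Ha _ _); lra.
have yx : - y <= - x by rewrite lerN2.
by have := convex_bounded_nonincreasing cg gB yx; rewrite /g !opprK.
Qed.

Lemma jessen_zeta_lower N (x : R) : (0 < N)%N -> - ln 2 <= jessen_zeta N x.
Proof.
move=> N0; apply: (@le_trans _ _ (jessen_zeta N (Num.max x 5))).
  have h : 5 <= Num.max x 5 by rewrite le_max lexx orbT.
  by have := jessen_zeta_right N0 h; rewrite ler_norml => /andP[].
by apply: jessen_zeta_nonincreasing; rewrite // le_max lexx.
Qed.

End slopes.

(** * Logarithmic averages over finitely many phases *)

Section phase_average.
Context {R : realType}.

Definition dyadic_angle (m j : nat) : R := 2 * pi * j%:R / 2 ^+ m.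

(* Pairing the angles [x] and [x + pi] turns the average of
   [ln (A + B + s + p cos x + q sin x)] into the same average over half as many
   doubled angles, with [A, B] replaced by their squares. *)
Lemma dyadic_log_average (m : nat) (A B s p q : R) : 0 <= A -> 0 < B -> 0 < s ->
  p ^+ 2 + q ^+ 2 = 4 * A * B ->
  ((2 ^ m)%:R - 1) * ln B + ln s <= \sum_(0 <= j < 2 ^ m)
    ln (A + B + s + p * cos (dyadic_angle m j) + q * sin (dyadic_angle m j)).
Proof.
have bound (A' B' p' q' x : R) : 0 <= A' -> 0 < B' -> p' ^+ 2 + q' ^+ 2 = 4 * A' * B' ->
    `|p' * cos x + q' * sin x| <= A' + B'.
  move=> A0 B0 pq; rewrite -(@ler_pXn2r _ 2) ?nnegrE ?addr_ge0 ?(ltW B0)//.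
  rewrite real_normK ?num_real//.
  apply: (@le_trans _ _ (p' ^+ 2 + q' ^+ 2)).
    have E : (p' ^+ 2 + q' ^+ 2) = (p' * cos x + q' * sin x) ^+ 2 + (p' * sin x - q' * cos x) ^+ 2.
      rewrite -[LHS]mulr1 -(cos2Dsin2 x); ring.
    by rewrite E lerDl sqr_ge0.
  rewrite pq -subr_ge0 (_ : _ - _ = (A' - B') ^+ 2); last by ring.
  exact: sqr_ge0.
elim: m A B s p q => [|m IH] A B s p q A0 B0 s0 pq.
  rewrite expn0 subrr mul0r add0r big_nat1.
  have := bound A B p q (dyadic_angle 0 0) A0 B0 pq; rewrite ler_norml => /andP[h _].
  by rewrite ler_ln ?posrE//; move: h; set c := cos _; set d := sin _; move: (p * c) (q * d) => u v; lra.
have dbl j : 2 * dyadic_angle m.+1 j = dyadic_angle m j.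
  rewrite /dyadic_angle exprS; field; by rewrite expf_neq0.
have shift j : dyadic_angle m.+1 (j + 2 ^ m) = dyadic_angle m.+1 j + pi.
  rewrite /dyadic_angle natrD natrX exprS; field; by rewrite expf_neq0.
(* In the product of two paired arguments, [2 A B] from [(A + B + s)^2] cancels the constant part
   [(p^2 + q^2) / 2] of the subtracted square, leaving [s'] and the double-angle coefficients [p'],
   [q']. The bound [s' >= 2 s B] supplies the one [ln B] missing from [2 (2 ^ m - 1)] to reach
   [2 ^ (m+1) - 1]. *)
pose s' := 2 * s * (A + B) + s ^+ 2.
pose p' := - ((p ^+ 2 - q ^+ 2) / 2); pose q' := - (p * q).
have sB : 2 * s * B <= s'.
  rewrite /s' mulrDr; have := mulr_ge0 (ltW s0) A0; have := sqr_ge0 s.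
  move: (s * B) => *; lra.
have sB0 : 0 < 2 * s * B by rewrite !mulr_gt0.
have s'0 : 0 < s' by exact: lt_le_trans sB.
have pq' : p' ^+ 2 + q' ^+ 2 = 4 * A ^+ 2 * B ^+ 2.
  rewrite (_ : 4 * _ * _ = (4 * A * B) ^+ 2 / 4); last by field.
  by rewrite -pq /p' /q'; field.
have pair j : ln (A + B + s + p * cos (dyadic_angle m.+1 j) + q * sin (dyadic_angle m.+1 j)) +
    ln (A + B + s + p * cos (dyadic_angle m.+1 (j + 2 ^ m)) + q * sin (dyadic_angle m.+1 (j + 2 ^ m))) =
    ln (A ^+ 2 + B ^+ 2 + s' + p' * cos (dyadic_angle m j) + q' * sin (dyadic_angle m j)).
  rewrite shift cosDpi sinDpi -dbl; set x := dyadic_angle m.+1 j.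
  have := bound A B p q x A0 B0 pq; rewrite ler_norml => /andP[h1 h2].
  have c2 : cos (2 * x) = cos x ^+ 2 - sin x ^+ 2 by rewrite mulr_natl mulr2n cosD !expr2.
  have s2 : sin (2 * x) = 2 * (cos x * sin x) by rewrite mulr_natl sin_mulr2n mulr_natl.
  have pos1 : 0 < A + B + s + p * cos x + q * sin x.
    by move: h1; move: (p * cos x) (q * sin x) => u v; lra.
  have pos2 : 0 < A + B + s + p * - cos x + q * - sin x.
    by move: h2; rewrite !mulrN; move: (p * cos x) (q * sin x) => u v; lra.
  rewrite -lnM ?posrE// c2 s2; congr ln.
  have E : 2 * A * B = (p ^+ 2 + q ^+ 2) / 2 * (cos x ^+ 2 + sin x ^+ 2).
    by rewrite cos2Dsin2 mulr1 pq; field.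
  transitivity ((A + B + s) ^+ 2 - (p * cos x + q * sin x) ^+ 2); first by ring.
  rewrite (_ : (A + B + s) ^+ 2 = A ^+ 2 + B ^+ 2 + 2 * A * B + s'); last by rewrite /s'; ring.
  by rewrite E /p' /q'; field.
have e2 : (2 ^ m.+1)%N = (2 ^ m + 2 ^ m)%N by rewrite expnS mul2n addnn.
rewrite e2 (@big_cat_nat _ _ _ (2 ^ m)%N)//=; last exact: leq_addr.
pose F j := ln (A + B + s + p * cos (dyadic_angle m.+1 j) + q * sin (dyadic_angle m.+1 j)).
have := @big_addn R 0 +%R 0 (2 ^ m + 2 ^ m) (2 ^ m) xpredT F.
rewrite add0n addnK => ->; rewrite -big_split/=.
rewrite (eq_bigr _ (fun j _ => pair j)).
have B20 : 0 < B ^+ 2 by rewrite exprn_gt0.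
apply: le_trans (IH (A ^+ 2) (B ^+ 2) s' p' q' (sqr_ge0 A) B20 s'0 pq').
have ls : ln 2 + ln s + ln B <= ln s'.
  by rewrite -!lnM ?posrE ?mulr_gt0// ler_ln ?posrE.
have l2 : 0 <= ln (2 : R) by rewrite ln_ge0//; lra.
rewrite lnXn// -[ln B *+ 2]mulr_natl natrD.
move: (2 ^ m)%:R (ln B) (ln s) (ln s') (ln (2 : R)) ls l2; clear.
move=> K b u v w h1 h2; rewrite -subr_ge0 (_ : _ - _ = (v - (w + u + b)) + w); last by ring.
by apply: addr_ge0; rewrite ?subr_ge0.
Qed.

Definition update (I : finType) (T : Type) (th : {ffun I -> T}) (i : I) (x : T) : {ffun I -> T} :=
  [ffun k => if k == i then x else th k].

(** Resampling a coordinate preserves the uniform average: exchanging the stored value with the new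
    one is an involution on the pairs [(th, x)]. *)
Lemma sum_update (I T : finType) (i : I) (G : {ffun I -> T} -> R) :
  \sum_(th : {ffun I -> T}) \sum_(x : T) G (update th i x) = #|T|%:R * \sum_(th : {ffun I -> T}) G th.
Proof.
rewrite pair_big/=.
pose h (y : {ffun I -> T} * T) := (update y.1 i y.2, y.1 i).
have hK : involutive h.
  move=> [th x]; rewrite /h/=; congr pair; last by rewrite ffunE eqxx.
  by apply/ffunP => k; rewrite !ffunE; case: eqP => // ->.
rewrite (reindex_inj (inv_inj hK))/=.
rewrite (eq_bigr (fun y => G y.1)); last first.
  move=> [th x] _ /=; congr G; apply/ffunP => k; rewrite !ffunE.
  by case: eqP => // ->.
rewrite -(pair_big xpredT xpredT (fun th _ => G th))/= mulr_sumr.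
by apply: eq_bigr => th _; rewrite sumr_const mulr_natl.
Qed.

(* [|a + \sum_k e^(i th_k) u_k|^2] for [a = a1 + i a2] and [u_k = u1 k + i u2 k]. *)
Definition rotated_sqr (I : finType) (a1 a2 : R) (u1 u2 th : I -> R) : R :=
  (a1 + \sum_i (u1 i * cos (th i) - u2 i * sin (th i))) ^+ 2 +
  (a2 + \sum_i (u2 i * cos (th i) + u1 i * sin (th i))) ^+ 2.

(** Only the [i]-th phase is really averaged, everything else being a constant for it. As [i] is
    free, it may be the largest block; the terms with [2 ^ (- m)] vanish in the limit. *)
Lemma phase_average (I : finType) (m : nat) (a1 a2 s : R) (u1 u2 : I -> R) (i : I) :
  0 < s -> 0 < u1 i ^+ 2 + u2 i ^+ 2 ->
  #|{ffun I -> 'I_(2 ^ m)}|%:R * ((1 - (2 ^+ m)^-1) * ln (u1 i ^+ 2 + u2 i ^+ 2) + (2 ^+ m)^-1 * ln s) <=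
  \sum_(th : {ffun I -> 'I_(2 ^ m)})
    ln (rotated_sqr a1 a2 u1 u2 (fun k => dyadic_angle m (th k)) + s).
Proof.
move=> s0 B0; set B := u1 i ^+ 2 + u2 i ^+ 2 in B0 *.
pose G (th : {ffun I -> 'I_(2 ^ m)}) := ln (rotated_sqr a1 a2 u1 u2 (fun k => dyadic_angle m (th k)) + s).
have M0 : 0 < (2 : R) ^+ m by rewrite exprn_gt0.
have key th : (2 ^+ m - 1) * ln B + ln s <= \sum_(j : 'I_(2 ^ m)) G (update th i j).
  pose w1 := a1 + \sum_(k | k != i) (u1 k * cos (dyadic_angle m (th k)) - u2 k * sin (dyadic_angle m (th k))).
  pose w2 := a2 + \sum_(k | k != i) (u2 k * cos (dyadic_angle m (th k)) + u1 k * sin (dyadic_angle m (th k))).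
  pose p := 2 * (w1 * u1 i + w2 * u2 i); pose q := 2 * (w2 * u1 i - w1 * u2 i).
  have pq : p ^+ 2 + q ^+ 2 = 4 * (w1 ^+ 2 + w2 ^+ 2) * B by rewrite /p /q /B; ring.
  have A0 : 0 <= w1 ^+ 2 + w2 ^+ 2 by rewrite addr_ge0// sqr_ge0.
  have := dyadic_log_average m A0 B0 s0 pq; rewrite natrX big_mkord => /le_trans; apply.
  apply: ler_sum => j _; rewrite le_eqVlt; apply/orP; left; apply/eqP; rewrite /G; congr ln.
  have e1 : \sum_k (u1 k * cos (dyadic_angle m (update th i j k)) - u2 k * sin (dyadic_angle m (update th i j k))) =
      (u1 i * cos (dyadic_angle m j) - u2 i * sin (dyadic_angle m j)) + (w1 - a1).
    rewrite (bigD1 i)//= ffunE eqxx; congr (_ + _); rewrite /w1 addrC addKr.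
    by apply: eq_bigr => k /negbTE ki; rewrite ffunE ki.
  have e2 : \sum_k (u2 k * cos (dyadic_angle m (update th i j k)) + u1 k * sin (dyadic_angle m (update th i j k))) =
      (u2 i * cos (dyadic_angle m j) + u1 i * sin (dyadic_angle m j)) + (w2 - a2).
    rewrite (bigD1 i)//= ffunE eqxx; congr (_ + _); rewrite /w2 addrC addKr.
    by apply: eq_bigr => k /negbTE ki; rewrite ffunE ki.
  rewrite /rotated_sqr e1 e2 /p /q.
  have -> : w1 ^+ 2 + w2 ^+ 2 + B = w1 ^+ 2 + w2 ^+ 2 + B * (cos (dyadic_angle m j) ^+ 2 + sin (dyadic_angle m j) ^+ 2).
    by rewrite cos2Dsin2 mulr1.
  by rewrite /B; ring.
have tot : \sum_(th : {ffun I -> 'I_(2 ^ m)}) ((2 ^+ m - 1) * ln B + ln s) <= 2 ^+ m * \sum_th G th.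
  have := sum_update i G; rewrite card_ord natrX => <-.
  by apply: ler_sum => th _; exact: key.
move: tot; rewrite sumr_const -[_ *+ _]mulr_natl => tot.
rewrite -(ler_pM2l M0); apply: le_trans tot.
rewrite le_eqVlt; apply/orP; left; apply/eqP; field; exact: lt0r_neq0.
Qed.

End phase_average.

(** * Independent phases at the primes in [(N/2, N]] *)

Section lower_bound.
Context {R : realType}.

Lemma prime_mul_eq (p q p' q' : nat) : prime p -> prime q -> prime p' -> prime q' -> p != q ->
  (p * p' = q * q')%N -> p' = q /\ q' = p.
Proof.
move=> pp pq pp' pq' npq E.
have : (p %| q * q')%N by rewrite -E dvdn_mulr.
rewrite Euclid_dvdM// !dvdn_prime2// (negbTE npq)/= => /eqP pq0; split => //.
move: E; rewrite -pq0 [(q * _)%N]mulnC => /eqP; rewrite eqn_pmul2l ?prime_gt0//.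
by move/eqP.
Qed.

(** Squaring gives resonances [e.1 f.1 = e.2 f.2] and [e.1 f.2 = e.2 f.1]; by unique factorisation
    the former forces [f] to be [e] swapped and the latter [f = e]. With weight [1/2] each, every
    [e] contributes at most [1]. *)
Lemma has_mean_prime_pairs (E : seq (nat * nat)) : uniq E ->
  (forall e, e \in E -> [/\ prime e.1, prime e.2 & e.1 != e.2]) ->
  exists2 l : R, l <= (size E)%:R &
  has_mean (fun t => (\sum_(e <- E) cos (twisted_phase (fun=> 0) e t)) ^+ 2) l.
Proof.
move=> uE pE; pose z : nat -> R := fun=> 0.
have posE e : e \in E -> pos_pair e.
  by move=> /pE[p1 p2 _]; rewrite /pos_pair !prime_gt0.
pose l := \sum_(e <- E) \sum_(f <- E) (2^-1 * (if (e.1 * f.1 == e.2 * f.2)%N then 1 else 0) +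
  2^-1 * (if (e.1 * f.2 == e.2 * f.1)%N then 1 else 0)) : R.
exists l.
  rewrite /l -sum1_size natr_sum big_seq [leRHS]big_seq; apply: ler_sum => e eE.
  have [p1 p2 ne] := pE e eE.
  have one (x : nat * nat) : \sum_(f <- E) (if f == x then 1 else 0) <= 1 :> R.
    rewrite -big_mkcond/= (_ : \sum_(f <- E | f == x) 1 = (count_mem x E)%:R).
      by rewrite (@count_uniq_mem _ E x uE); case: (x \in E); rewrite ?lexx ?ler01.
    by rewrite -sum1_count natr_sum.
  apply: (@le_trans _ _ (2^-1 * \sum_(f <- E) (if f == (e.2, e.1) then 1 else 0) +
     2^-1 * \sum_(f <- E) (if f == e then 1 else 0))); last first.
    by have := one (e.2, e.1); have := one e; lra.
  rewrite !mulr_sumr -big_split/= big_seq [leRHS]big_seq; apply: ler_sum => f fE.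
  have [f1 f2 nf] := pE f fE.
  apply: lerD; rewrite ler_pM2l ?invr_gt0//.
    case: eqP => [h|_]; last by case: ifP.
    have [h1 h2] := prime_mul_eq p1 p2 f1 f2 ne h.
    by rewrite (_ : f = (e.2, e.1)) ?eqxx//; case: (f) h1 h2 => a b /= -> ->.
  case: eqP => [h|_]; last by case: ifP.
  have [h1 h2] := prime_mul_eq p1 p2 f2 f1 ne h.
  by rewrite (_ : f = e) ?eqxx//; case: (f) (e) h1 h2 => a b [c d] /= -> ->.
have -> : (fun t => (\sum_(e <- E) cos (twisted_phase (fun=> 0) e t)) ^+ 2) =
  fun t => \sum_(e <- E) \sum_(f <- E) (if (e \in E) && (f \in E) then
    2^-1 * cos (twisted_phase z (e.1 * f.1, e.2 * f.2)%N t + 0) +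
    2^-1 * cos (twisted_phase z (e.1 * f.2, e.2 * f.1)%N t + 0) else 0).
  apply/funext => t; rewrite expr2 mulr_suml big_seq [RHS]big_seq; apply: eq_bigr => e eE.
  rewrite mulr_sumr big_seq [RHS]big_seq; apply: eq_bigr => f fE.
  rewrite eE fE/= !addr0.
  have := posE e eE; have := posE f fE; move: e f {eE fE} => [a b] [c d] /= h1 h2.
  have h0 := @completely_additive0 R.
  by rewrite -(twisted_phaseD _ h0 h2 h1) -(twisted_phaseB _ h0 h2 h1) cosMcos.
have cc (e f : nat * nat) : continuous (fun t => if (e \in E) && (f \in E) then
    2^-1 * cos (twisted_phase z (e.1 * f.1, e.2 * f.2)%N t + 0) +
    2^-1 * cos (twisted_phase z (e.1 * f.2, e.2 * f.1)%N t + 0) else 0).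
  case: ((e \in E) && (f \in E)); last by move=> t; exact: cvg_cst.
  by move=> t; apply: cvgD; apply: cvgMr; exact: continuous_twisted_phase.
apply: has_mean_sum_seq => e; first by apply: continuous_sum_fun => f; exact: cc.
move=> eE; apply: has_mean_sum_seq => f; first exact: cc.
move=> fE; rewrite eE fE/=.
have /andP[e1 e2] := posE e eE; have /andP[f1 f2] := posE f fE.
have H a : pos_pair a -> has_mean (fun t => 2^-1 * cos (twisted_phase z a t + 0)) (2^-1 * (if a.1 == a.2 then 1 else 0)).
  move=> ha; apply: has_meanZ; first exact: continuous_twisted_phase.
  by have := @has_mean_twisted_phase R z a 0 ha; rewrite cos0.
apply: has_meanD.
- by move=> t; apply: cvgMr; exact: continuous_twisted_phase.
- by move=> t; apply: cvgMr; exact: continuous_twisted_phase.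
- by apply: (H (_, _)); rewrite /pos_pair/= !muln_gt0 e1 e2 f1.
- by apply: (H (_, _)); rewrite /pos_pair/= !muln_gt0 e1 e2 f1 f2.
Qed.

Lemma sum_nat_codom (J : finType) (P : J -> nat) (N : nat) (F : nat -> R) : injective P ->
  (forall j, (0 < P j <= N)%N) ->
  \sum_(1 <= k < N.+1) F k = \sum_(1 <= k < N.+1 | k \notin codom P) F k + \sum_j F (P j).
Proof.
move=> injP PN; rewrite (bigID (fun k => k \notin codom P))/=; congr (_ + _).
rewrite (eq_bigl (fun k => k \in codom P)); last by move=> k; rewrite negbK.
rewrite -big_filter -(big_map P xpredT F); apply: perm_big; apply: uniq_perm.
- by rewrite filter_uniq// iota_uniq.
- by rewrite map_inj_uniq// index_enum_uniq.
move=> k; rewrite mem_filter mem_index_iota ltnS; apply/andP/mapP => [[/codomP[j ->] _]|[j _ ->]].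
  by exists j => //; rewrite mem_index_enum.
by split => //; exact: codom_f.
Qed.

(** Extends the choice of phase [ang (b j)] at each prime [P j], common to its block [b j], to a
    completely additive function vanishing at the other primes. *)
Definition prime_twist (J I : finType) (P : J -> nat) (b : J -> I) (ang : I -> R) (n : nat) : R :=
  \sum_j ang (b j) * (logn (P j) n)%:R.

Lemma completely_additive_prime_twist (J I : finType) (P : J -> nat) (b : J -> I) (ang : I -> R) :
  completely_additive (prime_twist P b ang).
Proof.
move=> x y x0 y0; rewrite /prime_twist -big_split/=; apply: eq_bigr => j _.
by rewrite lognM// natrD mulrDr.
Qed.

Lemma dsq_prime_twist (J I : finType) (P : J -> nat) (b : J -> I) (ang : I -> R) (N : nat) (t : R) :
  injective P -> (forall j, [/\ prime (P j), (N < 2 * P j)%N & (P j <= N)%N]) ->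
  dsq (fun=> 1) N (prime_twist P b ang) t =
  rotated_sqr (\sum_(1 <= k < N.+1 | k \notin codom P) cos (t * ln k%:R))
    (\sum_(1 <= k < N.+1 | k \notin codom P) sin (t * ln k%:R))
    (fun i => \sum_(j | b j == i) cos (t * ln (P j)%:R))
    (fun i => \sum_(j | b j == i) sin (t * ln (P j)%:R)) ang.
Proof.
move=> injP HP.
have PN j : (0 < P j <= N)%N by have [p _ ->] := HP j; rewrite prime_gt0.
have lognP j k : (0 < k <= N)%N -> logn (P j) k = (k == P j).
  move=> /andP[k0 kN]; have [pp N2 _] := HP j.
  case: (eqVneq k (P j)) => [->|ne]; first by rewrite logn_prime ?eqxx.
  apply/eqP; rewrite -leqn0 leqNgt logn_gt0 mem_primes pp k0/=; apply/negP => /dvdnP[c E].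
  by move: c E => [|[|c]] E; move: ne k0 kN N2; rewrite E ?mul1n ?eqxx//; nia.
have out k : k \notin codom P -> (0 < k <= N)%N -> prime_twist P b ang k = 0.
  move=> kP kN; rewrite /prime_twist big1// => j _; rewrite lognP//.
  by case: eqP => [E|]; [move: kP; rewrite E codom_f|rewrite mulr0].
have inn j : prime_twist P b ang (P j) = ang (b j).
  rewrite /prime_twist (bigD1 j)//= lognP// eqxx mulr1 big1 ?addr0// => i ij.
  by rewrite lognP// (inj_eq injP) eq_sym (negbTE ij) mulr0.
have regroup (F : J -> R) : \sum_j F j = \sum_i \sum_(j | b j == i) F j.
  by rewrite (partition_big b xpredT).
rewrite /dsq /dcos /dsin /rotated_sqr; congr (_ ^+ 2 + _ ^+ 2).
  rewrite (sum_nat_codom _ injP PN); congr (_ + _).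
    rewrite big_nat_cond [RHS]big_nat_cond; apply: eq_bigr => k /andP[/andP[k0 kN] kP].
    by rewrite out ?k0// addr0 mul1r.
  rewrite regroup; apply: eq_bigr => i _; rewrite !mulr_suml -sumrB; apply: eq_bigr => j /eqP <-.
  by rewrite inn mul1r cosD.
rewrite (sum_nat_codom _ injP PN); congr (_ + _).
  rewrite big_nat_cond [RHS]big_nat_cond; apply: eq_bigr => k /andP[/andP[k0 kN] kP].
  by rewrite out ?k0// addr0 mul1r.
rewrite regroup; apply: eq_bigr => i _; rewrite !mulr_suml -big_split/=; apply: eq_bigr => j /eqP <-.
by rewrite inn mul1r sinD.
Qed.

Lemma zcoef0 : zcoef (0 : R) = fun=> 1.
Proof. by apply/funext => n; rewrite /zcoef oppr0 powRr0. Qed.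

End lower_bound.

(** * The lower bound at [0] from blocks of primes *)

Section lower_bound_at_0.
Context {R : realType}.

Lemma dyadic_limit_le (X Y Z : R) : (forall m, (1 - (2 ^+ m)^-1) * Y + (2 ^+ m)^-1 * Z <= X) -> Y <= X.
Proof.
move=> H; apply/ler_addgt0Pl => d d0.
have h12 : `|2^-1 : R| < 1 by rewrite ger0_norm; lra.
have A0 : 0 < `|Y - Z| + 1 by have := normr_ge0 (Y - Z); lra.
have e0 : 0 < d / (`|Y - Z| + 1) by rewrite divr_gt0.
have /cvgrPdist_lt/(_ _ e0)[m _ /(_ m (leqnn m))] := cvg_expr h12.
rewrite sub0r normrN ger0_norm ?exprn_ge0 ?invr_ge0// ltr_pdivlMr// exprVn => h.
have := H m; have e1 : 0 <= (2 ^+ m)^-1 :> R by rewrite invr_ge0 exprn_ge0.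
move: ((2 ^+ m)^-1) h e1 => e h e1 Hm.
have : e * (Y - Z) <= e * (`|Y - Z| + 1).
  by apply: ler_wpM2l => //; have := ler_norm (Y - Z); lra.
move: h Hm; move: (e * (`|Y - Z| + 1)) => w h Hm k.
apply: (le_trans _ (lerD (ltW (le_lt_trans k h)) Hm)).
by rewrite le_eqVlt; apply/orP; left; apply/eqP; ring.
Qed.

Lemma cos_phase_pair (x y : nat) (t : R) : cos (twisted_phase (fun=> 0) (x, y) t) =
  cos (t * ln x%:R) * cos (t * ln y%:R) + sin (t * ln x%:R) * sin (t * ln y%:R).
Proof. by rewrite -cosB; congr cos; rewrite /twisted_phase/=; ring. Qed.

Lemma sum_block_sqr (J I : finType) (P : J -> nat) (b : J -> I) (t : R) :
  \sum_i ((\sum_(j | b j == i) cos (t * ln (P j)%:R)) ^+ 2 + (\sum_(j | b j == i) sin (t * ln (P j)%:R)) ^+ 2) =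
  #|J|%:R + \sum_(x : J * J | (x.1 != x.2) && (b x.1 == b x.2)) cos (twisted_phase (fun=> 0) (P x.1, P x.2) t).
Proof.
transitivity (\sum_j \sum_(k | b j == b k) cos (twisted_phase (fun=> 0) (P j, P k) t)).
  rewrite [RHS](partition_big b xpredT)//=; apply: eq_bigr => i _.
  rewrite !expr2 !mulr_suml -big_split/=; apply: eq_bigr => j /eqP <-.
  rewrite !mulr_sumr -big_split/=; rewrite (eq_bigl (fun k => b j == b k)); last by move=> k; rewrite eq_sym.
  by apply: eq_bigr => k _; rewrite cos_phase_pair.
rewrite -sum1_card natr_sum -(pair_big_dep xpredT (fun j k => (j != k) && (b j == b k))
  (fun j k => cos (twisted_phase (fun=> 0) (P j, P k) t)))/= -big_split/=; apply: eq_bigr => j _.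
rewrite (bigD1 j)//=; congr (_ + _).
  by rewrite /twisted_phase/= !subrr mulr0 addr0 cos0.
by apply: eq_bigl => k; rewrite andbC eq_sym.
Qed.

(** The block [None] is a singleton and gives no pair of distinct elements; the other pairs are
    coded by a block and two positions in it. *)
Lemma card_block_pairs (K v : nat) :
  (#|[pred x : option ('I_K * 'I_v) * option ('I_K * 'I_v) |
     (x.1 != x.2) && (omap fst x.1 == omap fst x.2)]| <= K * v * v)%N.
Proof.
pose f (y : 'I_K * 'I_v * 'I_v) := (Some y.1, Some (y.1.1, y.2)).
have <- : #|{: 'I_K * 'I_v * 'I_v}| = (K * v * v)%N by rewrite !card_prod !card_ord.
apply: (leq_trans _ (leq_image_card f {: 'I_K * 'I_v * 'I_v})); apply: subset_leq_card.
apply/fintype.subsetP => -[[x|] [y|]]; rewrite !inE//= => /andP[_].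
move: x y => [i a] [i' a'] /= /eqP[<-]; apply/fintype.imageP.
by exists ((i, a), a').
Qed.

(** Besides [K] blocks of [v] primes there is one more prime, forming the block [None] of modulus
    [1]. It gives the fallback [ln 1 = 0] at those [t] where all the other blocks may be small, and
    it explains the strict inequality on [K * v]. *)
Lemma jessen_zeta0_lower (N K v : nat) : (0 < N)%N -> (0 < K)%N -> (2 <= v)%N ->
  (K * v < size (upper_primes N./2))%N ->
  2^-1 * (ln (v%:R / 2) * (1 - 4 / K%:R)) <= jessen_zeta N 0 :> R.
Proof.
move=> N0 K0 v2 KvQ; set Q := upper_primes _ in KvQ.
pose J : finType := option ('I_K * 'I_v)%type; pose I : finType := option 'I_K.
pose b : J -> I := omap fst.
have cJ : #|J| = (K * v).+1 by rewrite card_option card_prod !card_ord.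
pose P (j : J) := nth 0%N Q (enum_rank j).
have rk (j : J) : (enum_rank j < size Q)%N by apply: leq_trans (ltn_ord _) _; rewrite cJ.
have PQ j : P j \in Q by exact: mem_nth.
have injP : injective P.
  move=> j k /eqP; rewrite nth_uniq ?filter_uniq ?iota_uniq// => /eqP h.
  by apply: enum_rank_inj; exact: val_inj.
have HP j : [/\ prime (P j), (N < 2 * P j)%N & (P j <= N)%N].
  have := PQ j; rewrite mem_filter mem_index_iota => /andP[pp /andP[h1 h2]].
  by have := odd_double_half N; case: (odd N) => /= E; split => //; lia.
pose L := ln (v%:R / 2 : R).
have v20 : 1 <= v%:R / 2 :> R by rewrite ler_pdivlMr// mul1r ler_nat.
have L0 : 0 <= L by exact: ln_ge0.
have KR : 0 < K%:R :> R by rewrite ltr0n.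
have vR : 0 < v%:R :> R by rewrite ltr0n; exact: leq_trans v2.
pose D t := \sum_(x : J * J | (x.1 != x.2) && (b x.1 == b x.2)) cos (twisted_phase (fun=> 0 : R) (P x.1, P x.2) t).
have [l lB meanD] : exists2 l : R, l <= K%:R * v%:R * v%:R & has_mean (fun t => D t ^+ 2) l.
  pose E := [seq (P x.1, P x.2) | x <- enum [pred x : J * J | (x.1 != x.2) && (b x.1 == b x.2)]].
  have uE : uniq E.
    rewrite map_inj_uniq ?enum_uniq// => -[x1 x2] [y1 y2] /= [/injP-> /injP->]//.
  have pE e : e \in E -> [/\ prime e.1, prime e.2 & e.1 != e.2].
    move=> /mapP[x]; rewrite mem_enum inE => /andP[ne _] ->/=.
    by have [p1 _ _] := HP x.1; have [p2 _ _] := HP x.2; split => //; rewrite (inj_eq injP).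
  have [l lE h] := @has_mean_prime_pairs R E uE pE; exists l.
    apply: (le_trans lE); rewrite size_map -cardE -!natrM ler_nat.
    exact: card_block_pairs.
  have -> : (fun t => D t ^+ 2) = fun t => (\sum_(e <- E) cos (twisted_phase (fun=> 0) e t)) ^+ 2.
    by apply/funext => t; rewrite big_map big_enum/=.
  exact: h.
have cD : continuous D by apply: continuous_sum_fun => x; rewrite /twisted_phase/=; exact: continuous_cos_affine.
have cD2 : continuous (fun t => D t ^+ 2) by under eq_fun do rewrite expr2; move=> t; apply: cvgM; exact: cD.
pose u1 t i := \sum_(j | b j == i) cos (t * ln (P j)%:R : R).
pose u2 t i := \sum_(j | b j == i) sin (t * ln (P j)%:R : R).
pose U t i := u1 t i ^+ 2 + u2 t i ^+ 2.
have UNone t : U t None = 1.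
  have bN (F : J -> R) : \sum_(j | b j == None) F j = F None.
    rewrite (eq_bigl (pred1 (None : J))) ?big_pred1_eq//.
    by move=> -[x|].
  by rewrite /U /u1 /u2 !bN cos2Dsin2.
have sumU t : \sum_(i : 'I_K) U t (Some i) = K%:R * v%:R + D t.
  have := sum_block_sqr P b t; rewrite cJ -/(D t).
  rewrite (bigD1 (None : I))//= -/(U t None) UNone -natr1 natrM.
  rewrite (reindex_onto Some (fun x : I => odflt (Ordinal K0) x))/=; last by move=> [x|].
  rewrite (eq_bigl xpredT); last by move=> x /=; rewrite eqxx.
  move=> h; apply: (addrI (1 : R)); rewrite h; ring.
(* Chebyshev's inequality made pointwise: if the block squares total less than [K v / 2], then
   [D <= - K v / 2] and [coefD * D ^+ 2 >= 1], so the claimed bound is at most [0] and the block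
   [None] attains it. The mean of [coefD * D ^+ 2] is at most [4 / K]. *)
pose coefD := 4 / (K%:R * v%:R) ^+ 2 : R.
have cut t : exists i, 0 < U t i /\ L * (1 - coefD * D t ^+ 2) <= ln (U t i).
  have KvR : 0 < K%:R * v%:R :> R by rewrite mulr_gt0.
  have cD0 : 0 <= coefD * D t ^+ 2 by rewrite mulr_ge0 ?sqr_ge0// divr_ge0 ?sqr_ge0.
  have [big|small] := leP (K%:R * v%:R / 2) (\sum_(i : 'I_K) U t (Some i)).
    have [i hi] : exists i : 'I_K, v%:R / 2 <= U t (Some i).
      apply: contrapT => H; move: big; apply/negP; rewrite -ltNge.
      have -> : K%:R * v%:R / 2 = \sum_(i : 'I_K) (v%:R / 2) :> R.
        by rewrite sumr_const card_ord -[(_ / _) *+ K]mulr_natl mulrA.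
      apply: ltr_sum; first by apply/hasP; exists (Ordinal K0); rewrite ?mem_index_enum.
      by move=> i _; rewrite ltNge; apply/negP => h; apply: H; exists i.
    exists (Some i); have U0 : 0 < U t (Some i) by apply: lt_le_trans hi; apply: lt_le_trans v20.
    split => //; apply: (@le_trans _ _ L); last first.
      by rewrite /L ler_ln ?posrE//; apply: lt_le_trans v20.
    by rewrite ler_piMr// gerBl.
  exists None; rewrite UNone ln1; split => //.
  apply: mulr_ge0_le0 => //; rewrite subr_le0.
  have : K%:R * v%:R / 2 <= - D t by move: small; rewrite sumU; move: (K%:R * v%:R) (D t) => x y; lra.
  move=> h; have : (K%:R * v%:R / 2) ^+ 2 <= D t ^+ 2.
    have a0 : 0 <= K%:R * v%:R / 2 :> R by apply: divr_ge0 => //; exact: ltW.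
    rewrite -[D t ^+ 2]sqrrN; apply: lerXn2r => //; rewrite nnegrE//.
    exact: le_trans h.
  rewrite /coefD; move: (K%:R * v%:R) KvR (D t ^+ 2) => x x0 y h2.
  rewrite mulrAC ler_pdivlMr ?exprn_gt0// mul1r.
  by move: h2; rewrite exprMn exprVn (_ : 2 ^+ 2 = 4 :> R); [lra|ring].
have coefl : coefD * l <= 4 / K%:R.
  apply: (@le_trans _ _ (coefD * (K%:R * v%:R * v%:R))).
    by apply: ler_wpM2l => //; rewrite divr_ge0 ?sqr_ge0.
  by rewrite /coefD le_eqVlt; apply/orP; left; apply/eqP; field; rewrite !gt_eqF.
apply: (jessen_zeta_ge N0 ltr01) => s s0 s1.
suff : L * (1 - 4 / K%:R) <= 2 * reg_jessen (zcoef 0) N s.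
  by move: (L * _) (reg_jessen _ _ _) => x y; lra.
(* For fixed [m] the phases are averaged at each [t], with a block depending on [t]; then the mean
   over [t] is taken, and all twists share the mean [2 * reg_jessen (zcoef 0) N s]. *)
apply: (@dyadic_limit_le _ _ (ln s)) => m.
pose ang (th : {ffun I -> 'I_(2 ^ m)}) i : R := dyadic_angle m (th i).
pose G th t := ln (dsq (zcoef 0) N (prime_twist P b (ang th)) t + s).
have cG th : continuous (G th).
  by apply: continuous_ln_dsq => //; exact: completely_additive_prime_twist.
have mG th : has_mean (G th) (2 * reg_jessen (zcoef 0) N s).
  by apply: has_mean_reg_jessen => //; exact: completely_additive_prime_twist.
have mS := @has_mean_sum R _ (index_enum {ffun I -> 'I_(2 ^ m)}) xpredT G (fun=> 2 * reg_jessen (zcoef 0) N s) cG (fun th _ => mG th).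
have cS : continuous (fun t => \sum_(th : {ffun I -> 'I_(2 ^ m)}) G th t) by exact: continuous_sum_fun.
pose e : R := (2 ^+ m)^-1.
have e0 : 0 <= e by rewrite invr_ge0 exprn_ge0.
have e1 : e <= 1 by rewrite invf_le1 ?exprn_gt0// exprn_ege1// ler1n.
pose M : R := #|{ffun I -> 'I_(2 ^ m)}|%:R.
have M0 : 0 < M by rewrite /M ltr0n card_ffun card_ord expn_gt0 expn_gt0.
pose k0 := M * ((1 - e) * L + e * ln s).
pose k1 := - (M * ((1 - e) * (L * coefD))).
have ck0 : continuous (fun _ : R => k0) by move=> t; exact: cvg_cst.
have ck1 : continuous (fun t => k1 * D t ^+ 2) by move=> t; apply: cvgMr; exact: cD2.
have mK := has_meanD ck0 ck1 (@has_mean_cst R k0) (has_meanZ (k := k1) cD2 meanD).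
have : k0 + k1 * l <= \sum_(th : {ffun I -> 'I_(2 ^ m)}) 2 * reg_jessen (zcoef 0) N s.
  apply: (le_has_mean _ cS mK mS).
    by move=> t; apply: cvgD; [exact: ck0|exact: ck1].
  move=> t; have [i [U0 hi]] := cut t.
  have := @phase_average R I m (\sum_(1 <= k < N.+1 | k \notin codom P) cos (t * ln k%:R))
    (\sum_(1 <= k < N.+1 | k \notin codom P) sin (t * ln k%:R)) s (u1 t) (u2 t) i s0 U0.
  rewrite -/M -/e -/(U t i) => h.
  apply: (@le_trans _ _ (M * ((1 - e) * ln (U t i) + e * ln s))).
    rewrite (_ : k0 + k1 * D t ^+ 2 = M * ((1 - e) * (L * (1 - coefD * D t ^+ 2)) + e * ln s)); last first.
      by rewrite /k0 /k1; ring.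
    rewrite ler_pM2l// lerD2r; apply: ler_wpM2l => //; by rewrite subr_ge0.
  apply: (le_trans h); apply: ler_sum => th _.
  by rewrite /G zcoef0 (dsq_prime_twist _ _ _ injP HP).
rewrite sumr_const -[_ *+ _]mulr_natl -/M => h.
rewrite -(ler_pM2l M0); apply: le_trans h.
rewrite (_ : k0 + k1 * l = M * ((1 - e) * (L * (1 - coefD * l)) + e * ln s)); last first.
  by rewrite /k0 /k1; ring.
rewrite ler_pM2l// -/e lerD2r; apply: ler_wpM2l; first by rewrite subr_ge0.
by apply: ler_wpM2l => //; rewrite lerB.
Qed.

End lower_bound_at_0.

(** * Size of the blocks and the growth of [jessen_zeta N 0] *)

Section asymptotics.
Context {R : realType}.

Lemma ln2_ge : 2^-1 <= ln (2 : R).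
Proof.
have h : -1 < - (2^-1 : R) by lra.
have := le_ln1Dx h; rewrite (_ : 1 - 2^-1 = 2^-1 :> R); last by field.
rewrite lnV ?posrE//; lra.
Qed.

Lemma sqrt_sqr_bounds (x : R) : 0 < x -> 0 < Num.sqrt x /\ Num.sqrt x ^+ 2 = x.
Proof. by move=> x0; rewrite sqrtr_gt0 sqr_sqrtr// ltW. Qed.

(** Logarithm of [upper_primes_bound]: the powers of [4] leave [1/2 - 1/3 = 1/6] of [w ^ 4]. With
    [ln w <= w], the primes up to the square root cost at most [8 w ^ 3], which is below
    [w ^ 4 / 10] once [w >= 80]; what remains exceeds [w ^ 4 / 20]. *)
Lemma upper_primes_size (n : nat) (w : R) : (2 < n)%N -> 80 <= w -> n.*2%:R = w ^+ 4 ->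
  w ^+ 4 <= 20 * ln (w ^+ 4) * (size (upper_primes n))%:R.
Proof.
move=> n2 w80 nw; have w0 : 0 < w by lra.
have w20 : 0 <= w ^+ 2 by exact: sqr_ge0.
pose r := Num.truncn (w ^+ 2).
have r1 : r%:R <= w ^+ 2 by rewrite truncn_le.
have r2 : w ^+ 2 < r.+1%:R := truncnS_gt _.
have nr : (n.*2 < r.+1 ^ 2)%N.
  rewrite -(@ltr_nat R) natrX nw (_ : w ^+ 4 = (w ^+ 2) ^+ 2); last by ring.
  by apply: ltrXn2r => //; rewrite nnegrE.
have H := upper_primes_bound n2 nr; set q := size _ in H *.
have x0 : 0 < n.*2%:R :> R by rewrite ltr0n double_gt0; exact: leq_trans n2.
have H2 : n%:R * ln 4 <= (r + q).+1%:R * ln (w ^+ 4) + (n.*2 %/ 3)%:R * ln 4 :> R.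
  move: H; rewrite -(@ler_nat R) natrM !natrX => h.
  have : ln (4%:R ^+ n) <= ln (n.*2%:R ^+ (r + q).+1 * 4%:R ^+ (n.*2 %/ 3)) :> R.
    by rewrite ler_ln ?posrE// ?mulr_gt0 ?exprn_gt0.
  by rewrite lnM ?posrE ?exprn_gt0// !lnXn// nw lnXn// => k; rewrite !mulr_natl.
have d3 : (n.*2 %/ 3)%:R <= w ^+ 4 / 3 :> R.
  by rewrite -nw ler_pdivlMr// -natrM ler_nat leq_trunc_div.
have nE : n%:R = w ^+ 4 / 2 :> R by rewrite -nw -muln2 natrM; field.
have l4 : 1 <= ln (4 : R).
  rewrite (_ : 4 = 2 ^+ 2 :> R); last by ring.
  by rewrite lnXn//; have := ln2_ge; lra.
have l40 : 0 <= ln (4 : R) by lra.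
have lw : 0 <= ln w by rewrite ln_ge0//; lra.
have lww : ln w <= w by exact: ltW (ln_sublinear w0).
have lE : ln (w ^+ 4) = 4 * ln w by rewrite lnXn// mulr_natl.
have w40 : 0 <= w ^+ 4 by rewrite exprn_ge0// ltW.
have H3 : w ^+ 4 / 6 <= (r + q).+1%:R * ln (w ^+ 4).
  have a1 := ler_wpM2r l40 d3.
  have a2 : w ^+ 4 / 6 <= w ^+ 4 / 6 * ln 4 by rewrite ler_peMr// divr_ge0.
  move: H2; rewrite nE; move: a1 a2.
  move: ((n.*2 %/ 3)%:R : R) ((r + q).+1%:R * ln (w ^+ 4)) (w ^+ 4) (ln (4 : R)) => u v x y; lra.
have H4 : (r.+1)%:R * ln (w ^+ 4) <= w ^+ 4 / 10.
  rewrite lE; apply: (@le_trans _ _ ((w ^+ 2 + 1) * (4 * w))).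
    by apply: ler_pM => //; [rewrite mulr_ge0|rewrite -natr1 lerD2r|rewrite ler_pM2l].
  have w1 : 1 <= w ^+ 2 by apply: exprn_ege1; lra.
  apply: (@le_trans _ _ ((w ^+ 2 + w ^+ 2) * (4 * w))); first by apply: ler_wpM2r; [lra|rewrite lerD2l].
  rewrite (_ : w ^+ 4 / 10 = w ^+ 2 * w * (w / 10)); last by field.
  rewrite (_ : _ * (4 * w) = w ^+ 2 * w * 8); last by ring.
  apply: ler_wpM2l; first by rewrite mulr_ge0// ltW.
  lra.
move: H3 H4; rewrite -addSn natrD mulrDl.
rewrite (_ : 20 * _ * _ = 20 * (q%:R * ln (w ^+ 4))); last by ring.
by move: (r.+1%:R * ln (w ^+ 4)) (q%:R * ln (w ^+ 4)) (w ^+ 4) w40 => u v x; clear; lra.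
Qed.

Lemma nat_large (A : R) : exists N0 : nat, forall N, (N0 <= N)%N -> A <= N%:R.
Proof.
exists (Num.truncn A).+1 => N hN; apply: (le_trans (ltW (truncnS_gt A))).
by rewrite ler_nat.
Qed.

Lemma ln_nat_large (A : R) : exists N0 : nat, forall N, (N0 <= N)%N -> A <= ln N%:R.
Proof.
have [N0 H] := nat_large (expR A); exists N0 => N hN.
have e0 : 0 < expR A := expR_gt0 A.
by rewrite -[A]expRK ler_ln ?posrE ?H//; exact: lt_le_trans (H N hN).
Qed.

(** One prime is kept aside and the others are cut into [K] blocks. The constant [160] is
    [2 * 20 * 2 * 2]: from [N <= 2 w ^ 4], from the prime count, from [q <= 2 K v], and from writing
    [v / 2]. *)
Lemma block_size_large (K : nat) : (0 < K)%N -> exists N0 : nat, forall N, (N0 <= N)%N ->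
  exists v : nat, [/\ (2 <= v)%N, (K * v < size (upper_primes N./2))%N &
    N%:R <= 160 * K%:R * ln N%:R * (v%:R / 2) :> R].
Proof.
move=> K0; have [N0 HN0] := nat_large ((80 + K%:R) ^+ 4 + 5).
exists N0 => N hN; have NB := HN0 N hN.
have KR : 1 <= K%:R :> R by rewrite ler1n.
set n := N./2; have Nn : N%:R <= n.*2%:R + 1 :> R.
  by rewrite natr1 ler_nat; have := odd_double_half N; rewrite -/n; clear; case: (odd N); lia.
have nN : n.*2%:R <= N%:R :> R by rewrite ler_nat; have := odd_double_half N; rewrite -/n; clear; lia.
have w80 : (80 + K%:R) ^+ 4 <= n.*2%:R :> R by move: Nn NB; move: ((80 + K%:R) ^+ 4) => y; lra.
have n2 : (2 < n)%N.
  have : 4 < n.*2%:R :> R.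
    have : 0 < (80 + K%:R) ^+ 4 :> R by rewrite exprn_gt0//; lra.
    by move: Nn NB; move: ((80 + K%:R) ^+ 4) => y; lra.
  by rewrite ltr_nat; clear; lia.
have x0 : 0 < n.*2%:R :> R by rewrite ltr0n double_gt0; exact: leq_trans n2.
have [s0 s2] := sqrt_sqr_bounds x0; have [w0 w2] := sqrt_sqr_bounds s0.
set w := Num.sqrt _ in w0 w2; have nw : n.*2%:R = w ^+ 4 by rewrite -s2 -w2 -exprM.
have wK : 80 + K%:R <= w.
  rewrite -(@ler_pXn2r _ 4) ?nnegrE ?(ltW w0)//.
  by rewrite -nw.
have w80' : 80 <= w by lra.
have H := upper_primes_size n2 w80' nw; set q := size _ in H *.
have lw : ln (w ^+ 4) <= 4 * w by rewrite lnXn// -[ln w *+ 4]mulr_natl ler_pM2l//; exact: ltW (ln_sublinear w0).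
have lw0 : 0 < ln (w ^+ 4).
  by apply: ln_gt0; rewrite -nw ltr1n; move: n2; clear; lia.
have q4 : 4 * K%:R + 4 <= q%:R :> R.
  have h1 : w ^+ 4 <= 80 * w * q%:R.
    apply: (le_trans H); apply: ler_wpM2r => //; lra.
  have h2 : w ^+ 3 <= 80 * q%:R.
    by rewrite -(ler_pM2l w0) -exprS mulrCA mulrA.
  have h3 : 80 * 80 * w <= w ^+ 3.
    rewrite exprSr; apply: ler_wpM2r; first exact: ltW.
    by rewrite expr2; apply: ler_pM.
  lra.
exists (q.-1 %/ K)%N.
have q0 : (0 < q)%N by rewrite -(@ltr0n R); lra.
have vK : (K * (q.-1 %/ K) < q)%N by rewrite mulnC; have := leq_trunc_div q.-1 K; move: (_ %/ _ * _)%N q0; clear; lia.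
have vge : q%:R <= 2 * K%:R * (q.-1 %/ K)%:R :> R.
  have : (q.-1 < (q.-1 %/ K).+1 * K)%N by exact: ltn_ceil.
  rewrite -ltnS prednK// ltnS => h.
  have : q%:R <= ((q.-1 %/ K).+1 * K)%:R :> R by rewrite ler_nat.
  rewrite natrM -natr1 mulrDl mul1r mulrC.
  rewrite (_ : 2 * _ * _ = 2 * (K%:R * (q.-1 %/ K)%:R)); last by ring.
  move: (K%:R * _) => y; lra.
have v2 : (2 <= q.-1 %/ K)%N.
  rewrite -(@ler_nat R); have h : 2 * K%:R * 2 <= 2 * K%:R * (q.-1 %/ K)%:R :> R by lra.
  by move: h; rewrite ler_pM2l//; lra.
split => //.
have N2 : N%:R <= 2 * w ^+ 4.
  have : 1 <= n.*2%:R :> R by rewrite ler1n double_gt0; exact: leq_trans n2.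
  by move: Nn; rewrite -nw; clear; lra.
have lN : ln (w ^+ 4) <= ln N%:R by rewrite -nw ler_ln ?posrE//; exact: lt_le_trans nN.
set v : R := (_ %/ _)%:R in vge *.
have v0 : 0 <= v by exact: ler0n.
apply: (le_trans N2).
apply: (@le_trans _ _ (2 * (20 * ln (w ^+ 4) * (2 * K%:R * v)))).
  rewrite ler_pM2l//; apply: (le_trans H); apply: ler_wpM2l => //; lra.
rewrite (_ : 160 * _ * _ * _ = 80 * K%:R * v * ln N%:R); last by field.
rewrite (_ : 2 * _ = 80 * K%:R * v * ln (w ^+ 4)); last by ring.
by apply: ler_wpM2l => //; rewrite !mulr_ge0//; lra.
Qed.

Lemma jessen_zeta0_asymp (e : R) : 0 < e -> exists N0 : nat, forall N, (N0 <= N)%N ->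
  (2^-1 - e) * ln N%:R <= jessen_zeta N 0.
Proof.
move=> e0; have [K0 HK] := nat_large (4 / e + 4).
have e4 : 0 < 4 / e by rewrite divr_gt0.
pose K := K0.+1; have K_gt0 : (0 < K)%N by [].
have KR : 0 < K%:R :> R by rewrite ltr0n.
have Ke : 4 / K%:R <= e.
  rewrite ler_pdivrMr// mulrC -ler_pdivrMr//.
  have : 4 / e + 4 <= K%:R by apply: HK; rewrite /K.
  lra.
have K4 : 0 <= 1 - 4 / K%:R :> R.
  rewrite subr_ge0 ler_pdivrMr// mul1r.
  have : 4 / e + 4 <= K%:R by apply: HK; rewrite /K.
  lra.
have [N1 H1] := block_size_large K_gt0.
pose C := ln (160 * K%:R : R).
(* With [y = ln N], the first threshold gives [ln y <= 2 sqrt y <= (e / 2) y] and the second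
   [C <= (e / 2) y]. Hence [ln (v / 2) >= (1 - e) y], and the factor [1 - 4 / K] costs another
   [e]. *)
have [N2 H2] := ln_nat_large (Num.max ((4 / e) ^+ 2) (Num.max (2 * C / e) 1)).
exists (maxn N1 (maxn N2 1)) => N; rewrite !geq_max => /and3P[hN1 hN2 N0].
have := H2 N hN2; rewrite !ge_max => /and3P[y1 y2 y3].
have [v [v2 Kv Nv]] := H1 N hN1.
apply: le_trans (@jessen_zeta0_lower R _ _ _ N0 K_gt0 v2 Kv).
have NR : 0 < N%:R :> R by rewrite ltr0n.
set y := ln N%:R in y1 y2 y3 Nv *.
have y0 : 0 < y by lra.
have v0 : 0 < v%:R / 2 :> R by rewrite divr_gt0// ltr0n; exact: leq_trans v2.
have K160 : 0 < 160 * K%:R :> R by rewrite mulr_gt0.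
have lv : y <= C + ln y + ln (v%:R / 2).
  have Ky : 0 < 160 * K%:R * y by rewrite mulr_gt0.
  have E : ln (160 * K%:R * y * (v%:R / 2)) = C + ln y + ln (v%:R / 2).
    by rewrite lnM ?posrE// [ln (160 * K%:R * y)]lnM ?posrE.
  by rewrite -E {1}/y ler_ln ?posrE// mulr_gt0.
have [s0 s2] := sqrt_sqr_bounds y0.
have ly : ln y <= 2 * Num.sqrt y.
  by rewrite -{1}s2 lnXn// -[ln _ *+ 2]mulr_natl ler_pM2l//; exact: ltW (ln_sublinear s0).
have sy : 2 * Num.sqrt y <= e / 2 * y.
  have : 4 / e <= Num.sqrt y by rewrite -(@ler_pXn2r _ 2) ?nnegrE ?divr_ge0 ?(ltW e0) ?(ltW s0)// s2.
  rewrite ler_pdivrMr// => h; rewrite -{2}s2 expr2 mulrA; apply: ler_wpM2r; first exact: ltW.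
  by move: h; rewrite mulrC; lra.
have Cy : C <= e / 2 * y by move: y2; rewrite ler_pdivrMr// [y * e]mulrC; lra.
have L : (1 - e) * y <= ln (v%:R / 2) by rewrite mulrBl mul1r; lra.
(* For [e >= 1/2] the claimed bound is nonpositive; otherwise both factors are nonnegative and their
   lower bounds can be multiplied. *)
have [e1|e1] := leP 2^-1 e.
  apply: (@le_trans _ _ 0); first by apply: mulr_le0_ge0; [lra|exact: ltW].
  have L0 : 0 <= ln (v%:R / 2 : R) by apply: ln_ge0; rewrite ler_pdivlMr// mul1r ler_nat.
  by rewrite mulr_ge0// mulr_ge0.
have L0 : 0 <= (1 - e) * y by apply: mulr_ge0; lra.
have h1 : (1 - e) * y * (1 - e) <= ln (v%:R / 2) * (1 - 4 / K%:R).
  by apply: ler_pM => //; lra.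
have : (1 - 2 * e) * y <= (1 - e) * y * (1 - e).
  rewrite -subr_ge0 (_ : _ - _ = e ^+ 2 * y); last by ring.
  by rewrite mulr_ge0 ?sqr_ge0 ?(ltW y0).
move: h1; move: (ln _ * _) => z; rewrite mulrBl [(_ - e) * y]mulrBl; lra.
Qed.

End asymptotics.

(** * The locally uniform limit *)

Section uniform_asymptotics.
Context {R : realType}.

Lemma ln_ln_small (e : R) : 0 < e -> exists N0 : nat, forall N, (N0 <= N)%N ->
  [/\ (2 <= N)%N, 1 <= ln (N%:R : R), 2^-1 * ln (1 + ln N%:R) <= e * ln N%:R & ln 2 <= e * ln N%:R].
Proof.
move=> e0; have [N0 H] := @ln_nat_large R (Num.max 1 (Num.max (2 / e ^+ 2) (ln 2 / e))).
exists (maxn N0 2) => N; rewrite geq_max => /andP[hN N2].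
have := H N hN; rewrite !ge_max => /and3P[].
move: (ln N%:R) => y y1 y2 y3; split => //; last by rewrite mulrC -ler_pdivrMr.
have y0 : 0 < 1 + y by lra.
have [s0 s2] := sqrt_sqr_bounds y0.
have E : ln (1 + y) = 2 * ln (Num.sqrt (1 + y)) by rewrite -{1}s2 lnXn// mulr_natl.
have := ltW (ln_sublinear s0); move: E.
have : Num.sqrt (1 + y) <= e * y.
  have ey0 : 0 <= e * y by apply: mulr_ge0; lra.
  rewrite -(@ler_pXn2r _ 2) ?nnegrE ?(ltW s0)// s2.
  move: y2; rewrite ler_pdivrMr ?exprn_gt0// => y2.
  have : 2 * y <= y * e ^+ 2 * y by apply: ler_wpM2r => //; lra.
  rewrite exprMn (_ : y * e ^+ 2 * y = e ^+ 2 * y ^+ 2); [|by ring].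
  move: (e ^+ 2 * _) => z; lra.
move: (Num.sqrt _) (ln _) (ln _) (e * y) => a b c d; lra.
Qed.

(** The lower bound has three regimes: [- ln 2] for [sigma >= 1/2]; the slope bound starting from
    [0] for [0 <= sigma < 1/2]; and for [sigma < 0] convexity at [sigma < 0 < 1/2], with the lower
    bound at [0] and the upper bound at [1/2]. *)
Lemma jessen_zeta_uniform (A e : R) : 0 <= A -> 0 < e -> exists N0 : nat, forall N, (N0 <= N)%N ->
  forall sigma, `|sigma| <= A -> `|jessen_zeta N sigma / ln N%:R - Num.max (2^-1 - sigma) 0| <= e.
Proof.
move=> A0 e0; pose d := e / (4 * (1 + A)).
have d0 : 0 < d by rewrite divr_gt0// mulr_gt0//; lra.
have dE : 4 * d * (1 + A) = e by rewrite /d; field; rewrite gt_eqF//; lra.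
have de : d <= e.
  by have := mulr_ge0 (ltW d0) A0; move: dE; rewrite mulrDr mulr1 -mulrA; move: (d * A) => x; lra.
have [N1 H1] := ln_ln_small d0; have [N2 H2] := jessen_zeta0_asymp d0.
exists (maxn N1 N2) => N; rewrite geq_max => /andP[hN1 hN2] sigma sA.
have [N2' y1 yd l2] := H1 N hN1; have J0 := H2 N hN2.
have N0 : (0 < N)%N by exact: leq_trans N2'.
have up x := @jessen_zeta_upper R N x N0.
have lo x := @jessen_zeta_lower R N x N0.
have J_half : jessen_zeta N 2^-1 <= d * ln N%:R.
  by have := up 2^-1; rewrite subrr maxxx mul0r add0r => /le_trans; apply.
have sl := @jessen_zeta_slope_ge R N 0 sigma N2'.
have cv := jessen_zeta_convex N0 (_ : sigma < 0) (_ : 0 < 2^-1).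
have {up} up := le_trans (up sigma) (lerD (lexx _) yd).
set y := ln N%:R in y1 up l2 J0 J_half sl *.
have y0 : 0 < y := lt_le_trans ltr01 y1.
set m := Num.max _ _ in up *.
move: (lo sigma) sl cv up J0 J_half; move: (jessen_zeta N sigma) (jessen_zeta N 0) (jessen_zeta N 2^-1) => j j0 jh {}lo sl cv up J0 J_half.
have ey : d * y <= e * y by rewrite ler_pM2r.
rewrite ler_norml; apply/andP; split; last first.
  rewrite lerBlDr ler_pdivrMr// mulrDl addrC; apply: (le_trans up).
  by rewrite lerD2l.
rewrite lerBrDr ler_pdivlMr// mulrDl mulNr.
suff : m * y <= j + e * y by move: (m * y) (e * y); clear => a b; lra.
have j1 : 0 <= j + e * y by move: lo l2 ey; clear; lra.
rewrite /m maxEle; case: ifP => hs; first by rewrite mul0r.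
have [s0|s0] := leP 0 sigma.
  have := sl s0; rewrite mul0r addr0 => k.
  move: k J0 ey; rewrite !mulrBl; move: (sigma * y) (d * y) (e * y) (2^-1 * y) => a b c f; clear; lra.
have h2 : 0 < 2^-1 :> R by rewrite invr_gt0.
have := cv s0 h2; rewrite subr0 sub0r => k.
have sA' : - sigma <= A by move: sA; rewrite ler_norml => /andP[? _]; rewrite lerNl.
have s0' : 0 <= - sigma by rewrite oppr_ge0 ltW.
have k2 : jh * - sigma <= d * y * - sigma by apply: ler_wpM2r.
have k3 : (2^-1 - d) * y * (2^-1 - sigma) <= j0 * (2^-1 - sigma).
  by apply: ler_wpM2r => //; move: s0'; clear; lra.
have k4 : d * (1 + 4 * - sigma) * y <= e * y.
  rewrite ler_pM2r//; apply: (@le_trans _ _ (d * (4 * (1 + A)))); last by rewrite -dE mulrA [d * 4]mulrC.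
  by rewrite ler_pM2l//; move: sA'; clear; lra.
have k5 : (2^-1 - d) * y * (2^-1 - sigma) <= j * 2^-1 + d * y * - sigma.
  by move: k k2 k3; clear; lra.
rewrite -subr_ge0 (_ : _ - _ = 2 * (j * 2^-1 + d * y * - sigma - (2^-1 - d) * y * (2^-1 - sigma)) + (e * y - d * (1 + 4 * - sigma) * y)); last by field.
by apply: addr_ge0; rewrite ?mulr_ge0// subr_ge0.
Qed.

End uniform_asymptotics.

Section right_derivative_convex.
Context {R : realType} (f : R -> R) (L : R).
Context (cf : convex_real f).
Context (lipf : forall x y, x <= y -> - L * (y - x) <= f y - f x <= 0).

Let slope x h := h^-1 * (f (x + h) - f x).

Lemma slope_nondecreasing x h k : 0 < h -> h <= k -> slope x h <= slope x k.
Proof.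
move=> h0; rewrite le_eqVlt => /orP[/eqP->//|hk]; have k0 := lt_trans h0 hk.
have x1 : x < x + h by rewrite ltrDl.
have x2 : x + h < x + k by rewrite ltrD2l.
have := cf x1 x2; rewrite (_ : x + k - x = k); last by ring.
rewrite (_ : x + k - (x + h) = k - h); last by ring.
rewrite (_ : x + h - x = h); last by ring.
move=> H; rewrite /slope ler_pdivrMl// mulrCA ler_pdivlMl//.
by move: H; move: (f _) (f _) (f _) => a b c; rewrite !mulrBr; clear; lra.
Qed.

Lemma slope_left_le x h k : 0 < h -> 0 < k -> h^-1 * (f x - f (x - h)) <= slope x k.
Proof.
move=> h0 k0.
have x1 : x - h < x by rewrite gtrBl.
have x2 : x < x + k by rewrite ltrDl.
have := cf x1 x2; rewrite (_ : x + k - (x - h) = h + k); last by ring.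
rewrite (_ : x + k - x = k); last by ring.
rewrite (_ : x - (x - h) = h); last by ring.
move=> H; rewrite /slope ler_pdivrMl// mulrCA ler_pdivlMl//.
by move: H; move: (f _) (f _) (f _) => a b c; clear; lra.
Qed.

Lemma slope_le0 x h : 0 < h -> slope x h <= 0.
Proof.
move=> h0; have xh : x <= x + h by rewrite lerDl ltW.
have /andP[_ H] := lipf xh.
by rewrite /slope pmulr_rle0 ?invr_gt0.
Qed.

Lemma slope_geN x h : 0 < h -> - L <= slope x h.
Proof.
move=> h0; have xh : x <= x + h by rewrite lerDl ltW.
have /andP[H _] := lipf xh.
by rewrite /slope ler_pdivlMl//; move: H; rewrite (_ : x + h - x = h) 1?mulrC//; ring.
Qed.

Lemma cvg_right_derivative x : slope x h @[h --> 0^'+] --> right_derivative f x.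
Proof.
suff : cvg (slope x h @[h --> 0^'+]) by [].
apply: nondecreasing_at_right_is_cvgr.
- near=> y => h k; rewrite !in_itv/= => /andP[h0 _] _ hk.
  exact: slope_nondecreasing.
- near=> y; exists (- L) => z [h /=]; rewrite in_itv/= => /andP[h0 _] <-.
  exact: slope_geN.
Unshelve. all: by end_near. Qed.

Lemma right_derivative_le_slope x h : 0 < h -> right_derivative f x <= slope x h.
Proof.
move=> h0; apply: (limr_le (cvgP _ (@cvg_right_derivative x))).
near=> k; apply: slope_nondecreasing.
  by near: k; exact: nbhs_right_gt.
by near: k; exact: nbhs_right_le.
Unshelve. all: by end_near. Qed.

Lemma right_derivative_ge_slope x h : 0 < h -> h^-1 * (f x - f (x - h)) <= right_derivative f x.
Proof.
move=> h0; apply: (limr_ge (cvgP _ (@cvg_right_derivative x))).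
near=> k; apply: slope_left_le => //.
Unshelve. all: by end_near. Qed.

Lemma right_derivative_le0 x : right_derivative f x <= 0.
Proof. exact: le_trans (right_derivative_le_slope x ltr01) (slope_le0 x ltr01). Qed.

Lemma right_derivative_geN x : - L <= right_derivative f x.
Proof.
apply: le_trans (right_derivative_ge_slope x ltr01).
have := slope_geN (x - 1) ltr01; by rewrite /slope subrK.
Qed.

Lemma right_derivative_nondecreasing : nondecreasing (right_derivative f).
Proof.
move=> x y; rewrite le_eqVlt => /orP[/eqP->//|xy].
have yx : 0 < y - x by rewrite subr_gt0.
apply: (le_trans (right_derivative_le_slope x yx)).
have := right_derivative_ge_slope y yx.
by rewrite /slope [x + _]addrC subrK subKr.
Qed.

Lemma lipschitz_continuous : continuous f.
Proof.
have L0 : 0 <= L.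
  have := lipf (ler01 : (0 : R) <= 1); lra.
have key x y : `|f x - f y| <= L * `|x - y|.
  wlog xy : x y / x <= y.
    by move=> H; have [xy|/ltW yx] := leP x y; [exact: H|rewrite distrC [`|x - y|]distrC; exact: H].
  have /andP[h1 h2] := lipf xy.
  rewrite distrC [`|x - y|]distrC ler0_norm// ger0_norm ?subr_ge0//.
  by rewrite lerNl -mulNr.
move=> x; apply/cvgrPdist_le => e e0.
have e1 : 0 < e / (L + 1) by rewrite divr_gt0//; lra.
near=> y; apply: (le_trans (key x y)).
have : `|x - y| <= e / (L + 1) by near: y; exact: (@cvgr_dist_le _ _ _ _ _ id _ (@cvg_id _ _) _ e1).
rewrite ler_pdivlMr; last by lra.
have := normr_ge0 (x - y); move: `|x - y| => z z0; rewrite mulrDr mulr1 mulrC; lra.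
Unshelve. all: by end_near. Qed.

Lemma right_derivative_right_continuous : right_continuous (right_derivative f).
Proof.
move=> x; apply/cvgrPdist_le => e e0.
have e2 : 0 < e / 2 by rewrite divr_gt0.
have /cvgrPdist_le/(_ _ e2) H := @cvg_right_derivative x.
have [h [h0 hh]] : exists h, 0 < h /\ `|right_derivative f x - slope x h| <= e / 2.
  have [h [h1 h2]] := filter_ex (filterI H (@nbhs_right_gt R 0)).
  by exists h.
have cs : {for x, continuous (fun y => slope y h)}.
  apply: cvgMr; apply: cvgB; last exact: lipschitz_continuous.
  have : {for x, continuous (f \o (fun y => y + h))}.
    by apply: continuous_comp; [apply: cvgD; [exact: cvg_id|exact: cvg_cst]|exact: lipschitz_continuous].
  by [].
have /cvgrPdist_le/(_ _ e2) Hs := cvg_at_right_filter cs.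
near=> y.
have xy : x <= y by near: y; exact: nbhs_right_ge.
have a1 := right_derivative_nondecreasing xy.
have a2 := right_derivative_le_slope y h0.
have a3 : `|slope x h - slope y h| <= e / 2 by near: y.
have /ler_normlP[b1 _] := a3; have /ler_normlP[b2 _] := hh.
rewrite ler0_norm ?subr_le0//; move: a1 a2 b1 b2.
move: (right_derivative f x) (right_derivative f y) (slope x h) (slope y h).
clear; move=> a b c d; lra.
Unshelve. all: by end_near. Qed.

Lemma right_derivative_cvgy a B : (forall x, a <= x -> `|f x| <= B) -> right_derivative f @ +oo --> 0.
Proof.
move=> fB; apply/cvgrPdist_le => e e0; near=> x.
rewrite sub0r normrN ler0_norm ?right_derivative_le0//.
have ax : a < x by near: x; apply: nbhs_pinfty_gt; rewrite num_real.
have xa : 0 < x - a by rewrite subr_gt0.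
have := right_derivative_ge_slope x xa; rewrite (_ : x - (x - a) = a); last by ring.
have : - e <= (x - a)^-1 * (f x - f a).
  rewrite ler_pdivlMl//.
  have : a + (2 * B) / e <= x by near: x; apply: nbhs_pinfty_ge; rewrite num_real.
  rewrite -lerBrDl ler_pdivrMr//.
  have /ler_normlP[fx _] := fB x (ltW ax); have /ler_normlP[_ fa] := fB a (lexx a).
  move: ((x - a) * e) ((x - a) * - e) (mulrN (x - a) e) => u v ->; lra.
lra.
Unshelve. all: by end_near. Qed.

Lemma right_derivative_cvgNy a B : (forall x, x <= a -> `|f x + L * x| <= B) ->
  right_derivative f @ -oo --> - L.
Proof.
move=> fB; apply/cvgrPdist_le => e e0; near=> x.
have := right_derivative_geN x => g1.
rewrite ler0_norm ?subr_le0// opprB opprK.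
have ax : x < a by near: x; apply: nbhs_ninfty_lt; rewrite num_real.
have xa : 0 < a - x by rewrite subr_gt0.
have := right_derivative_le_slope x xa; rewrite /slope (_ : x + (a - x) = a); last by ring.
have : (a - x)^-1 * (f a - f x) <= - L + e.
  rewrite ler_pdivrMl//.
  have : x <= a - (2 * B) / e by near: x; apply: nbhs_ninfty_le; rewrite num_real.
  rewrite lerBrDl -lerBrDr ler_pdivrMr//.
  have /ler_normlP[fx _] := fB x (ltW ax); have /ler_normlP[_ fa] := fB a (lexx a).
  rewrite (_ : (a - x) * (- L + e) = (a - x) * e - L * a + L * x); last by ring.
  move: ((a - x) * e) (L * a) (L * x) fx fa => u v w fx fa; clear -fx fa; lra.
lra.
Unshelve. all: by end_near. Qed.

End right_derivative_convex.

Section second_derivative_measure.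
Context {R : realType} (f : R -> R).
Context (fD : nondecreasing (right_derivative f)) (fC : right_continuous (right_derivative f)).

Lemma second_derivative_itvoc (a b : R) : a <= b ->
  second_derivative f `]a, b]%classic = (right_derivative f b - right_derivative f a)%:E.
Proof.
move=> ab; rewrite /second_derivative; case: pselect => [h|/(_ (conj fD fC))//].
rewrite /= /lebesgue_stieltjes_measure /measure_extension measurable_mu_extE/=; last exact: is_ocitv.
by rewrite wlength_itv_bnd.
Qed.

Lemma second_derivative_setT (l r : R) :
  right_derivative f @ -oo --> l -> right_derivative f @ +oo --> r ->
  second_derivative f [set: R] = (r - l)%:E.
Proof.
move=> Hl Hr; set mu := second_derivative f.
rewrite -(@bigcup_itvT R false false).
pose I n : set R := `]- (n%:R), n%:R]%classic.
have H1 : (mu \o I) n @[n --> \oo] --> (r - l)%:E.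
  have -> : mu \o I = (fun n => (right_derivative f n%:R - right_derivative f (- n%:R))%:E).
    by apply/funext => n; rewrite /= second_derivative_itvoc// ge0_cp.
  apply: cvg_EFin; first by near=> n.
  apply: cvgB.
    exact: (cvg_comp _ _ (@cvgr_idn R)).
  apply: (cvg_ninftyP _ _).1 => //.
  by apply: (cvg_comp _ _ (@cvgr_idn R)); rewrite ninfty.
have H2 : (mu \o I) n @[n --> \oo] --> mu (\bigcup_n I n).
  apply: nondecreasing_cvg_mu; rewrite /I//; first exact: bigcup_measurable.
  by move=> *; apply/subsetPset/subset_itv; rewrite leBSide/= ?lerN2 ler_nat.
exact: cvg_unique H2 H1.
Unshelve. all: end_near. Qed.

End second_derivative_measure.

Section concentration.
Context {R : realType}.
Local Open Scope ereal_scope.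

Lemma integral_near_point (mu : {measure set (measurableTypeR R) -> \bar R}) (f : R -> R)
    (A : set (measurableTypeR R)) (c e M : R) :
  mu [set: R] = 1 -> measurable A -> continuous f -> (forall x, (`|f x| <= M)%R) ->
  (0 <= e)%R -> (forall x, A x -> (`|f x - f c| <= e)%R) ->
  `|\int[mu]_x (f x)%:E - (f c)%:E| <= e%:E + (2 * M)%:E * (1 - mu A).
Proof.
move=> mu1 mA cf fM e0 fA.
have M0 : (0 <= 2 * M)%R by rewrite mulr_ge0//; exact: le_trans (normr_ge0 _) (fM c).
have muT : mu [set: measurableTypeR R] < +oo by rewrite mu1 ltry.
have mf : measurable_fun [set: measurableTypeR R] (f : measurableTypeR R -> R).
  exact: continuous_measurable_fun.
have If : mu.-integrable [set: measurableTypeR R] (EFin \o f).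
  apply: measurable_bounded_integrable => //.
  by exists M; split; [rewrite num_real|move=> x Mx t _ /=; exact: le_trans (fM t) (ltW Mx)].
have Ic : mu.-integrable [set: measurableTypeR R] (EFin \o cst (f c)).
  apply: measurable_bounded_integrable => //.
  by exists M; split; [rewrite num_real|move=> x Mx t _ /=; exact: le_trans (fM c) (ltW Mx)].
have <- : \int[mu]_x (f c)%:E = (f c)%:E.
  by rewrite integral_cst// mu1 mule1.
rewrite -integralB_EFin//.
apply: (le_trans (le_abse_integral _ _ _)) => //.
  by apply/measurable_EFinP; apply: measurable_funB.
have muC : mu (~` A) = 1 - mu A.
  rewrite -mu1 -setTD measureD// setTI//.
rewrite -muC.
apply: (@le_trans _ _ (\int[mu]_x (e%:E + (2 * M)%:E * (\1_(~` A) x)%:E))).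
  apply: ge0_le_integral => //.
  - apply: measurableT_comp => //; apply/measurable_EFinP; apply: measurable_funB => //.
  - apply: emeasurable_funD => //; apply: emeasurable_funM => //.
    by apply/measurable_EFinP; apply: measurable_indic; exact: measurableC.
  - move=> x _; rewrite -EFinB abse_EFin -EFinM -EFinD lee_fin indicE in_setC.
    have [Ax|nAx] := boolP (x \in A); rewrite /= ?mulr0 ?addr0 ?mulr1.
      by apply: fA; exact: set_mem.
    apply: (le_trans (ler_normB _ _)); have := fM x; have := fM c; move: `|_|%R `|_|%R => u v; lra.
rewrite ge0_integralD//; last 2 first.
  by move=> x _; rewrite mule_ge0.
  apply: emeasurable_funM => //.
  by apply/measurable_EFinP; apply: measurable_indic; exact: measurableC.
rewrite integral_cst// [X in e%:E * X]mu1 mule1 ge0_integralZl//; last first.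
  by apply/measurable_EFinP; apply: measurable_indic; exact: measurableC.
by rewrite integral_indic ?setIT//; exact: measurableC.
Qed.

End concentration.

Section zeta_measure.
Context {R : realType}.
Implicit Types (N : nat).
Let J N : R -> R := jessen_zeta N.

Lemma jessen_zeta_slope_bounds N (x y : R) : (2 <= N)%N -> x <= y ->
  - ln N%:R * (y - x) <= J N y - J N x <= 0.
Proof.
move=> N2 xy; have N0 : (0 < N)%N by exact: leq_trans N2.
apply/andP; split; last by rewrite subr_le0 /J jessen_zeta_nonincreasing.
have := @jessen_zeta_slope_ge R N x y N2 xy; rewrite -/(J N x) -/(J N y).
rewrite (_ : - ln N%:R * (y - x) = x * ln N%:R - y * ln N%:R); last by ring.
by move: (_ * _) (_ * _) (J N x) (J N y) => a b c d; clear; lra.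
Qed.

Lemma right_derivative_jessen_zeta N : (2 <= N)%N ->
  nondecreasing (right_derivative (J N)) /\ right_continuous (right_derivative (J N)).
Proof.
move=> N2; have N0 : (0 < N)%N by exact: leq_trans N2.
have cJ := @jessen_zeta_convex R N N0.
have lJ := fun x y => @jessen_zeta_slope_bounds N x y N2.
by split; [exact: (right_derivative_nondecreasing cJ lJ)
          |exact: (right_derivative_right_continuous cJ lJ)].
Qed.

Lemma normalized_jessen_measure_itvoc N (a b : R) : (2 <= N)%N -> a <= b ->
  normalized_jessen_measure N `]a, b]%classic =
  ((ln N%:R)^-1 * (right_derivative (J N) b - right_derivative (J N) a))%:E.
Proof.
move=> N2 ab; have [hD hC] := right_derivative_jessen_zeta N2.
rewrite /normalized_jessen_measure /= /mscale /=.
by rewrite -[second_derivative _ _]/(second_derivative (J N) _) second_derivative_itvoc.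
Qed.

Lemma normalized_jessen_measure_setT N : (2 <= N)%N ->
  normalized_jessen_measure N [set: R] = 1%E.
Proof.
move=> N2; have N0 : (0 < N)%N by exact: leq_trans N2.
have [hD hC] := right_derivative_jessen_zeta N2.
have cJ := @jessen_zeta_convex R N N0.
have lJ := fun x y => @jessen_zeta_slope_bounds N x y N2.
rewrite /normalized_jessen_measure /= /mscale /=.
rewrite -[second_derivative _ _]/(second_derivative (J N) _).
rewrite (@second_derivative_setT _ _ hD hC (- ln N%:R) 0).
- rewrite sub0r opprK -EFinM mulVf// gt_eqF// ln_gt0//.
  by rewrite ltr1n.
- have [a Ha] := @jessen_zeta_left R N N2.
  apply: (right_derivative_cvgNy cJ lJ (a := a) (B := ln 2)) => x xa.
  by rewrite mulrC; exact: Ha.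
- apply: (right_derivative_cvgy cJ lJ (a := 5) (B := ln 2)) => x xa.
  exact: jessen_zeta_right.
Qed.

Lemma normalized_jessen_measure_concentrates (d e : R) : 0 < d -> 0 < e ->
  exists N0 : nat, forall N, (N0 <= N)%N ->
  ((1 - e)%:E <= normalized_jessen_measure N `](2^-1 - d)%R, (2^-1 + d)%R]%classic)%E.
Proof.
move=> d0 e0; pose q := e * d / 4.
have q0 : 0 < q by rewrite divr_gt0// mulr_gt0.
have A0 : 0 <= 2^-1 + d by rewrite addr_ge0// ltW.
have [N1 H] := @jessen_zeta_uniform R (2^-1 + d) q A0 q0.
exists (maxn N1 2) => N; rewrite geq_max => /andP[hN N2].
have N0 : (0 < N)%N by exact: leq_trans N2.
have cJ := @jessen_zeta_convex R N N0.
have lJ := fun x y => @jessen_zeta_slope_bounds N x y N2.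
have L0 : 0 < ln (N%:R : R) by rewrite ln_gt0// ltr1n.
rewrite normalized_jessen_measure_itvoc//; last by move: d0; clear; lra.
rewrite lee_fin.
have HN := H N hN; move: HN; rewrite -/(J N) => HN.
have h1 := HN (2^-1 - d); have h2 := HN 2^-1; have h3 := HN (2^-1 + d).
have {}h1 : d - q <= J N (2^-1 - d) / ln N%:R.
  have k : `|2^-1 - d| <= 2^-1 + d by rewrite ler_norml; apply/andP; split; move: d0; clear; lra.
  have /ler_normlP[+ _] := h1 k.
  rewrite (_ : 2^-1 - (2^-1 - d) = d); last by ring.
  rewrite max_l; last exact: ltW.
  by move: (_ / _) (q) => u v; clear; lra.
have {}h2 : - q <= J N 2^-1 / ln N%:R <= q.
  have k : `|2^-1| <= 2^-1 + d :> R by rewrite ger0_norm ?lerDl ?ltW// invr_ge0.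
  by have := h2 k; rewrite subrr maxxx subr0 ler_norml.
have {}h3 : J N (2^-1 + d) / ln N%:R >= - q.
  have k : `|2^-1 + d| <= 2^-1 + d by rewrite ger0_norm.
  have /ler_normlP[+ _] := h3 k.
  rewrite max_r; last by move: d0; clear; lra.
  by rewrite subr0; move: (_ / _) (q) => u v; clear; lra.
have s1 := right_derivative_ge_slope cJ lJ (2^-1 + d) d0; have s2 := right_derivative_le_slope cJ lJ (2^-1 - d) d0.
rewrite -/(J N) addrK in s1; rewrite -/(J N) subrK in s2.
rewrite mulrBr; move: h1 h2 h3 s1 s2 L0.
move: (J N (2^-1 - d)) (J N 2^-1) (J N (2^-1 + d)) (right_derivative (J N) (2^-1 - d))
  (right_derivative (J N) (2^-1 + d)) (ln N%:R) => u v w s t L.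
move=> h1 /andP[h2 h2'] h3 ht hs L0.
have {}ht : - (2 * q / d) <= L^-1 * t.
  apply: (@le_trans _ _ (L^-1 * (d^-1 * (w - v)))); last by rewrite ler_pM2l// invr_gt0.
  rewrite (_ : - (2 * q / d) = d^-1 * (- q - q)); last by field; rewrite gt_eqF.
  rewrite (_ : L^-1 * _ = d^-1 * (w / L - v / L)); last by field; rewrite !gt_eqF.
  by rewrite ler_pM2l ?invr_gt0//; apply: lerB.
have {}hs : L^-1 * s <= -1 + 2 * q / d.
  apply: (@le_trans _ _ (L^-1 * (d^-1 * (v - u)))); first by rewrite ler_pM2l// invr_gt0.
  rewrite (_ : -1 + 2 * q / d = d^-1 * (q - (d - q))); last by field; rewrite gt_eqF.
  rewrite (_ : L^-1 * _ = d^-1 * (v / L - u / L)); last by field; rewrite !gt_eqF.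
  by rewrite ler_pM2l ?invr_gt0//; apply: lerB.
have : 2 * q / d = e / 2 by rewrite /q; field; rewrite gt_eqF.
by move: hs ht; move: (L^-1 * s) (L^-1 * t) (_ / d) => a b c; clear; lra.
Qed.

Lemma normalized_jessen_measure_weak_cvg :
  weakly_converges (@normalized_jessen_measure R) \d_(2^-1 : measurableTypeR R).
Proof.
move=> f cf [M0 [_ fM0]].
pose M := `|M0| + 1.
have fM x : `|f x| <= M by apply: (fM0 M) => //; rewrite /M (le_lt_trans (ler_norm _))// ltrDl.
have M1 : 1 <= M by rewrite /M lerDr.
rewrite integral_dirac//; last by apply/measurable_EFinP; exact: continuous_measurable_fun.
rewrite diracT mul1e.
have key (e : R) : 0 < e -> exists N0 : nat, forall N, (N0 <= N)%N ->
    (`|\int[normalized_jessen_measure N]_x (f x)%:E - (f 2^-1)%:E| <= e%:E)%E.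
  move=> e0; have e2 : 0 < e / 2 by rewrite divr_gt0.
  have e4 : 0 < e / (4 * M) by rewrite divr_gt0// mulr_gt0//; move: M1; clear; lra.
  have /cvgrPdist_le/(_ _ e2)/nbhs_ballP[r /= r0 Hr] := cf 2^-1.
  have r2 : 0 < r / 2 by rewrite divr_gt0.
  have [N1 H] := normalized_jessen_measure_concentrates r2 e4.
  exists (maxn N1 2) => N; rewrite geq_max => /andP[hN N2].
  apply: (le_trans (@integral_near_point _ _ f `](2^-1 - r / 2), (2^-1 + r / 2)]%classic 2^-1 (e / 2) M (normalized_jessen_measure_setT N2) _ cf fM _ _)).
  - by [].
  - exact: ltW.
  - move=> x /=; rewrite in_itv/= => /andP[x1 x2]; rewrite distrC; apply: Hr.
    by rewrite /ball/= ltr_norml; apply/andP; split; move: x1 x2 r0; clear; lra.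
  have := H N hN; rewrite normalized_jessen_measure_itvoc//; last by move: r0; clear; lra.
  rewrite lee_fin -EFinB -EFinM -EFinD lee_fin; move: ((ln _)^-1 * _) => u hu.
  rewrite -lerBrDl (_ : e - e / 2 = (2 * M) * (e / (4 * M))); last first.
    by field; rewrite gt_eqF//; move: M1; clear; lra.
  have M2 : 0 < 2 * M by move: M1; clear; lra.
  by rewrite (ler_pM2l M2); move: hu; move: (e / _) => v; clear; lra.
have fin (e : R) (I : \bar R) : (`|I - (f 2^-1)%:E| <= e%:E)%E -> I \is a fin_num.
  by case: I.
apply/fine_cvgP; split.
  have [N0 H] := key 1 ltr01.
  by exists N0 => // N /= hN; exact: fin (H N hN).
apply/cvgrPdist_le => e e0; have [N0 H] := key e e0.
exists N0 => // N /= hN; have := H N hN.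
by move: (fin _ _ (H N hN)) => /fineK <-; rewrite -EFinB abse_EFin lee_fin distrC.
Qed.

Lemma jessen_zeta_family_cvg :
  {family compact, (fun (N : nat) (sigma : R) => jessen_zeta N sigma / ln N%:R) @ \oo -->
    (fun sigma : R => Num.max (2^-1 - sigma) 0)}.
Proof.
apply/fam_cvgP => A cA P /uniform_nbhs [E [eE EP]].
have [B [_ HB]] := compact_bounded cA.
move: eE; rewrite -entourage_ballE => -[e /= e0 Ee].
have e2 : 0 < e / 2 by rewrite divr_gt0.
have A0 : 0 <= `|B| + 1 by rewrite addr_ge0.
have [N0 H] := @jessen_zeta_uniform R (`|B| + 1) (e / 2) A0 e2.
exists N0 => // N /= hN; apply: EP => y Ay; apply: Ee => /=.
rewrite /ball/= distrC; apply: (@le_lt_trans _ _ (e / 2)); last by move: e0; clear; lra.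
apply: H => //; apply: (HB (`|B| + 1)) => //.
by rewrite (le_lt_trans (ler_norm _))// ltrDl.
Qed.

End zeta_measure.

Theorem theorem2p4 (R : realType) :
  {family compact, (fun (N : nat) (sigma : R) => jessen_zeta N sigma / ln N%:R) @ \oo -->
    (fun sigma : R => Num.max (2^-1 - sigma) 0)} /\
  (forall N : nat, (2 <= N)%N -> normalized_jessen_measure N [set: R] = 1%E) /\
  weakly_converges (@normalized_jessen_measure R) \d_(2^-1 : measurableTypeR R).
Proof.
split; first exact: jessen_zeta_family_cvg.
by split; [exact: normalized_jessen_measure_setT|exact: normalized_jessen_measure_weak_cvg].
Qed.
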